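(* Let $D$ be a planar knotoid diagram. (1) If $-D$ is the inverse of $D$, then $H_{-D}(t,y,z)=H_D(t^{-1},y,z)$. (2) If $D^*$ is the mirror image of $D$, then $H_{D^*}(t,y,z)=-H_D(t^{-1},y,z^{-1})$. (3) If $D$ is zero height, then $H_D(t,y,z)=0$.
   Context: **Planar knotoid diagrams.** A planar knotoid diagram $D$ is a generic immersion of the oriented interval $[0,1]$ into $\mathbb{R}^2$ with finitely many transverse double points (crossings), each carrying over/under information. It is oriented from $0$ to $1$. The images of $0$ and $1$ are the tail and the head; they are distinct from the double points. The sign $\operatorname{sgn}(c)=\pm1$ of a crossing $c$ is the usual one: $+1$ if the over-strand direction is rotated counterclockwise (by less than $\pi$) to the under-strand direction, and $-1$ otherwise. Two diagrams are equivalent if they are related by a finite sequence of planar isotopies and oriented Reidemeister moves $\Omega_1,\Omega_2,\Omega_3$ performed away from the tail and head; pulling an endpoint over or under an arc is forbidden. Equivalence classes are planar knotoids. **Inverse, mirror image, zero height.** $-D$ is obtained from $D$ by reversing the orientation. $D^*$ is obtained from $D$ by switching over/under at every crossing. $D$ is zero height if the planar knotoid it represents has a diagram whose two endpoints lie in the same region (component of the complement of the diagram), i.e. some equivalent diagram admits an arc joining its endpoints that does not otherwise meet the diagram. **Gauss diagram.** $G(D)$ is a counterclockwise oriented arc of a circle (the circle minus a gap between head and tail), running from the tail to the head, with a chord joining the two preimages of each crossing. Each chord $c$ is directed from the overcrossing to the undercrossing and carries the sign $\operatorname{sgn}(c)$ of its crossing. $C(G(D))$ is the set of chords. For a chord $c$,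 let $r(c)$ (resp. $\ell(c)$) be the set of chords $e\ne c$ intersecting $c$ and passing through $c$ from left to right (resp. from right to left) with respect to the direction of $c$, where $e$ is traversed in its own direction. Thus $e\in r(c)$ means that the starting point of $e$ is on the left of $c$ and its end point on the right. Let $r^{\pm}(c)$ and $\ell^{\pm}(c)$ be the subsets of chords of sign $\pm$. **Degree.** $d(c)=|r^+(c)|-|r^-(c)|-|\ell^+(c)|+|\ell^-(c)|$. **Index functions.** For a chord $c$ put $R_{|d(c)|}=\mathbb{Z}[z^{\pm1}]/(z^{|d(c)|}-1)$ (so $R_0=\mathbb{Z}[z^{\pm1}]$ and $R_1=\mathbb{Z}$), and $\phi_c(k)=k \bmod |d(c)|$, with $\phi_c=\mathrm{id}$ if $d(c)=0$. For $n\in\mathbb{N}=\{0,1,2,\dots\}$ let $r^n(c)=\{e\in r(c):\gcd(d(c),d(e))=n\}$ and $\ell^n(c)=\{e\in\ell(c):\gcd(d(c),d(e))=n\}$, where $\gcd(a,0)=|a|$ and $\gcd(0,0)=0$. The $n$-th index function is $$\operatorname{Ind}_c^n(z)=\sum_{e\in r^n(c)}\operatorname{sgn}(e)\,z^{\phi_c(d(e))}-\sum_{e\in\ell^n(c)}\operatorname{sgn}(e)\,z^{\phi_c(-d(e))}\in R_{|d(c)|}.$$ **The function $H_D$.** $$H_D(t,y,z)=\sum_{c\in C(G(D)),\,n\in\mathbb{N}}\operatorname{sgn}(c)\left(t^{\operatorname{Ind}_c^n(z)}-1\right)y^n,$$ a finite sum since $\operatorname{Ind}_c^n(z)\neq0$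 for only finitely many pairs $(c,n)$. Here $t^f$ (for $f\in R_k$, $k\ge0$) is a formal symbol, with $t^0=1$ for the zero of every $R_k$. So $H_D$ is a polynomial in $y$ with coefficients in the free abelian group on the symbols $t^f$, where $f$ runs over the disjoint union of the $R_k$ ($k\geq 0$) with all zero elements identified. Substituting $t^{-1}$ for $t$ means replacing $t^{f}$ by $t^{-f}$; substituting $z^{-1}$ for $z$ means replacing $t^{f(z)}$ by $t^{f(z^{-1})}$, where $f(z)\mapsto f(z^{-1})$ is the induced automorphism of each $R_k$. *)

(* Defs.v *)
From HB Require Import structures.
From Stdlib Require Import Relation_Operators.
From mathcomp Require Import all_boot all_order all_algebra finmap freeg.
From mathcomp Require Import all_classical all_reals.
From mathcomp Require Import topology normedtype derive.

Set Implicit Arguments.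
Unset Strict Implicit.
Unset Printing Implicit Defensive.

Import Order.TTheory GRing.Theory Num.Theory.
Import numFieldNormedType.Exports.

Local Open Scope classical_set_scope.
Local Open Scope fset_scope.
Local Open Scope ring_scope.

(** * Planar knotoid diagrams *)

Definition det2 {R : realType} (u v : R * R) : R := u.1 * v.2 - u.2 * v.1.

(* Two distinct parameters in [0, 1] with the same image. *)
Definition double_pt {R : realType} (g : R -> R * R) (s t : R) : Prop :=
  [/\ 0 <= s <= 1, 0 <= t <= 1, s != t & g s = g t].

(* A map on [0, 1] is C^1 when it extends to a C^1 map of the line; only the
   restriction of [crv] to [0, 1] matters.  [ov s] says that the strand through
   the parameter s is the upper one; it matters only if s is the parameter of
   a double point. *)
Record knotoid_diagram (R : realType) := KnotoidDiagram {
  crv : R -> R * R;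
  ov : R -> bool;
  crv_derivable : forall t, derivable crv t 1;
  crv_C1 : continuous (derive1 crv);
  crv_immersion : forall t, 0 <= t <= 1 -> derive1 crv t != 0;
  crv_finite : finite_set [set p : R * R | double_pt crv p.1 p.2];
  crv_no_triple : forall s t u,
    double_pt crv s t -> double_pt crv s u -> t = u;
  crv_transverse : forall s t,
    double_pt crv s t -> det2 (derive1 crv s) (derive1 crv t) != 0;
  crv_endpoints : forall s t, double_pt crv s t -> 0 < s < 1;
  ov_crossing : forall s t, double_pt crv s t -> ov s = ~~ ov t }.

Section InverseMirror.
Context {R : realType}.
Implicit Type D : knotoid_diagram R.

Let flip (t : R) : R := 1 - t.

Lemma double_pt_flip (g : R -> R * R) s t :
  double_pt (fun x => g (1 - x)) s t -> double_pt g (1 - s) (1 - t).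
Proof.
case=> /andP[s0 s1] /andP[t0 t1] st gst; split=> //.
- by rewrite subr_ge0 s1 gerBl s0.
- by rewrite subr_ge0 t1 gerBl t0.
- by apply: contra st => /eqP/addrI/oppr_inj ->.
Qed.

Lemma is_derive_flip (g : R -> R * R) t : derivable g (1 - t) 1 ->
  is_derive t 1 (fun x => g (1 - x)) (- derive1 g (1 - t)).
Proof.
move=> dg.
have df : is_derive t 1 flip (-1).
  by rewrite -[X in is_derive _ _ _ X]add0r; apply: is_deriveB.
have /derivable1_diffP dg' := dg.
have /derivable1_diffP df' : derivable flip t 1 by apply: ex_derive.
have dc : differentiable (g \o flip) t by apply: differentiable_comp.
split; first exact/derivable1_diffP.
rewrite -[LHS]/('D_1 (g \o flip) t) deriveE // diff_comp //=.
rewrite -(deriveE _ df') derive_val.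
by rewrite linearN -(deriveE _ dg') derive1E.
Qed.

Lemma continuous_flip (g : R -> R * R) :
  continuous g -> continuous (fun x : R => - g (1 - x) : R * R).
Proof.
move=> cg t.
have cf : {for t, continuous flip}.
  by apply: (@cvgB R R^o); [exact: cvg_cst | exact: cvg_id].
have cgf : {for t, continuous (g \o flip)} := continuous_comp cf (cg _).
exact: (@cvgN R (R * R)%type _ (nbhs t) _ (g \o flip) _ cgf).
Qed.

Lemma inverse_derive1 D t :
  derive1 (fun x => crv D (1 - x)) t = - derive1 (crv D) (1 - t).
Proof.
have H := is_derive_flip (@crv_derivable _ D (1 - t)).
by rewrite derive1E derive_val.
Qed.

Definition inverse D : knotoid_diagram R.
Proof.
refine (@KnotoidDiagram R (fun t => crv D (1 - t)) (fun t => ov D (1 - t))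
  _ _ _ _ _ _ _ _).
- move=> t.
  by have [] := is_derive_flip (@crv_derivable _ D (1 - t)).
- rewrite (_ : derive1 _ = fun t => - derive1 (crv D) (1 - t)); last first.
    by apply/funext => t; exact: inverse_derive1.
  exact/continuous_flip/crv_C1.
- move=> t /andP[t0 t1]; rewrite inverse_derive1 oppr_eq0.
  by apply: crv_immersion; rewrite subr_ge0 t1 gerBl t0.
- apply: (sub_finite_set (B := (fun p : R * R => (1 - p.1, 1 - p.2)) @`
      [set p : R * R | double_pt (crv D) p.1 p.2])).
    move=> [s t] /= /double_pt_flip st; exists (1 - s, 1 - t) => //=.
    by rewrite !subKr.
  exact/finite_image/crv_finite.
- move=> s t u /double_pt_flip st /double_pt_flip su.
  by have /addrI/oppr_inj := crv_no_triple st su.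
- move=> s t /double_pt_flip st; rewrite !inverse_derive1.
  by have := crv_transverse st; rewrite /det2 /= !mulrNN.
- move=> s t /double_pt_flip /crv_endpoints /andP[].
  by rewrite subr_gt0 gtrBl => -> ->.
- by move=> s t /double_pt_flip /ov_crossing.
Defined.

Definition mirror D : knotoid_diagram R.
Proof.
refine (@KnotoidDiagram R (crv D) (fun t => ~~ ov D t) _ _ _ _ _ _ _ _).
- exact: crv_derivable.
- exact: crv_C1.
- exact: crv_immersion.
- exact: crv_finite.
- exact: crv_no_triple.
- exact: crv_transverse.
- exact: crv_endpoints.
- by move=> s t /ov_crossing ->.
Defined.

End InverseMirror.

(** * Planar isotopies and Reidemeister moves *)

Section Equivalence.
Context {R : realType}.
Implicit Types (D : knotoid_diagram R) (psi : R * R -> R * R).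

Definition C1map psi : Prop :=
  (forall x, differentiable psi x) /\
  (forall v : R * R, continuous (fun x => 'D_v psi x)).

Definition diffeo psi : Prop :=
  C1map psi /\ exists2 phi, C1map phi & cancel psi phi /\ cancel phi psi.

Definition ambient_isotopy (Phi : R -> R * R -> R * R) : Prop :=
  [/\ Phi 0 =1 id,
      forall s, diffeo (Phi s),
      continuous (fun p : R * (R * R) => Phi p.1 p.2) &
      forall v : R * R,
        continuous (fun p : R * (R * R) => 'D_v (Phi p.1) p.2)].

(* Diagrams are also identified up to orientation preserving
   reparametrization [theta] of [0, 1]. *)
Definition planar_isotopy D D' : Prop :=
  exists (Phi : R -> R * R -> R * R) (theta : R -> R),
    [/\ ambient_isotopy Phi,
        [/\ theta 0 = 0, theta 1 = 1, forall t, derivable theta t 1,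
            continuous (derive1 theta) & forall t, 0 < derive1 theta t],
        forall t, 0 <= t <= 1 -> crv D' t = Phi 1 (crv D (theta t)) &
        forall s t, double_pt (crv D') s t -> ov D' s = ov D (theta s)].

Definition in_disc (p : R * R) : bool := p.1 ^+ 2 + p.2 ^+ 2 <= 1.
Definition in_odisc (p : R * R) : bool := p.1 ^+ 2 + p.2 ^+ 2 < 1.

(* In the closed disc B = psi^-1 (unit disc), D consists of the k arcs with
   parameter intervals [a i, b i], each meeting the boundary of B exactly at
   its two ends. *)
Definition tangle k D psi (a b : 'I_k -> R) : Prop :=
  forall t, 0 <= t <= 1 ->
    (in_disc (psi (crv D t)) <-> exists i, a i <= t <= b i) /\
    (in_odisc (psi (crv D t)) <-> exists i, a i < t < b i).

(* D and D' coincide outside B, and each consists in B of k arcs; B is away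
   from the tail and the head. *)
Definition local_change k D D' psi (a b : 'I_k -> R) : Prop :=
  [/\ diffeo psi,
      (forall i, [/\ 0 < a i, a i < b i & b i < 1]) /\
      (forall i j t, a i <= t <= b i -> a j <= t <= b j -> i = j),
      tangle D psi a b, tangle D' psi a b &
      forall t, 0 <= t <= 1 -> ~ (exists i, a i < t < b i) ->
        crv D t = crv D' t /\ ov D t = ov D' t].

Definition embedded_on D (a b : R) : Prop :=
  forall s t, a <= s <= b -> a <= t <= b -> crv D s = crv D t -> s = t.

(* An embedded arc of B is replaced by an arc with exactly one
   self-crossing. *)
Definition Omega1 D D' : Prop :=
  exists psi (a b : 'I_1 -> R), local_change D D' psi a b /\
  [/\ embedded_on D (a 0) (b 0) &
      exists s t : R, [/\ a 0 < s, s < t, t < b 0, crv D' s = crv D' t &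
        forall s' t' : R, a 0 <= s' -> s' < t' -> t' <= b 0 ->
          crv D' s' = crv D' t' -> s' = s /\ t' = t]].

(* In the coordinates given by psi, arc 0 is the diameter y = 0 in both
   diagrams; arc 1 lies in y > 0 in D, whereas in D' it cuts arc 0 in exactly
   two points, both times as the upper strand or both times as the lower
   strand. *)
Definition Omega2 D D' : Prop :=
  exists psi (a b : 'I_2 -> R), local_change D D' psi a b /\
  [/\ forall t, a 0 <= t <= b 0 ->
        crv D t = crv D' t /\ (psi (crv D t)).2 = 0,
      forall t, a 1 <= t <= b 1 -> 0 < (psi (crv D t)).2,
      embedded_on D (a 1) (b 1), embedded_on D' (a 1) (b 1) &
      exists s t : R, [/\ a 1 <= s, s < t, t <= b 1,
        forall u, a 1 <= u <= b 1 ->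
          ((psi (crv D' u)).2 = 0 <-> u = s \/ u = t) &
        ov D' s = ov D' t]].

(* In the coordinates given by psi, arcs 0 and 1 are the diagonals x = y and
   x = - y in both diagrams; arc 2 joins (1, 0) and (-1, 0), cuts each diagonal
   exactly once, and passes below their intersection point in D and above it
   in D'.  The relative heights of the three strands are given by [lev]. *)
Definition Omega3 D D' : Prop :=
  exists psi (a b : 'I_3 -> R), local_change D D' psi a b /\
  [/\ (forall t, a 0 <= t <= b 0 ->
        crv D t = crv D' t /\ (psi (crv D t)).1 = (psi (crv D t)).2) /\
      (forall t, a 1 <= t <= b 1 ->
        crv D t = crv D' t /\ (psi (crv D t)).1 = - (psi (crv D t)).2),
      (forall t, a 2 < t < b 2 ->
        (psi (crv D t)).2 < 0 /\ 0 < (psi (crv D' t)).2),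
      (forall E, E = D \/ E = D' ->
        [/\ embedded_on E (a 2) (b 2),
            exists! t, a 2 <= t <= b 2 /\
              (psi (crv E t)).1 = (psi (crv E t)).2 &
            exists! t, a 2 <= t <= b 2 /\
              (psi (crv E t)).1 = - (psi (crv E t)).2]) &
      exists2 lev : 'I_3 -> nat, injective lev &
        forall E, E = D \/ E = D' -> forall i j s t, i != j ->
          a i <= s <= b i -> a j <= t <= b j -> crv E s = crv E t ->
          ov E s = (lev j < lev i)%N].

Definition elementary_move D D' : Prop :=
  [\/ planar_isotopy D D', Omega1 D D', Omega2 D D' | Omega3 D D'].

Definition knotoid_equiv : knotoid_diagram R -> knotoid_diagram R -> Prop :=
  clos_refl_sym_trans _ elementary_move.

(* Some arc [g] joins the tail to the head without otherwise meeting D. *)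
Definition endpoints_in_same_region D : Prop :=
  exists g : R -> R * R,
    [/\ continuous g,
        forall s t, 0 <= s <= 1 -> 0 <= t <= 1 -> g s = g t -> s = t,
        g 0 = crv D 0, g 1 = crv D 1 &
        forall s t, 0 < s < 1 -> 0 <= t <= 1 -> g s <> crv D t].

Definition zero_height D : Prop :=
  exists2 D', knotoid_equiv D D' & endpoints_in_same_region D'.

End Equivalence.

(** * Gauss diagrams *)

(* The circle minus the gap between head and tail is identified with [0, 1],
   counterclockwise orientation being the increasing one.  A chord is the pair
   (start, end) of its ends. *)
Record gauss_diagram (R : realType) := GaussDiagram {
  chords : set (R * R);
  csgn : R * R -> int }.

Definition gauss {R : realType} (D : knotoid_diagram R) : gauss_diagram R :=
  {| chords := [set c | [/\ double_pt (crv D) c.1 c.2, ov D c.1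
                          & ~~ ov D c.2]];
     csgn := fun c => if 0 < det2 (derive1 (crv D) c.1) (derive1 (crv D) c.2)
                      then 1 else - 1 |}.

Section Degree.
Context {R : realType} (G : gauss_diagram R).
Implicit Types c e : R * R.

(* The right side of c is the part of the circle that runs counterclockwise
   from the start to the end of c; it goes through the gap if c.2 < c.1. *)
Definition on_right c (x : R) : bool :=
  if c.1 < c.2 then c.1 < x < c.2 else (x < c.2) || (c.1 < x).
Definition on_left c (x : R) : bool :=
  if c.1 < c.2 then (x < c.1) || (c.2 < x) else c.2 < x < c.1.

Definition rset c : set (R * R) :=
  [set e | [/\ chords G e, on_left c e.1 & on_right c e.2]].
Definition lset c : set (R * R) :=
  [set e | [/\ chords G e, on_right c e.1 & on_left c e.2]].

Definition with_sign (A : set (R * R)) (s : int) : set (R * R) :=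
  [set e | A e /\ csgn G e = s].

Definition card (A : set (R * R)) : int := #|` fset_set A|%:Z.

Definition degree c : int :=
  card (with_sign (rset c) 1) - card (with_sign (rset c) (- 1))
  - card (with_sign (lset c) 1) + card (with_sign (lset c) (- 1)).

End Degree.

(** * Index functions *)

(* Canonical representatives of the integers modulo k; since j %% 0 = j, these
   are all the integers if k = 0. *)
Definition residue (k : nat) : Type := {j : int | (j %% k)%Z == j}.
HB.instance Definition _ k := Choice.on (residue k).

Lemma modzK (k : nat) (j : int) : ((j %% k)%Z %% k)%Z == (j %% k)%Z.
Proof. by rewrite modz_mod. Qed.

Definition phi (k : nat) (j : int) : residue k :=
  exist _ (j %% k)%Z (modzK k j).

(* The additive group of Z[z^+-1] / (z^k - 1): it is free on the classes of the
   z^j, where j runs over the integers modulo k. *)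
Definition laurent (k : nat) : Type := {freeg (residue k)}.
HB.instance Definition _ k := GRing.Zmodule.on (laurent k).

Definition zpow (k : nat) (j : int) : laurent k := << phi k j >>.

(* f(z) |-> f(z^-1) *)
Definition zinv (k : nat) (f : laurent k) : laurent k :=
  fglift (fun j : residue k => << phi k (- val j) >> : {freeg (residue k)}) f.

Section Index.
Context {R : realType} (G : gauss_diagram R).
Implicit Types c e : R * R.

Definition rset_gcd (n : nat) c : set (R * R) :=
  [set e | rset G c e /\ gcdz (degree G c) (degree G e) = n].
Definition lset_gcd (n : nat) c : set (R * R) :=
  [set e | lset G c e /\ gcdz (degree G c) (degree G e) = n].

Definition Ind (n : nat) c : laurent `|degree G c|%N :=
  \sum_(e \in rset_gcd n c) zpow `|degree G c|%N (degree G e) *~ csgn G e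
  - \sum_(e \in lset_gcd n c) zpow `|degree G c|%N (- degree G e) *~ csgn G e.

End Index.

(** * The function H *)

(* The formal symbols t^f: the disjoint union of the rings Z[z^+-1] / (z^k - 1)
   with all their zeros identified, [None] standing for t^0. *)
Definition symbol : Type := option {k : nat & {f : laurent k | f != 0}}.
HB.instance Definition _ := Choice.on symbol.

Definition tpow (k : nat) (f : laurent k) : symbol :=
  omap (Tagged (fun k => {f : laurent k | f != 0})) (insub f).

(* Polynomials in y with coefficients in the free abelian group on the symbols:
   the free abelian group on the t^f y^n, encoded as pairs (t^f, n). *)
Definition ypoly : Type := {freeg (symbol * nat)%type}.
HB.instance Definition _ := GRing.Zmodule.on ypoly.

Definition ty (u : symbol) (n : nat) : ypoly := << (u, n) >>.

Definition subst_exponent (F : forall k, laurent k -> laurent k) (P : ypoly) :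
    ypoly :=
  fglift (fun m : symbol * nat =>
    << (if m.1 is Some u then tpow (F (tag u) (val (tagged u))) else None, m.2)
    >> : {freeg (symbol * nat)%type}) P.

(* t |-> t^-1 *)
Definition subst_tinv : ypoly -> ypoly :=
  subst_exponent (fun k (f : laurent k) => - f).
(* z |-> z^-1 *)
Definition subst_zinv : ypoly -> ypoly := subst_exponent zinv.

Definition Hgauss {R : realType} (G : gauss_diagram R) : ypoly :=
  \sum_(p \in chords G `*` [set: nat])
    (ty (tpow (Ind G p.2 p.1)) p.2 - ty None p.2) *~ csgn G p.1.

Definition Hpoly {R : realType} (D : knotoid_diagram R) : ypoly :=
  Hgauss (gauss D).

(* Main.v *)
(* H is determined by the signs of the chords and by kap(c, e), which is 1 on r(c),
   -1 on l(c) and 0 elsewhere: d(c) is the sum of the sgn(e) kap(c, e), and Ind_c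
   that of the sgn(e) kap(c, e) z^(kap(c, e) d(e)).  Inversion and mirror image act
   on the signs and on kap by signs.

   For invariance under the moves only the chords of the modified disc matter.  An
   Omega1 chord meets no other chord; the two Omega2 chords are parallel with
   opposite signs and cancel.  The degrees of the three Omega3 chords A, B, C
   satisfy d(A) + d(B) + d(C) = 0, so that in Ind_A the chords B and C come with
   the same gcd and, modulo d(A), with opposite exponents; the move preserves
   their total contribution.

   If the endpoints lie in the same region, all degrees vanish.  Up to sign, d(c)
   is the sum of the signs of the crossings of the loop of D at c with the rest of
   D.  As a point runs along the rest of D, the winding number of the loop around
   it jumps by these signs; it does not change when the point takes a short cut
   past the crossing c, and it agrees at the tail and the head, which are joined by
   an arc avoiding the loop.  When all degrees vanish, Ind_c is the constant
   d(c) = 0.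

   Winding numbers are obtained without integration or covering spaces, by counting
   with signs the crossings of a ray by a fine subdivision of the loop. *)
From HB Require Import structures.
Require Import Defs.
From Stdlib Require Import Relation_Operators.
From mathcomp Require Import all_boot all_order all_algebra finmap freeg.
From mathcomp Require Import all_classical all_reals.
From mathcomp Require Import topology normedtype derive realfun.
From mathcomp Require Import ring lra zify.

Set Implicit Arguments.
Unset Strict Implicit.
Unset Printing Implicit Defensive.

Import Order.TTheory GRing.Theory Num.Theory.
Import numFieldNormedType.Exports.

Local Open Scope classical_set_scope.
Local Open Scope ring_scope.

(** * Winding numbers *)

(** Counting the axis as part of the upper half-plane makes [chi] exactly additive on triples in an
    open half-plane, even for points on the ray, so no general position is assumed. The analysis
    then reduces to a uniform scale given by compactness and to first-order expansions at crossings.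
    The chart [psi] of a Reidemeister move may reverse orientation, so a crossing sign read in the
    chart is known only up to the sign of the Jacobian, which is constant on the plane. It cancels
    in the relative sign of the two crossings of Omega2, and is a common factor of the three signs
    of Omega3. Two diagrams related by a move agree only outside the open parameter arcs, and curves
    only matter on [0, 1]; velocities are therefore compared through parameters that accumulate at
    the given one. *)

Section RayCrossing.
Context {R : realType}.
Implicit Types a b c d v : R * R.

(* The signed number of times the segment from a to b crosses the positive
   x-axis, which is taken to lie in the upper half-plane. *)
Definition chi a b : int :=
  ((a.2 < 0 <= b.2) && (0 < det2 a b))%:Z
  - ((b.2 < 0 <= a.2) && (det2 a b < 0))%:Z.

Definition dot2 a b : R := a.1 * b.1 + a.2 * b.2.

Lemma det2C a b : det2 a b = - det2 b a.
Proof. by rewrite /det2; ring. Qed.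

Lemma chiC a b : chi a b = - chi b a.
Proof.
by rewrite /chi (det2C b a) oppr_gt0 oppr_lt0 opprB.
Qed.

(** The triangle lies in an open half-plane, hence misses the origin, and the ray enters it as often
    as it leaves it. Algebraically, [rel] is a vanishing combination of the three determinants with
    positive weights, and [rel2] ties their signs to those of the second coordinates. *)
Lemma chi_triangle v a b c :
    0 < dot2 v a -> 0 < dot2 v b -> 0 < dot2 v c ->
  chi a b + chi b c = chi a c.
Proof.
rewrite /dot2 => va vb vc.
(* Cramer's relation between three vectors of the plane *)
have rel1 : det2 b c * a.1 + det2 c a * b.1 + det2 a b * c.1 = 0.
  by rewrite /det2; ring.
have rel2 : det2 b c * a.2 + det2 c a * b.2 + det2 a b * c.2 = 0.
  by rewrite /det2; ring.
have rel : det2 b c * dot2 v a + det2 c a * dot2 v b + det2 a b * dot2 v c = 0.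
  rewrite /dot2.
  transitivity
    (v.1 * (det2 b c * a.1 + det2 c a * b.1 + det2 a b * c.1) +
     v.2 * (det2 b c * a.2 + det2 c a * b.2 + det2 a b * c.2)); first by ring.
  by rewrite rel1 rel2; ring.
rewrite /dot2 in rel.
rewrite /chi (det2C a c) oppr_gt0 oppr_lt0.
move: (det2 b c) (det2 c a) (det2 a b) rel2 rel => x y z rel2 rel {rel1}.
move: va vb vc rel; move: (v.1 * a.1 + _) (v.1 * b.1 + _) (v.1 * c.1 + _).
move=> p q r p0 q0 r0 rel.
have pos u w : 0 < u -> 0 < w -> (0 < u * w) by move=> ? ?; rewrite mulr_gt0.
case: (ltP a.2 0) => a0; case: (ltP b.2 0) => b0; case: (ltP c.2 0) => c0 //=;
case: (ltgtP x 0) => x0; case: (ltgtP y 0) => y0; case: (ltgtP z 0) => z0 //=;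
  exfalso; nra.
Qed.

End RayCrossing.

(** * Discrete primitives of the ray count *)

Section Primitive.
Context {R : realType}.
Implicit Types (Phi : R * R -> R * R) (Psi : R * R -> int) (K : set (R * R)).

Lemma chi_quad v (a b c d : R * R) :
    0 < dot2 v a -> 0 < dot2 v b -> 0 < dot2 v c -> 0 < dot2 v d ->
  chi c d - chi a b = chi b d - chi a c.
Proof.
move=> va vb vc vd.
have h1 := chi_triangle va vb vd.
have h2 := chi_triangle va vc vd.
by lia.
Qed.

(** The integer counterpart of a continuous branch of the argument of [Phi]: at scale [d] the ray
    count is the coboundary of [Psi]. *)
Definition primitive K Phi (d : R) Psi : Prop :=
  forall p q, K p -> K q -> `|p - q| < d ->
    chi (Phi p) (Phi q) = Psi q - Psi p.

Definition rect (a b c d : R) : set (R * R) :=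
  [set p | a <= p.1 <= b /\ c <= p.2 <= d].

Lemma compact_rect a b c d : compact (rect a b c d).
Proof.
have -> : rect a b c d = `[a, b] `*` `[c, d].
  by apply/seteqP; split=> p /=; rewrite !in_itv.
by apply: compact_setX; apply: segment_compact.
Qed.

Lemma continuous_dot2 v : continuous (dot2 v : R * R -> R).
Proof.
move=> p; apply: cvgD; apply: cvgMr.
  exact: cvg_fst.
exact: cvg_snd.
Qed.

Lemma half_plane_near Phi p : {for p, continuous Phi} -> Phi p != 0 ->
  \forall q \near p, 0 < dot2 (Phi p) (Phi q).
Proof.
move=> cPhi Phi0.
have c : {for p, continuous (dot2 (Phi p) \o Phi)}.
  by apply: continuous_comp => //; apply: continuous_dot2.
have : 0 < (dot2 (Phi p) \o Phi) p.
  rewrite /= /dot2 -!expr2 lt_neqAle addr_ge0 ?sqr_ge0 // andbT eq_sym.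
  rewrite paddr_eq0 ?sqr_ge0 // !sqrf_eq0.
  by apply: contra Phi0 => /andP[/eqP x0 /eqP y0]; rewrite [Phi p]surjective_pairing x0 y0.
exact: (cvgr_gt ((dot2 (Phi p) \o Phi) p) c).
Qed.

(* A Lebesgue number *)
Lemma half_plane_uniform K Phi : compact K ->
    (forall p, K p -> {for p, continuous Phi}) ->
    (forall p, K p -> Phi p != 0) ->
  exists2 r : R, 0 < r & forall p, K p -> exists v, forall q, `|p - q| < r ->
    0 < dot2 v (Phi q).
Proof.
move=> /compact_near_coveringP cK cPhi Phi0.
have := cK R 0^'+ (fun r p => exists v, forall q, `|p - q| < r ->
  0 < dot2 v (Phi q)) _.
case=> [p Kp|r /= r0 H].
  have /nbhs_ballP[e /= e0 He] := half_plane_near (cPhi p Kp) (Phi0 p Kp).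
  exists (ball p (e / 2), [set r | 0 < r < e / 2]).
    split; first by apply/nbhs_ballP; exists (e / 2) => //=; rewrite divr_gt0.
    near=> r; rewrite /=; apply/andP; split; near: r.
      exact: nbhs_right_gt.
    by apply: nbhs_right_lt; rewrite divr_gt0.
  move=> [q r] /= [pq /andP[r0 re]]; exists (Phi p) => u qu.
  apply: He; rewrite -ball_normE /=.
  rewrite (splitr e) (le_lt_trans (ler_distD q _ _)) // ltrD //.
    by move: pq; rewrite -ball_normE.
  exact: lt_trans qu re.
exists (r / 2); first by rewrite divr_gt0.
apply: H; rewrite /= ?divr_gt0 // sub0r normrN gtr0_norm ?divr_gt0 //.
by rewrite ltr_pdivrMr // ltr_pMr // ltr1n.
Unshelve. all: by end_near. Qed.

End Primitive.

Section Rho.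
Context {R : realType}.
Implicit Types (Phi : R * R -> R * R) (Psi : R * R -> int).

Lemma chixx (a : R * R) : chi a a = 0.
Proof. by have := chiC a a; lia. Qed.

Lemma normr_prod_le (p : R * R) (e : R) :
  `|p.1| <= e -> `|p.2| <= e -> `|p| <= e.
Proof. by move=> h1 h2; rewrite prod_normE ge_max h1 h2. Qed.

(** A discrete Poincaré lemma: [Psi p] is the ray count along [n] equal steps of the segment from
    the corner [p0] to [p]. For close [p] and [q], each thin quadrilateral between the two segments
    is sent into one half-plane, so by [chi_quad] the difference telescopes to the last edge. *)
Lemma rect_primitive (a b c d : R) Phi : a <= b -> c <= d ->
    (forall p, rect a b c d p -> {for p, continuous Phi}) ->
    (forall p, rect a b c d p -> Phi p != 0) ->
  exists2 r : R, 0 < r & exists Psi, primitive (rect a b c d) Phi r Psi.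
Proof.
move=> ab cd cPhi Phi0.
have [r r0 H] := half_plane_uniform (@compact_rect _ a b c d) cPhi Phi0.
pose p0 := (a, c).
pose M := (b - a) + (d - c).
have M0 : 0 <= M by rewrite /M; lra.
(* [M] bounds the distance to [p0], so a step is shorter than [r / 2]; with [q] within [r / 2] of
   [p], the four corners of a quadrilateral lie within [r] of the first. *)
pose n := (Num.bound (2 * M / r)).+1.
have n0 : 0 < n%:R :> R by rewrite ltr0n.
have Mn : M / n%:R < r / 2.
  rewrite ltr_pdivrMr // mulrC -ltr_pdivrMr ?divr_gt0 //.
  have : 2 * M / r < (Num.bound (2 * M / r))%:R.
    by rewrite archi_boundP // divr_ge0 ?mulr_ge0 // ltW.
  rewrite invf_div mulrA [M * 2]mulrC => /lt_trans; apply.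
  by rewrite ltr_nat.
pose pt i (p : R * R) : R * R := p0 + (i%:R / n%:R) *: (p - p0).
have in01 i : (i <= n)%N -> 0 <= (i%:R / n%:R : R) <= 1.
  by move=> ilen; rewrite divr_ge0 //= ler_pdivrMr // mul1r ler_nat.
have ptK i p : (i <= n)%N -> rect a b c d p -> rect a b c d (pt i p).
  rewrite /pt => /in01; move: (_ / _) => t /andP[t0 t1] [/andP[p1 p2] /andP[q1 q2]].
  have conv (x y z : R) : x <= y -> y <= z -> x <= x + t * (y - x) <= z.
    by move=> xy yz; apply/andP; split; nra.
  by split; [exact: (conv a p.1 b)|exact: (conv c p.2 d)].
have ptS i p : rect a b c d p -> `|pt i p - pt i.+1 p| < r / 2.
  move=> [/andP[p1 p2] /andP[q1 q2]].
  rewrite /pt opprD addrACA subrr add0r -scalerBl -mulrBl -natr1 opprD addNKr.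
  rewrite normrZ normrM normrN normr1 mul1r gtr0_norm ?invr_gt0 // mulrC.
  apply: le_lt_trans Mn; rewrite ler_pM2r ?invr_gt0 //.
  by apply: normr_prod_le => /=; rewrite /M ger0_norm; lra.
have ptB i p q : (i <= n)%N -> `|pt i p - pt i q| <= `|p - q|.
  rewrite /pt => /in01/andP[t0 t1].
  rewrite opprD addrACA subrr add0r -scalerBr opprB addrA subrK normrZ.
  by rewrite ger0_norm // ler_piMl.
exists (r / 2); first by rewrite divr_gt0.
exists (fun p => \sum_(i < n) chi (Phi (pt i p)) (Phi (pt i.+1 p))) => p q Kp Kq pq.
rewrite -sumrB.
transitivity (\sum_(i < n) (chi (Phi (pt i.+1 p)) (Phi (pt i.+1 q))
                            - chi (Phi (pt i p)) (Phi (pt i q)))); last first.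
  apply: eq_bigr => i _.
  have [v Hv] := H _ (ptK i p (ltnW (ltn_ord i)) Kp).
  have near q' : `|pt i p - q'| < r / 2 + r / 2 -> 0 < dot2 v (Phi q').
    by rewrite -splitr => /Hv.
  apply/esym/(@chi_quad _ v); apply: near.
  - by rewrite subrr normr0 addr_gt0 ?divr_gt0.
  - by apply: lt_trans (ptS _ _ Kp) _; rewrite ltrDl divr_gt0.
  - apply: le_lt_trans (ptB i _ _ (ltnW (ltn_ord i))) _.
    by apply: lt_trans pq _; rewrite ltrDl divr_gt0.
  - apply: le_lt_trans (ler_distD (pt i.+1 p) _ _) _; rewrite ltrD ?ptS //.
    by apply: le_lt_trans (ptB i.+1 _ _ _) _.
rewrite -(big_mkord xpredT (fun i => chi (Phi (pt i.+1 p)) (Phi (pt i.+1 q)) -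
   chi (Phi (pt i p)) (Phi (pt i q)))).
rewrite (telescope_sumr (fun i => chi (Phi (pt i p)) (Phi (pt i q)))) //.
rewrite /pt mul0r !scale0r !addr0 chixx subr0 divff ?gt_eqF // !scale1r.
by rewrite [p0 + (p - _)]addrC [p0 + (q - _)]addrC !subrK.
Qed.

End Rho.

(** * Discrete variation of the argument along a path *)

Section PathIndex.
Context {R : realType}.
Implicit Types (Phi : R * R -> R * R) (al : R -> R * R) (a b c d : R).

Definition path_primitive al a b r (psi : R -> int) : Prop :=
  forall x y, a <= x <= b -> a <= y <= b -> `|x - y| < r ->
    chi (al x) (al y) = psi y - psi x.

(* A discrete variation of the argument: the signed number of times that al
   crosses the positive x-axis on [a, b]. *)
Definition is_rho al a b (k : int) : Prop :=
  exists (r : R) psi, [/\ 0 < r, path_primitive al a b r psi & k = psi b - psi a].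

(** For [a <= b] at most one value qualifies ([is_rho_uniq]), and one exists when the path is
    continuous and avoids the origin ([is_rhoP]); the default 0 stands for the absence of a
    primitive. *)
Definition rho al a b : int := xget 0 [set k | is_rho al a b k].

Lemma uniformly_locally_constant (f : R -> int) a b r : 0 < r -> a <= b ->
  (forall x y, a <= x <= b -> a <= y <= b -> `|x - y| < r -> f x = f y) ->
  f a = f b.
Proof.
move=> r0 ab H.
pose n := (Num.bound ((b - a) / r)).+1.
have n0 : 0 < n%:R :> R by rewrite ltr0n.
have hr : (b - a) / n%:R < r.
  rewrite ltr_pdivrMr // mulrC -ltr_pdivrMr //.
  apply: (@lt_trans _ _ (Num.bound ((b - a) / r))%:R); last by rewrite ltr_nat.
  by rewrite archi_boundP // divr_ge0 ?subr_ge0 // ltW.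
pose h := (b - a) / n%:R.
have h0 : 0 <= h by rewrite divr_ge0 ?subr_ge0 // ltW.
have hn : n%:R * h = b - a by rewrite mulrC divfK ?gt_eqF.
have step i : (i <= n)%N -> f (a + i%:R * h) = f a.
  elim: i => [|i IH] ilt; first by rewrite mul0r addr0.
  rewrite -IH ?(ltnW ilt) //; apply: H.
  - rewrite lerDl mulr_ge0 //= -lerBrDl -hn ler_wpM2r // ler_nat //.
  - rewrite lerDl mulr_ge0 //= -lerBrDl -hn ler_wpM2r // ler_nat ltnW //.
  - by rewrite opprD addrACA subrr add0r -mulrBl -natr1 addrAC subrr add0r mul1r ger0_norm.
by rewrite -(step n) // hn addrC subrK.
Qed.

Lemma is_rho_uniq al a b k l : a <= b ->
  is_rho al a b k -> is_rho al a b l -> k = l.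
Proof.
move=> ab [r [f [r0 Hf ->]]] [s [g [s0 Hg ->]]].
suff : f a - g a = f b - g b by lia.
apply: (@uniformly_locally_constant (fun x => f x - g x) a b (Num.min r s)) => //.
  by rewrite lt_min r0.
move=> x y xab yab; rewrite lt_min => /andP[/(Hf _ _ xab yab) h1].
by move=> /(Hg _ _ xab yab); lia.
Qed.

Lemma rhoE al a b k : a <= b -> is_rho al a b k -> rho al a b = k.
Proof.
move=> ab hk; rewrite /rho; case: xgetP => [l _ /= hl|/(_ k)//].
exact: is_rho_uniq hl hk.
Qed.

Lemma is_rhoP al a b : a <= b ->
  (forall x, a <= x <= b -> {for x, continuous al}) ->
  (forall x, a <= x <= b -> al x != 0) ->
  is_rho al a b (rho al a b).
Proof.
move=> ab cal al0.
suff [k hk] : exists k, is_rho al a b k by rewrite (rhoE ab hk).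
(* The path is a map on a degenerate rectangle of height 0. *)
have [|||r r0 [Psi HPsi]] := @rect_primitive R a b 0 0 (al \o fst) ab.
- by [].
- move=> p [p1 _]; apply: continuous_comp; first exact: cvg_fst.
  exact: cal.
- by move=> p [p1 _]; apply: al0.
exists (Psi (b, 0) - Psi (a, 0)), r, (fun x => Psi (x, 0)); split=> //.
move=> x y xab yab xy; apply: (HPsi (x, 0) (y, 0)); rewrite /rect /= ?lexx //.
rewrite prod_normE /= subrr normr0 gt_max xy //.
Qed.

Lemma rho_cat al a b c : a <= b -> b <= c ->
  (forall x, a <= x <= c -> {for x, continuous al}) ->
  (forall x, a <= x <= c -> al x != 0) ->
  rho al a c = rho al a b + rho al b c.
Proof.
move=> ab bc cal al0; have ac := le_trans ab bc.
have [r [psi [r0 H ->]]] := is_rhoP ac cal al0.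
rewrite (@rhoE al a b (psi b - psi a)) // ?(@rhoE al b c (psi c - psi b)) //.
- by lia.
- exists r, psi; split=> // x y /andP[? ?] /andP[? ?]; apply: H.
    by apply/andP; split=> //; apply: le_trans ab _.
  by apply/andP; split=> //; apply: le_trans ab _.
- exists r, psi; split=> // x y /andP[? ?] /andP[? ?]; apply: H.
    by apply/andP; split=> //; apply: le_trans bc.
  by apply/andP; split=> //; apply: le_trans bc.
Qed.

(** Inside a half-plane [chi (al a)] is a primitive at every scale, so only the two ends count; the
    scale 1 is arbitrary. *)
Lemma rho_half_plane al v a b : a <= b ->
  (forall x, a <= x <= b -> 0 < dot2 v (al x)) ->
  rho al a b = chi (al a) (al b).
Proof.
move=> ab H; apply: rhoE => //; exists 1, (fun x => chi (al a) (al x)).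
split=> //; last by rewrite chixx subr0.
move=> x y xab yab _.
have aab : a <= a <= b by rewrite lexx.
by have := chi_triangle (H _ aab) (H _ xab) (H _ yab); lia.
Qed.

(** Homotopy invariance: both sides equal [Psi (b, d) - Psi (a, c)] for a primitive on the
    rectangle. *)
Lemma rho_rect Phi a b c d : a <= b -> c <= d ->
    (forall p, rect a b c d p -> {for p, continuous Phi}) ->
    (forall p, rect a b c d p -> Phi p != 0) ->
  rho (fun x => Phi (x, c)) a b + rho (fun y => Phi (b, y)) c d =
  rho (fun y => Phi (a, y)) c d + rho (fun x => Phi (x, d)) a b.
Proof.
move=> ab cd cPhi Phi0; have [r r0 [Psi H]] := rect_primitive ab cd cPhi Phi0.
have hx z : c <= z <= d ->
    rho (fun x => Phi (x, z)) a b = Psi (b, z) - Psi (a, z).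
  move=> zcd; apply: rhoE => //; exists r, (fun x => Psi (x, z)); split=> //.
  move=> x y xab yab xy; apply: (H (x, z) (y, z)) => //.
  by rewrite prod_normE /= subrr normr0 gt_max xy.
have hy z : a <= z <= b ->
    rho (fun y => Phi (z, y)) c d = Psi (z, d) - Psi (z, c).
  move=> zcd; apply: rhoE => //; exists r, (fun x => Psi (z, x)); split=> //.
  move=> x y xab yab xy; apply: (H (z, x) (z, y)) => //.
  by rewrite prod_normE /= subrr normr0 gt_max xy r0.
by rewrite (hx c) ?(hx d) ?(hy a) ?(hy b) ?lexx ?ab ?cd //; ring.
Qed.

(** Four counterclockwise turns, each of less than a half turn, that return to the first direction
    make exactly one full turn, which crosses the ray once. *)
Lemma chi_ccw (a b c d : R * R) :
    0 < det2 a b -> 0 < det2 b c -> 0 < det2 c d -> 0 < det2 d a ->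
  chi a b + chi b c + chi c d + chi d a = 1.
Proof.
move=> ab bc cd da.
have rel1 : det2 b c * a.2 + det2 c a * b.2 + det2 a b * c.2 = 0.
  by rewrite /det2; ring.
have rel2 : det2 c d * b.2 + det2 d b * c.2 + det2 b c * d.2 = 0.
  by rewrite /det2; ring.
have rel3 : det2 d a * c.2 + det2 a c * d.2 + det2 c d * a.2 = 0.
  by rewrite /det2; ring.
have rel4 : det2 a b * d.2 + det2 b d * a.2 + det2 d a * b.2 = 0.
  by rewrite /det2; ring.
rewrite /chi ab bc cd da !ltNge !(ltW ab, ltW bc, ltW cd, ltW da) /= !andbT !andbF.
rewrite -!ltNge.
have ca := det2C c a; have db := det2C d b.
have ab' : det2 a b = a.1 * b.2 - a.2 * b.1 by [].
have bc' : det2 b c = b.1 * c.2 - b.2 * c.1 by [].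
have cd' : det2 c d = c.1 * d.2 - c.2 * d.1 by [].
have da' : det2 d a = d.1 * a.2 - d.2 * a.1 by [].
move: ab bc cd da rel1 rel2 rel3 rel4 ab' bc' cd' da'; rewrite ca db.
move: (det2 a b) (det2 b c) (det2 c d) (det2 d a) (det2 a c) (det2 b d).
move: a.1 a.2 b.1 b.2 c.1 c.2 d.1 d.2 {ca db} => a1 a2 b1 b2 c1 c2 d1 d2.
move=> ab bc cd da ac bd ab0 bc0 cd0 da0 r1 r2 r3 r4 e1 e2 e3 e4.
case: (ltP a2 0) => a0; case: (ltP b2 0) => b0; case: (ltP c2 0) => c0;
  case: (ltP d2 0) => d0 //=; exfalso; case: (ltgtP ac 0) => ac0.
all: try nra.
(* In the goals that are left [a] and [c] lie on the axis. The positive turns put [b] and [d]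
   strictly on opposite sides of it, against [bd0]. *)
all: have a20 : a2 = 0 by nra.
all: have c20 : c2 = 0 by nra.
all: rewrite a20 c20 !(mulr0, mul0r, subr0, sub0r) in e1 e2 e3 e4.
all: have bd0 : 0 <= b2 * d2 by nra.
all: have : 0 <= (c1 * c1) * (b2 * d2) by rewrite mulr_ge0 // -expr2 sqr_ge0.
all: have : 0 < bc * cd by rewrite mulr_gt0.
all: by rewrite e2 e3; lra.
Qed.

Lemma chi_cw (a b c d : R * R) :
    det2 a b < 0 -> det2 b c < 0 -> det2 c d < 0 -> det2 d a < 0 ->
  chi a b + chi b c + chi c d + chi d a = -1.
Proof.
rewrite (det2C a b) (det2C b c) (det2C c d) (det2C d a) !oppr_lt0 => ba cb dc ad.
have := chi_ccw ad dc cb ba.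
by have := (chiC a b, chiC b c, chiC c d, chiC d a); case=> [[[]]]; lia.
Qed.

End PathIndex.

(** * The index of a small square around a transverse crossing *)

Section Crossing.
Context {R : realType}.
Implicit Types (la de : R -> R * R).

Lemma det2_norm (a b : R * R) : `|det2 a b| <= 2 * `|a| * `|b|.
Proof.
have h (x : R * R) : `|x.1| <= `|x| /\ `|x.2| <= `|x|.
  by rewrite prod_normE !le_max !lexx orbT.
have [a1 a2] := h a; have [b1 b2] := h b.
rewrite /det2 (le_trans (ler_normB _ _)) // !normrM.
have -> : 2 * `|a| * `|b| = `|a| * `|b| + `|a| * `|b| by ring.
by rewrite lerD // ler_pM.
Qed.

Lemma det2Dl (a b c : R * R) : det2 (a + b) c = det2 a c + det2 b c.
Proof. by rewrite /det2 /=; ring. Qed.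
Lemma det2Dr (a b c : R * R) : det2 a (b + c) = det2 a b + det2 a c.
Proof. by rewrite /det2 /=; ring. Qed.
Lemma det2Zl k (a b : R * R) : det2 (k *: a) b = k * det2 a b.
Proof. by rewrite /det2 /= /GRing.scale /=; ring. Qed.
Lemma det2Zr k (a b : R * R) : det2 a (k *: b) = k * det2 a b.
Proof. by rewrite /det2 /= /GRing.scale /=; ring. Qed.
Lemma det2xx (a : R * R) : det2 a a = 0.
Proof. by rewrite /det2; ring. Qed.

Lemma derivable_expansion (W : normedModType R) (la : R -> W) t e : derivable la t 1 -> 0 < e ->
  exists2 r : R, 0 < r & forall h, `|h| <= r ->
    `|la (t + h) - la t - h *: derive1 la t| <= e * `|h|.
Proof.
move=> dla e0.
have /cvgr_dist_le/(_ _ e0) : h^-1 *: ((la \o shift t) (h *: 1) - la t)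
    @[h --> 0^'] --> derive1 la t by rewrite derive1E; exact: dla.
case/nbhs_ballP => r /= r0 H.
exists (r / 2); first by rewrite divr_gt0.
move=> h hr; have [->|h0] := eqVneq h 0.
  by rewrite addr0 subrr scale0r subrr !normr0 mulr0.
have := H h; rewrite -ball_normE /= sub0r normrN => /(_ _ h0) => H1.
have {H1} : `|derive1 la t - h^-1 *: (la (h *: 1 + t) - la t)| <= e.
  by apply: H1; rewrite (le_lt_trans hr) // ltr_pdivrMr // ltr_pMr // ltr1n.
rewrite [_ *: 1]mulr1 [h + t]addrC => H1.
rewrite -normrN opprB.
have -> : h *: derive1 la t - (la (t + h) - la t) =
          h *: (derive1 la t - h^-1 *: (la (t + h) - la t)).
  by rewrite scalerBr scalerA divff // scale1r.
by rewrite normrZ mulrC ler_wpM2r.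
Qed.

(** The bound on [x] is [(16 M e + 8 e^2) h^2], at most [24 M e h^2] because [e <= 1 <= M], while
    [2 D] is at least [40 M e]. It is applied to the error in the determinant of two corners. *)
Lemma crossing_numbers (M e D h x : R) :
    0 < h -> 1 <= M -> 0 < e -> e <= 1 -> 20 * M * e <= D ->
    x <= 2 * (2 * M * h) * (2 * e * h)
         + (2 * (2 * e * h) * (2 * M * h) + 2 * (2 * e * h) * (2 * e * h)) ->
  x < 2 * (h * h) * D.
Proof.
move=> h0 M1 e0 e1 eD H; apply: le_lt_trans H _.
have hh0 : 0 < h * h by rewrite mulr_gt0.
have -> : 2 * (2 * M * h) * (2 * e * h)
    + (2 * (2 * e * h) * (2 * M * h) + 2 * (2 * e * h) * (2 * e * h)) =
    (16 * M * e + 8 * e * e) * (h * h) by ring.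
have -> : 2 * (h * h) * D = (2 * D) * (h * h) by ring.
rewrite ltr_pM2r //.
have ee : e * e <= M * e by rewrite ler_pM2r // (le_trans e1).
have Me : 0 < M * e by rewrite mulr_gt0 // (lt_le_trans ltr01).
lra.
Qed.

Section CrossingSquare.
Variables (la de : R -> R * R) (t v : R) (L G : R * R) (M e h D : R).
Hypotheses (ladev : la t = de v) (LM : `|L| <= M) (GM : `|G| <= M).
Hypotheses (M1 : 1 <= M) (e0 : 0 < e) (e1 : e <= 1) (h0 : 0 < h).
Hypotheses (DE : det2 L G = D) (eD : 20 * M * e <= `|D|).
Hypothesis laE : forall x, `|x| <= h ->
  `|la (t + x) - la t - x *: L| <= e * `|x|.
Hypothesis deE : forall x, `|x| <= h ->
  `|de (v + x) - de v - x *: G| <= e * `|x|.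

Let err x y := la (t + x) - de (v + y) - (x *: L - y *: G).

Let errE x y : la (t + x) - de (v + y) = (x *: L - y *: G) + err x y.
Proof. by rewrite /err [RHS]addrCA subrr addr0. Qed.

Let errB x y : `|x| <= h -> `|y| <= h -> `|err x y| <= 2 * e * h.
Proof.
move=> xh yh; rewrite /err.
have -> : la (t + x) - de (v + y) - (x *: L - y *: G) =
    (la (t + x) - la t - x *: L) - (de (v + y) - de v - y *: G).
  by rewrite ladev; apply: injective_projections => /=; ring.
apply: le_trans (ler_normB _ _) _.
have -> : 2 * e * h = e * h + e * h by ring.
by rewrite lerD // (le_trans (laE xh), le_trans (deE yh)) // ler_pM2l.
Qed.

Let hh : `|h| <= h. Proof. by rewrite gtr0_norm. Qed.
Let Nhh : `|- h| <= h. Proof. by rewrite normrN gtr0_norm. Qed.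

(* the functional that sees one edge of the square on its positive side *)
Let side (w : R * R) x y k : `|w| <= M -> `|k| = 1 -> `|x| <= h -> `|y| <= h ->
  k * det2 w (x *: L - y *: G) = h * `|D| ->
  0 < dot2 (- k * w.2, k * w.1) (la (t + x) - de (v + y)).
Proof.
move=> wM k1 xh yh Hk; rewrite errE.
have dotE z : dot2 (- k * w.2, k * w.1) z = k * det2 w z.
  by rewrite /dot2 /det2 /=; ring.
rewrite dotE det2Dr mulrDr Hk.
have B : `|k * det2 w (err x y)| <= 2 * M * (2 * e * h).
  rewrite normrM k1 mul1r (le_trans (det2_norm _ _)) //.
  by rewrite ler_pM ?mulr_ge0 // ?ler_pM2l // errB.
have lt : 2 * M * (2 * e * h) < h * `|D|.
  have -> : 2 * M * (2 * e * h) = h * (4 * (M * e)) by ring.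
  rewrite ltr_pM2l //.
  have Me : 0 < M * e by rewrite mulr_gt0 // (lt_le_trans ltr01).
  by apply: lt_le_trans eD; lra.
have := le_lt_trans B lt; rewrite ltr_norml => /andP[N _].
by rewrite -ltrBlDl sub0r.
Qed.

Let cornerB x y : `|x| <= h -> `|y| <= h -> `|x *: L - y *: G| <= 2 * M * h.
Proof.
move=> xh yh; rewrite (le_trans (ler_normB _ _)) // !normrZ.
have -> : 2 * M * h = h * M + h * M by ring.
by rewrite lerD // ler_pM.
Qed.

(** For adjacent corners of the square the linear model has a determinant of absolute value exactly
    [2 * (h * h) * |D|], so its sign survives the error. *)
Let corner x y x' y' : `|x| <= h -> `|y| <= h -> `|x'| <= h -> `|y'| <= h ->
  `|det2 (la (t + x) - de (v + y)) (la (t + x') - de (v + y'))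
    - det2 (x *: L - y *: G) (x' *: L - y' *: G)| < 2 * (h * h) * `|D|.
Proof.
move=> xh yh xh' yh'; rewrite !errE.
have := cornerB xh yh; have := cornerB xh' yh'.
have := errB xh yh; have := errB xh' yh'.
move: (err x y) (err x' y') (x *: L - y *: G) (x' *: L - y' *: G) => u w p q.
move=> uB wB pB qB.
have -> : det2 (p + u) (q + w) - det2 p q = det2 p w + (det2 u q + det2 u w).
  by rewrite !det2Dl !det2Dr; ring.
apply: (crossing_numbers h0 M1 e0 e1 eD).
rewrite (le_trans (ler_normD _ _)) // lerD //.
  by rewrite (le_trans (det2_norm _ _)) // ler_pM // ?ler_pM2l ?mulr_ge0.
rewrite (le_trans (ler_normD _ _)) // lerD //.
  by rewrite (le_trans (det2_norm _ _)) // ler_pM // ?ler_pM2l ?mulr_ge0.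
by rewrite (le_trans (det2_norm _ _)) // ler_pM // ?ler_pM2l ?mulr_ge0.
Qed.

(** On each edge the difference of the curves stays in the half-plane given by [side], so only the
    corners count. These turn as for the linear map sending [(x, y)] to [x L - y G], whose
    determinant is [- D]: clockwise when [D] is positive. *)
Lemma rho_crossing_square :
  rho (fun x => la x - de (v - h)) (t - h) (t + h)
  + rho (fun y => la (t + h) - de y) (v - h) (v + h)
  - rho (fun x => la x - de (v + h)) (t - h) (t + h)
  - rho (fun y => la (t - h) - de y) (v - h) (v + h)
  = if 0 < D then -1 else 1.
Proof.
have le_h z : z - h <= z + h.
  by rewrite lerD2l (le_trans _ (ltW h0)) // oppr_le0 ltW.
have xtE z x : x = z + (x - z) :> R by rewrite addrC subrK.
have xhb z x : z - h <= x <= z + h -> `|x - z| <= h.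
  by move=> /andP[zx xz]; rewrite ler_norml lerBrDl zx lerBlDl xz.
pose s : R := if 0 < D then 1 else -1.
have s1 : `|s| = 1 by rewrite /s; case: ifP; rewrite ?normrN normr1.
have Ns1 : `|- s| = 1 by rewrite normrN.
have sD : s * D = `|D|.
  rewrite /s; case: ifPn => [D1|]; first by rewrite mul1r gtr0_norm.
  by rewrite -leNgt => D1; rewrite mulN1r ler0_norm.
have GL : det2 G L = - D by rewrite det2C DE.
have LE x y : det2 L (x *: L - y *: G) = - y * D.
  by rewrite det2Dr det2Zr det2xx -scaleNr det2Zr DE mulr0 add0r.
have GE x y : det2 G (x *: L - y *: G) = - x * D.
  by rewrite det2Dr det2Zr GL -scaleNr det2Zr det2xx mulr0 addr0 mulrN mulNr.
have LGE x y x' y' : det2 (x *: L - y *: G) (x' *: L - y' *: G) =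
    (y * x' - x * y') * D.
  by rewrite -DE /det2 /= /GRing.scale /=; ring.
rewrite (@rho_half_plane _ _ (- s * L.2, s * L.1)) //; last first.
  move=> x /xhb hx; rewrite {1}(xtE t x); apply: side => //.
  by rewrite LE opprK -sD; ring.
rewrite (@rho_half_plane _ _ (- (- s) * G.2, (- s) * G.1)) //; last first.
  move=> y /xhb hy; rewrite {1}(xtE v y); apply: side => //.
  by rewrite GE -sD; ring.
rewrite (@rho_half_plane _ _ (- (- s) * L.2, (- s) * L.1)) //; last first.
  move=> x /xhb hx; rewrite {1}(xtE t x); apply: side => //.
  by rewrite LE -sD; ring.
rewrite (@rho_half_plane _ _ (- s * G.2, s * G.1)) //; last first.
  move=> y /xhb hy; rewrite {1}(xtE v y); apply: side => //.
  by rewrite GE opprK -sD; ring.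
have := corner Nhh Nhh hh Nhh; have := corner hh Nhh hh hh.
have := corner hh hh Nhh hh; have := corner Nhh hh Nhh Nhh.
rewrite !LGE.
move: (la (t - h) - de (v - h)) (la (t + h) - de (v - h)) => A B.
move: (la (t + h) - de (v + h)) (la (t - h) - de (v + h)) => C E.
have hhD : 0 < h * h by rewrite mulr_gt0.
rewrite (chiC E C) (chiC A E) !opprK !ltr_norml.
case: ifPn => [D1|].
  rewrite (gtr0_norm D1) => /andP[_ c1] /andP[_ c2] /andP[_ c3] /andP[_ c4].
  by apply: chi_cw; lra.
rewrite -leNgt => D1.
rewrite (ler0_norm D1) => /andP[c1 _] /andP[c2 _] /andP[c3 _] /andP[c4 _].
by apply: chi_ccw; lra.
Qed.

End CrossingSquare.

Lemma rho_crossing la de t v :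
    derivable la t 1 -> derivable de v 1 -> la t = de v ->
    det2 (derive1 la t) (derive1 de v) != 0 ->
  exists2 r : R, 0 < r & forall h, 0 < h -> h <= r ->
    rho (fun x => la x - de (v - h)) (t - h) (t + h)
    + rho (fun y => la (t + h) - de y) (v - h) (v + h)
    - rho (fun x => la x - de (v + h)) (t - h) (t + h)
    - rho (fun y => la (t - h) - de y) (v - h) (v + h)
    = if 0 < det2 (derive1 la t) (derive1 de v) then -1 else 1.
Proof.
move=> dla dde ladev.
have := derivable_expansion dla; have := derivable_expansion dde.
move: (derive1 la t) (derive1 de v) => L G expG expL.
move DE : (det2 L G) => D D0.
have [M [M1 LM GM]] : exists M : R, [/\ 1 <= M, `|L| <= M & `|G| <= M].
  exists (1 + `|L| + `|G|); have := normr_ge0 L; have := normr_ge0 G.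
  by move: (`|L|) (`|G|) => l g *; split; lra.
have M0 : 0 < M by apply: lt_le_trans M1.
have aD0 : 0 < `|D| by rewrite normr_gt0.
have [e [e0 e1 eD]] : exists e : R, [/\ 0 < e, e <= 1 & 20 * M * e <= `|D|].
  exists (Num.min 1 (`|D| / (20 * M))); split.
  - by rewrite lt_min ltr01 divr_gt0 // mulr_gt0.
  - by rewrite ge_min lexx.
  - by rewrite mulrC -ler_pdivlMr ?mulr_gt0 // ge_min lexx orbT.
have [r1 r10 H1] := expL _ e0; have [r2 r20 H2] := expG _ e0.
exists (Num.min r1 r2); first by rewrite lt_min r10.
move=> h h0; rewrite le_min => /andP[hr1 hr2].
apply: (rho_crossing_square ladev LM GM M1 e0 e1 h0 DE eD) => x xh.
  exact/H1/(le_trans xh).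
exact/H2/(le_trans xh).
Qed.

End Crossing.

(** * Winding numbers of a loop and their jumps *)

Section Winding.
Context {R : realType}.
Implicit Types (g de : R -> R * R) (Z : seq (R * R)).

(* The winding number around p of the loop described by g on [s, t] *)
Definition wn g s t (p : R * R) : int := rho (fun x => g x - p) s t.

Lemma continuous_sub2 g de : continuous g -> continuous de ->
  continuous (fun p : R * R => g p.1 - de p.2).
Proof.
move=> cg cde p; apply: (@cvgB R (R * R)%type).
  by apply: (@continuous_comp _ _ _ fst g); [exact: cvg_fst | exact: cg].
by apply: (@continuous_comp _ _ _ snd de); [exact: cvg_snd | exact: cde].
Qed.

Lemma rho_rect_sub g de a b c d : continuous g -> continuous de ->
    a <= b -> c <= d ->
    (forall x y, a <= x <= b -> c <= y <= d -> g x != de y) ->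
  rho (fun x => g x - de c) a b + rho (fun y => g b - de y) c d =
  rho (fun y => g a - de y) c d + rho (fun x => g x - de d) a b.
Proof.
move=> cg cde ab cd H.
apply: (@rho_rect R (fun p => g p.1 - de p.2) a b c d ab cd).
  by move=> p _; apply: continuous_sub2.
by move=> p [p1 p2]; rewrite subr_eq0 H.
Qed.

(** The two lateral sides of the rectangle cancel because the loop is closed. *)
Lemma wn_path g de s t c d : continuous g -> continuous de ->
    s <= t -> c <= d -> g s = g t ->
    (forall x y, s <= x <= t -> c <= y <= d -> g x != de y) ->
  wn g s t (de c) = wn g s t (de d).
Proof.
move=> cg cde st cd gst H.
by have := rho_rect_sub cg cde st cd H; rewrite gst /wn; lia.
Qed.

Definition det_sign (a b : R * R) : int := if 0 < det2 a b then 1 else -1.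

Lemma continuous_path_sub g p : continuous g -> continuous (fun x => g x - p).
Proof. by move=> cg x; apply: (@cvgB R (R * R)%type) (cg x) (cvg_cst p). Qed.

(** A rectangle is cut into three columns: the [b] and [t] are the variations along bottom and top,
    [l] and [r] those along the sides of the middle column, and [f] the variation shared by the two
    outer sides of a closed loop. *)
Lemma jump_algebra (b1 b2 b3 t1 t2 t3 l r f k : int) :
  b1 + l = f + t1 -> b3 + f = r + t3 -> b2 + r - t2 - l = k ->
  t1 + (t2 + t3) - (b1 + (b2 + b3)) = - k.
Proof. lia. Qed.

(** Over [[s, t]] and [[v0 - h, v0 + h]] the outer columns contain no coincidence, so only the
    middle square around [(x0, v0)] contributes, with the index found in [rho_crossing]. *)
Lemma wn_jump g s t x0 v0 r0 : continuous g -> (forall x, derivable g x 1) ->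
    g s = g t -> s < x0 -> x0 < t -> g x0 = g v0 ->
    det2 (derive1 g x0) (derive1 g v0) != 0 -> 0 < r0 ->
    (forall x v, s <= x <= t -> `|v - v0| <= r0 -> g x = g v ->
       x = x0 /\ v = v0) ->
  exists2 r : R, 0 < r & forall h, 0 < h -> h <= r ->
    wn g s t (g (v0 + h)) - wn g s t (g (v0 - h))
    = det_sign (derive1 g x0) (derive1 g v0).
Proof.
move=> cg dg gst sx xt gxv D0 r00 H.
have [r1 r10 H1] := rho_crossing (dg x0) (dg v0) gxv D0.
exists (Num.min (Num.min r0 r1) (Num.min (x0 - s) (t - x0))).
  by rewrite !lt_min r00 r10 !subr_gt0 sx.
move=> h h0; rewrite !le_min => /andP[/andP[hr0 hr1] /andP[hs ht]].
have {}H1 := H1 h h0 hr1.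
have xh : x0 - h <= x0 + h by lra.
have vh : v0 - h <= v0 + h by lra.
have sxh : s <= x0 - h by lra.
have xth : x0 + h <= t by lra.
have far x v : s <= x <= t -> v0 - h <= v <= v0 + h -> x <= x0 - h \/ x0 + h <= x ->
    g x - g v != 0.
  move=> sxt /andP[va vb] xx; rewrite subr_eq0; apply/eqP => gg.
  have [|xe _] := H _ _ sxt _ gg.
    by rewrite ler_norml; apply/andP; split; lra.
  by case: xx; rewrite xe; lra.
have far' x v : s <= x <= t -> v0 - h <= v <= v0 + h -> v <> v0 ->
    g x - g v != 0.
  move=> sxt /andP[va vb] vv; rewrite subr_eq0; apply/eqP => gg.
  have [|_ //] := H _ _ sxt _ gg.
  by rewrite ler_norml; apply/andP; split; lra.
have e1 := rho_rect_sub cg cg sxh vh.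
have e2 := rho_rect_sub cg cg xth vh.
have n1 x v : s <= x <= x0 - h -> v0 - h <= v <= v0 + h -> g x != g v.
  move=> /andP[xs xx] vv; rewrite -subr_eq0; apply: far => //; last by left.
  by rewrite xs /=; lra.
have n2 x v : x0 + h <= x <= t -> v0 - h <= v <= v0 + h -> g x != g v.
  move=> /andP[xs xx] vv; rewrite -subr_eq0; apply: far => //; last by right.
  by rewrite xx andbT; lra.
move: (e1 n1) (e2 n2) => {e1 e2 n1 n2} e1 e2.
have cat v : v0 - h <= v <= v0 + h -> v <> v0 -> wn g s t (g v) =
    rho (fun x => g x - g v) s (x0 - h) +
    (rho (fun x => g x - g v) (x0 - h) (x0 + h)
    + rho (fun x => g x - g v) (x0 + h) t).
  move=> vh' vv; rewrite /wn.
  have xht : x0 - h <= t by lra.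
  have cgv := continuous_path_sub (p := g v) cg.
  rewrite (rho_cat sxh xht) => [|x _|x xx]; [|exact: cgv|exact: far'].
  rewrite (rho_cat xh xth) => [|x _|x /andP[x1 x2]]; [by []|exact: cgv|].
  by apply: far' => //; rewrite x2 andbT; lra.
rewrite !cat; [|lra|lra|lra|lra].
rewrite gst in e1; rewrite (jump_algebra e1 e2 H1) /det_sign.
by case: ifP.
Qed.

End Winding.

Section WindingSum.
Context {R : realType}.
Implicit Types (g de : R -> R * R) (Z : seq (R * R)).

Lemma exists_gap (l : seq R) v : v \notin l ->
  exists2 r : R, 0 < r & forall y, y \in l -> r < `|y - v|.
Proof.
elim: l => [|y l IH]; first by exists 1.
rewrite inE negb_or => /andP[vy /IH[r r0 H]].
have d0 : 0 < `|y - v| by rewrite normr_gt0 subr_eq0 eq_sym.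
exists (Num.min (`|y - v| / 2) (r)); first by rewrite lt_min r0 divr_gt0.
move=> z; rewrite inE => /predU1P[->|/H rz]; rewrite gt_min ?rz ?orbT //.
by rewrite ltr_pdivrMr // ltr_pMr // ltr1n.
Qed.

(** The induction runs on a bound for the size of [Z], because [Z] is split: its head contributes a
    jump at [v0], and the pairs with second parameter below and above [v0] are treated on the two
    remaining intervals. Distinct second parameters isolate the jumps. *)
Lemma wn_sum g s t : continuous g -> (forall x, derivable g x 1) ->
    s <= t -> g s = g t ->
  forall n Z c d, (size Z <= n)%N -> c <= d -> uniq (map snd Z) ->
    (forall z, z \in Z -> [/\ s < z.1 < t, c < z.2 < d, g z.1 = g z.2 &
       det2 (derive1 g z.1) (derive1 g z.2) != 0]) ->
    (forall x v, s <= x <= t -> c <= v <= d -> g x = g v -> (x, v) \in Z) ->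
  wn g s t (g d) - wn g s t (g c) =
  \sum_(z <- Z) det_sign (derive1 g z.1) (derive1 g z.2).
Proof.
move=> cg dg st gst; elim=> [|n IH] [|[x0 v0] Z] c d // szn cd uZ HZ1 HZ2.
- rewrite big_nil (@wn_path _ _ _ _ _ c d cg cg st cd gst) ?subrr // => x v xst vcd.
  by apply/eqP => /(HZ2 _ _ xst vcd).
- rewrite big_nil (@wn_path _ _ _ _ _ c d cg cg st cd gst) ?subrr // => x v xst vcd.
  by apply/eqP => /(HZ2 _ _ xst vcd).
have [/= /andP[sx0 x0t] /andP[cv0 v0d] gxv D0] := HZ1 _ (mem_head _ _).
move: uZ => /= /andP[v0Z uZ].
have [|r0 r00 Hr0] := @exists_gap (c :: d :: map snd Z) v0.
  by rewrite !inE !negb_or v0Z (gt_eqF cv0) (lt_eqF v0d).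
have rc : r0 < v0 - c.
  have := Hr0 c (mem_head _ _).
  by rewrite -normrN opprB gtr0_norm // subr_gt0.
have rd : r0 < d - v0.
  have := Hr0 d; rewrite !inE eqxx orbT => /(_ isT).
  by rewrite gtr0_norm // subr_gt0.
have rZ z : z \in Z -> r0 < `|z.2 - v0|.
  by move=> zZ; apply: Hr0; rewrite !inE map_f ?orbT.
have [|r r1 Hr] := wn_jump cg dg gst sx0 x0t gxv D0 r00.
  move=> x v xst; rewrite ler_norml => /andP[vl vr] gxgv.
  rewrite lerBrDl in vl; rewrite lerBlDl in vr.
  have vcd : c <= v <= d.
    apply/andP; split.
      by apply: (le_trans _ vl); rewrite lerBrDl -lerBrDr ltW.
    by apply: le_trans vr _; rewrite -lerBrDl ltW.
  have := HZ2 _ _ xst vcd gxgv; rewrite inE => /predU1P[[-> ->]//|/rZ /=].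
  by rewrite ltNge ler_norml lerBrDl vl lerBlDl vr.
have [h [h0 hr hr0]] : exists h, [/\ 0 < h, h <= r & h <= r0].
  by exists (Num.min r r0); rewrite lt_min r1 r00 !ge_min !lexx orbT.
have hc : c < v0 - h by rewrite ltrBrDl -ltrBrDr (le_lt_trans hr0).
have hd : v0 + h < d by rewrite -ltrBrDl (le_lt_trans hr0).
have hv : v0 - h < v0 by rewrite ltrBlDr ltrDl.
have hv' : v0 < v0 + h by rewrite ltrDl.
have inZ z : z \in Z -> [/\ s < z.1 < t, c < z.2 < d, g z.1 = g z.2 &
       det2 (derive1 g z.1) (derive1 g z.2) != 0].
  by move=> zZ; apply: HZ1; rewrite inE zZ orbT.
have J := Hr h h0 hr.
have uf (P : pred (R * R)) : uniq [seq z.2 | z <- Z & P z].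
  by apply: subseq_uniq uZ; apply: map_subseq; apply: filter_subseq.
have szf (P : pred (R * R)) : (size [seq z <- Z | P z] <= n)%N.
  by rewrite size_filter (leq_trans (count_size _ _)).
have J1 := IH [seq z <- Z | z.2 < v0] c (v0 - h) (szf _) (ltW hc) (uf _).
have J2 := IH [seq z <- Z | ~~ (z.2 < v0)] (v0 + h) d (szf _) (ltW hd) (uf _).
have telescope (p q u v j j1 j2 : int) :
    v - u = j -> u - p = j1 -> q - v = j2 -> q - p = j + (j1 + j2).
  by move=> <- <- <-; ring.
rewrite big_cons (bigID (fun z => z.2 < v0)) /= -!(big_filter Z).
apply: (telescope _ _ _ _ _ _ _ J); [apply: J1|apply: J2]; last 2 first.
- move=> z; rewrite mem_filter -leNgt => /andP[zv zZ].
  have [? /andP[_ zd] ? ?] := inZ _ zZ; split=> //.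
  rewrite zd andbT -ltrBrDl; apply: le_lt_trans hr0 _.
  by rewrite -[ltRHS]ger0_norm ?subr_ge0 // rZ.
- move=> x v xst /andP[vl vr] gg; rewrite mem_filter /=.
  have lv : v0 < v by apply: lt_le_trans vl.
  have := HZ2 x v xst _ gg; rewrite vr (ltW (lt_trans cv0 lv)) => /(_ isT).
  rewrite inE => /predU1P[[_ e]|->]; first by rewrite e ltxx in lv.
  by rewrite -leNgt ltW.
- move=> z; rewrite mem_filter => /andP[zv zZ].
  have [? /andP[zc _] ? ?] := inZ _ zZ; split=> //.
  rewrite zc /= ltrBrDl -ltrBrDr; apply: le_lt_trans hr0 _.
  by rewrite -[ltRHS]gtr0_norm ?subr_gt0 // distrC rZ.
- move=> x v xst /andP[vl vr] gg; rewrite mem_filter /=.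
  have lv : v < v0 by apply: le_lt_trans vr _.
  have := HZ2 x v xst _ gg; rewrite vl (ltW (lt_trans lv v0d)) => /(_ isT).
  by rewrite inE lv => /predU1P[[_ e]|->//]; rewrite e ltxx in lv.
Qed.

End WindingSum.

(** * A short cut past the double point of a loop *)

Section Corner.
Context {R : realType}.
Variables (g : R -> R * R) (s t : R).
Hypothesis cg : continuous g.
Hypotheses (st : s < t) (gst : g s = g t).
Hypothesis simple : forall x, s < x < t -> g x <> g s.

Variables A B : R * R.
Hypothesis D0 : det2 A B != 0.
Hypothesis expA : forall e : R, 0 < e -> exists2 r : R, 0 < r &
  forall h, `|h| <= r -> `|g (s + h) - g s - h *: A| <= e * `|h|.
Hypothesis expB : forall e : R, 0 < e -> exists2 r : R, 0 < r &
  forall h, `|h| <= r -> `|g (t + h) - g t - h *: B| <= e * `|h|.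

Lemma corner_far r : 0 < r -> r <= (t - s) / 2 ->
  exists2 m : R, 0 < m & forall x, s + r <= x <= t - r -> m <= `|g x - g s|.
Proof.
move=> r0 rst.
have rr : s + r <= t - r by lra.
have cn : continuous (fun x => `|g x - g s|).
  move=> x; apply: (@continuous_comp _ _ _ (fun x => g x - g s) (fun y => `|y|)).
    exact: continuous_path_sub.
  exact: norm_continuous.
have [|c cin Hc] := @EVT_min R (fun x => `|g x - g s|) _ _ rr.
  exact: continuous_subspaceT.
exists `|g c - g s|.
  rewrite normr_gt0 subr_eq0; apply/eqP/simple.
  by move: cin; rewrite in_itv /= => /andP[c1 c2]; lra.
by move=> x xx; apply: Hc; rewrite in_itv.
Qed.

(** By Cramer's rule [p] and [l] are, up to sign, the determinants of [w] with [b] and with [a],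
    divided by [det2 a b]. Each determinant is at most [2 M e (p + l)], and the sum of the two
    bounds is too small. *)
Lemma sector_separation (a b w : R * R) (M e p l : R) :
    `|a| <= M -> `|b| <= M -> 0 <= p -> 0 <= l -> 0 < p + l ->
    4 * M * e < `|det2 a b| ->
    p *: a - l *: b = w -> `|w| <= e * (p + l) -> False.
Proof.
move=> aM bM p0 l0 pl0 small wE wB.
have M0 : 0 <= M := le_trans (normr_ge0 a) aM.
have h1 : p * `|det2 a b| <= 2 * M * (e * (p + l)).
  have -> : p * `|det2 a b| = `|det2 w b|.
    rewrite -wE -[in LHS](ger0_norm p0) -normrM; congr `|_|.
    by rewrite /det2 /= /GRing.scale /=; ring.
  rewrite (le_trans (det2_norm _ _)) // [2 * _ * _]mulrAC.
  by rewrite ler_pM ?mulr_ge0 // ler_pM2l.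
have h2 : l * `|det2 a b| <= 2 * M * (e * (p + l)).
  have -> : l * `|det2 a b| = `|det2 w a|.
    rewrite -wE -[in LHS](ger0_norm l0) -normrM; congr `|_|.
    by rewrite /det2 /= /GRing.scale /=; ring.
  rewrite (le_trans (det2_norm _ _)) // [2 * _ * _]mulrAC.
  by rewrite ler_pM ?mulr_ge0 // ler_pM2l.
have : (p + l) * `|det2 a b| <= (p + l) * (4 * M * e).
  move: h1 h2; move: (`|det2 a b|) => X h1 h2.
  have -> : (p + l) * (4 * M * e) =
    2 * M * (e * (p + l)) + 2 * M * (e * (p + l)) by ring.
  by rewrite mulrDl lerD.
by rewrite ler_pM2l // leNgt small.
Qed.

(* Near the double point the segment lies in the sector spanned by -A and B,
   the loop along the rays of A and -B. *)
Lemma corner_shortcut eta : 0 < eta ->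
  exists e : R, [/\ 0 < e, e <= eta &
    forall r x, 0 <= r <= 1 -> s <= x <= t ->
      g x != g (s - e) + r *: (g (t + e) - g (s - e))].
Proof.
move=> eta0.
have [M [M1 AM BM]] : exists M : R, [/\ 0 < M, `|A| <= M & `|B| <= M].
  have bound (a b : R) : 0 <= a -> 0 <= b -> exists M, [/\ 0 < M, a <= M & b <= M].
    by move=> a0 b0; exists (1 + a + b); split; lra.
  exact: bound.
have D1 : 0 < `|det2 A B| by rewrite normr_gt0.
have [e [e0 e1 eD]] : exists e : R, [/\ 0 < e, e <= 1 & 4 * M * e < `|det2 A B|].
  exists (Num.min 1 (`|det2 A B| / (8 * M))); split.
  - by rewrite lt_min ltr01 divr_gt0 // mulr_gt0.
  - by rewrite ge_min lexx.
  - apply: (@le_lt_trans _ _ (`|det2 A B| / 2)); last first.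
      by rewrite ltr_pdivrMr // ltr_pMr // ltr1n.
    rewrite mulrC -ler_pdivlMr ?mulr_gt0 //; rewrite ge_min; apply/orP; right.
    by rewrite -mulrA -invfM mulrA -natrM.
have [r1 r10 H1] := expA e0; have [r2 r20 H2] := expB e0.
have [r [r0 rr1 rr2 rst]] : exists r : R,
    [/\ 0 < r, r <= r1, r <= r2 & r <= (t - s) / 2].
  exists (Num.min (Num.min r1 r2) ((t - s) / 2)).
  by rewrite !lt_min r10 r20 divr_gt0 ?subr_gt0 // !ge_min !lexx !orbT.
have [m m0 Hm] := corner_far r0 rst.
(* The segment will stay within [(M + 1) * d] of the double point, and the middle part of the loop
   keeps the distance [m] of [corner_far]. *)
have [d [d0 deta dr dm]] : exists d : R,
    [/\ 0 < d, d <= eta, d <= r & (M + 1) * d < m].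
  have M2 : 0 < M + 1 by rewrite addr_gt0.
  exists (Num.min (Num.min eta r) (m / (2 * (M + 1)))); split.
  - by rewrite !lt_min eta0 r0 divr_gt0 // mulr_gt0.
  - by rewrite !ge_min lexx.
  - by rewrite !ge_min lexx !orbT.
  - apply: (@le_lt_trans _ _ (m / 2)); last first.
      by rewrite ltr_pdivrMr // ltr_pMr // ltr1n.
    rewrite mulrC -ler_pdivlMr //; rewrite ge_min; apply/orP; right.
    by rewrite -mulrA -invfM.
exists d; split=> // q x /andP[q0 q1] /andP[sx xt]; apply/eqP => gx.
have q10 : 0 <= 1 - q by rewrite subr_ge0.
have d_ge0 : 0 <= d by exact: ltW.
have nd : `|d| = d by rewrite gtr0_norm.
have Nnd : `|- d| = d by rewrite normrN.
have {H1}H1 h : `|h| <= r -> exists2 w : R * R, `|w| <= e * `|h| &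
    g (s + h) = g s + h *: A + w.
  move=> hr; exists (g (s + h) - g s - h *: A); first exact/H1/(le_trans hr).
  by apply: injective_projections => /=; ring.
have {H2}H2 h : `|h| <= r -> exists2 w : R * R, `|w| <= e * `|h| &
    g (t + h) = g s + h *: B + w.
  move=> hr; exists (g (t + h) - g t - h *: B); first exact/H2/(le_trans hr).
  by rewrite gst; apply: injective_projections => /=; ring.
have [|w2 w2B w2E] := H1 (- d); first by rewrite Nnd.
have [|w3 w3B w3E] := H2 d; first by rewrite nd.
rewrite Nnd in w2B; rewrite nd in w3B.
(* The segment point is [g s - (1 - q) d A + q d B + w], with the two endpoint errors
   interpolated. *)
pose w := (1 - q) *: w2 + q *: w3.
have wB : `|w| <= e * ((1 - q) * d + q * d).
  rewrite (le_trans (ler_normD _ _)) // !normrZ !ger0_norm // mulrDr.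
  by rewrite !(mulrCA e) lerD // ler_wpM2l.
have {}gx : g x = g s - ((1 - q) * d) *: A + (q * d) *: B + w.
  by rewrite gx w2E w3E /w; apply: injective_projections;
    rewrite /= /GRing.scale /=; ring.
have p0 : 0 <= (1 - q) * d by rewrite mulr_ge0 // ltW.
have l0 : 0 <= q * d by rewrite mulr_ge0 // ltW.
have pl0 : 0 < (1 - q) * d + q * d by rewrite -mulrDl subrK mul1r.
(* Near [s], and then near [t], a coincidence is a relation between nonnegative multiples of [A] and
   [- B] with a small right-hand side, excluded by [sector_separation]. In between, distances to the
   double point decide. *)
have [xs|xs] := leP x (s + r).
  have h0 : 0 <= x - s by rewrite subr_ge0.
  have [|w1 w1B w1E] := H1 (x - s).
    by rewrite ger0_norm // lerBlDl.
  rewrite (ger0_norm h0) in w1B.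
  apply: (@sector_separation A B (w - w1) M e (x - s + (1 - q) * d) (q * d)) => //.
  - by rewrite addr_ge0.
  - by rewrite -addrA ltr_wpDl.
  - have : g s + (x - s) *: A + w1 = g s - ((1 - q) * d) *: A + (q * d) *: B + w.
      by rewrite -gx -w1E addrC subrK.
    move=> [E1 E2]; rewrite /= /GRing.scale /= in E1 E2.
    apply: injective_projections; rewrite /= /GRing.scale /=.
      by move: E1; lra.
    by move: E2; lra.
  - rewrite (le_trans (ler_normB _ _)) //.
    by rewrite -[x - s + _ + _]addrA mulrDr [leRHS]addrC lerD.
have [xt'|xt'] := leP (t - r) x.
  have h0 : 0 <= t - x by rewrite subr_ge0.
  have [|w1 w1B w1E] := H2 (x - t).
    by rewrite distrC ger0_norm // lerBlDl -lerBlDr.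
  rewrite distrC (ger0_norm h0) in w1B.
  apply: (@sector_separation A B (w - w1) M e ((1 - q) * d) (t - x + q * d)) => //.
  - by rewrite addr_ge0.
  - by rewrite addrCA ltr_wpDl.
  - have : g s + (x - t) *: B + w1 = g s - ((1 - q) * d) *: A + (q * d) *: B + w.
      by rewrite -gx -w1E addrC subrK.
    move=> [E1 E2]; rewrite /= /GRing.scale /= in E1 E2.
    apply: injective_projections; rewrite /= /GRing.scale /=.
      by move: E1; lra.
    by move: E2; lra.
  - rewrite (le_trans (ler_normB _ _)) //.
    by rewrite [(1 - q) * d + (_ + _)]addrCA mulrDr [leRHS]addrC lerD.
have := Hm x; rewrite (ltW xs) (ltW xt') => /(_ isT); apply/negP.
rewrite -ltNge; apply: le_lt_trans dm.
have -> : g x - g s = (q * d) *: B - ((1 - q) * d) *: A + w.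
  by rewrite gx; apply: injective_projections; rewrite /= /GRing.scale /=; ring.
rewrite (le_trans (ler_normD _ _)) // [leRHS]mulrDl mul1r lerD //.
  rewrite (le_trans (ler_normB _ _)) // !normrZ !ger0_norm //.
  apply: (@le_trans _ _ (q * d * M + (1 - q) * d * M)).
    by rewrite lerD // ler_wpM2l.
  by rewrite le_eqVlt; apply/orP; left; apply/eqP; ring.
apply: le_trans wB _; rewrite -mulrDl subrK mul1r.
by rewrite ler_piMl // ltW.
Qed.

End Corner.

(** * Crossings of a loop with the rest of the diagram *)

Section LoopCrossings.
Context {R : realType}.
Implicit Types (D : knotoid_diagram R) (Z : seq (R * R)).

Lemma double_ptC (g : R -> R * R) s t : double_pt g s t -> double_pt g t s.
Proof. by case=> hs ht st gg; split=> //; rewrite eq_sym. Qed.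

Lemma continuous_crv D : continuous (crv D).
Proof.
move=> x; apply: differentiable_continuous.
exact/derivable1_diffP/crv_derivable.
Qed.

Lemma uniq_snd D Z : uniq Z ->
  (forall z, z \in Z -> double_pt (crv D) z.2 z.1) -> uniq (map snd Z).
Proof.
move=> uZ HZ; rewrite map_inj_in_uniq // => -[x v] [x' v'] /HZ /= h /HZ /= h' /= e.
by move: h h'; rewrite e => h h'; rewrite (crv_no_triple h h').
Qed.

Lemma loop_crossings_sum D Z s t :
    endpoints_in_same_region D -> double_pt (crv D) s t -> s < t -> uniq Z ->
    (forall z, z \in Z -> [/\ s < z.1 < t, ~~ (s <= z.2 <= t) &
       double_pt (crv D) z.1 z.2]) ->
    (forall x v, s < x < t -> ~~ (s <= v <= t) -> double_pt (crv D) x v ->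
       (x, v) \in Z) ->
  \sum_(z <- Z) det_sign (derive1 (crv D) z.1) (derive1 (crv D) z.2) = 0.
Proof.
move=> [g [cg _ g0 g1 gD]] dst st uZ HZ1 HZ2.
have /andP[s0 s1] := crv_endpoints dst.
have /andP[t0 t1] := crv_endpoints (double_ptC dst).
have ss : s <= s <= t by rewrite lexx ltW.
have tt : s <= t <= t by rewrite lexx ltW.
have gst : crv D s = crv D t by case: dst.
have dD x : derivable (crv D) x 1 by exact: crv_derivable.
have cD := @continuous_crv D.
have uZ2 : uniq (map snd Z).
  by apply: (@uniq_snd D) uZ _ => z /HZ1[_ _ /double_ptC h]; exact: h.
have sZ : s \notin map snd Z.
  by apply/mapP => -[z /HZ1[_ + _] e]; rewrite -e ss.
have tZ : t \notin map snd Z.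
  by apply/mapP => -[z /HZ1[_ + _] e]; rewrite -e tt.
have [r1 r10 Hr1] := exists_gap sZ.
have [r2 r20 Hr2] := exists_gap tZ.
(* Then [s - e] and [t + e] stay in [0, 1], and no crossing of [Z] is lost between [s - e] and [s]
   or between [t] and [t + e]. *)
have [eta [eta0 er1 er2 es et]] : exists eta : R,
    [/\ 0 < eta, eta <= r1, eta <= r2, eta <= s & eta <= 1 - t].
  exists (Num.min (Num.min r1 r2) (Num.min s (1 - t))).
  by rewrite !lt_min r10 r20 s0 subr_gt0 t1 !ge_min !lexx !orbT.
have D0 : det2 (derive1 (crv D) s) (derive1 (crv D) t) != 0 := crv_transverse dst.
have simple x : s < x < t -> crv D x <> crv D s.
  move=> /andP[sx xt] e; have : x = t; last by move=> xe; rewrite xe ltxx in xt.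
  apply/esym/(crv_no_triple dst); split=> //; rewrite ?(lt_eqF sx) //.
  - by rewrite (ltW s0) (ltW s1).
  - by rewrite (ltW (lt_trans s0 sx)) (ltW (lt_trans xt t1)).
have [e [e0 eeta He]] := corner_shortcut cD st gst simple D0
  (fun e => derivable_expansion (@dD s)) (fun e => derivable_expansion (@dD t)) eta0.
have path_short : wn (crv D) s t (crv D (s - e)) = wn (crv D) s t (crv D (t + e)).
  pose de r := crv D (s - e) + r *: (crv D (t + e) - crv D (s - e)).
  have cde : continuous de.
    move=> r; apply: (@cvgD R (R * R)%type); first exact: cvg_cst.
    by apply: (@cvgZr_tmp R (R * R)%type); exact: cvg_id.
  have := @wn_path R (crv D) de s t 0 1 cD cde (ltW st) ler01 gst.
  rewrite /de scale0r scale1r addr0 [crv D (s - e) + (_ - _)]addrC subrK.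
  apply=> x y xst y01.
  exact: He.
have path_g : wn (crv D) s t (crv D 0) = wn (crv D) s t (crv D 1).
  rewrite -g0 -g1; apply: (wn_path cD cg (ltW st) ler01 gst).
  move=> x y /andP[sx xt] /andP[y0 y1].
  have x0 : 0 < x by apply: lt_le_trans sx.
  have x1 : x < 1 by apply: le_lt_trans t1.
  have x01 : 0 <= x <= 1 by rewrite !ltW.
  (* At its ends the arc is at the tail and the head, which are not double points and so are off the
     loop. *)
  move: y0; rewrite le_eqVlt => /predU1P[<-|y0].
    rewrite g0; apply/eqP => e'.
    have : (0 : R) < (0 : R) < 1; last by move=> /andP[]; rewrite ltxx.
    apply: (@crv_endpoints _ D 0 x).
    by split=> //; rewrite ?lexx ?ler01 // lt_eqF.
  move: y1; rewrite le_eqVlt => /predU1P[->|y1].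
    rewrite g1; apply/eqP => e'.
    have : (0 : R) < (1 : R) < 1; last by move=> /andP[_]; rewrite ltxx.
    apply: (@crv_endpoints _ D 1 x).
    by split=> //; rewrite ?lexx ?ler01 // gt_eqF.
  by apply/eqP => e'; apply: (gD y x) => //; rewrite y0.
(* The absence of triple points excludes [x = s] and [x = t]: the only partner of [s] is [t]. *)
have inside x v : s <= x <= t -> ~~ (s <= v <= t) -> 0 <= v <= 1 ->
    crv D x = crv D v -> (x, v) \in Z.
  move=> /andP[sx xt] nv v01 gxv.
  have xv : x != v by apply: contraNneq nv => <-; rewrite sx.
  have dxv : double_pt (crv D) x v.
    split=> //; rewrite (le_trans (ltW s0) sx) /=.
    exact: le_trans xt (ltW t1).
  apply: HZ2 => //; apply/andP; split.
    rewrite lt_neqAle sx andbT; apply: contraNneq nv => xs.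
    by rewrite -xs in dxv; rewrite -(crv_no_triple dst dxv).
  rewrite lt_neqAle xt andbT; apply: contraNneq nv => xt'.
  by rewrite xt' in dxv; rewrite -(crv_no_triple (double_ptC dst) dxv).
have uf (P : pred (R * R)) : uniq [seq z.2 | z <- Z & P z].
  by apply: subseq_uniq uZ2; apply: map_subseq; apply: filter_subseq.
have gr1 z : z \in Z -> e < `|z.2 - s|.
  by move=> zZ; apply: le_lt_trans (Hr1 z.2 (map_f _ zZ)); apply: le_trans er1.
have gr2 z : z \in Z -> e < `|z.2 - t|.
  by move=> zZ; apply: le_lt_trans (Hr2 z.2 (map_f _ zZ)); apply: le_trans er2.
have ses : 0 <= s - e by rewrite subr_ge0 (le_trans eeta).
have tet : t + e <= 1 by rewrite -lerBrDl (le_trans eeta).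
have S1 := @wn_sum R (crv D) s t cD (@crv_derivable _ D) (ltW st) gst
  (size [seq z <- Z | z.2 < s]) [seq z <- Z | z.2 < s] 0 (s - e)
  (leqnn _) ses (uf _).
have S2 := @wn_sum R (crv D) s t cD (@crv_derivable _ D) (ltW st) gst
  (size [seq z <- Z | ~~ (z.2 < s)]) [seq z <- Z | ~~ (z.2 < s)] (t + e) 1
  (leqnn _) tet (uf _).
rewrite (bigID (fun z => z.2 < s)) /= -!(big_filter Z) -S1 -?S2.
- by rewrite path_short path_g addrC addrA subrK subrr.
- move=> z; rewrite mem_filter -leNgt => /andP[sz zZ].
  have [zst nz dz] := HZ1 _ zZ.
  split; [exact: zst| |by case: dz|exact: crv_transverse dz].
  have /andP[_ ->] := crv_endpoints (double_ptC dz).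
  rewrite andbT -ltrBrDl; move: nz; rewrite sz /= -ltNge => tz.
  by rewrite -[ltRHS]gtr0_norm ?subr_gt0 // gr2.
- move=> x v xst /andP[vl vr] gg.
  have tv : t < v by apply: lt_le_trans vl; rewrite ltrDl.
  rewrite mem_filter /= -leNgt (le_trans (ltW st) (ltW tv)) /=.
  apply: inside => //; first by rewrite negb_and -!ltNge tv orbT.
  by rewrite vr andbT (le_trans (ltW t0)) // ltW.
- move=> z; rewrite mem_filter => /andP[sz zZ].
  have [zst nz dz] := HZ1 _ zZ.
  split; [exact: zst| |by case: dz|exact: crv_transverse dz].
  have /andP[-> _] := crv_endpoints (double_ptC dz).
  rewrite /= ltrBrDl -ltrBrDr.
  by rewrite -[ltRHS]gtr0_norm ?subr_gt0 // distrC gr1.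
- move=> x v xst /andP[vl vr] gg.
  have tv : v < s by apply: le_lt_trans vr _; rewrite gtrBl.
  rewrite mem_filter /= tv /=.
  apply: inside => //; first by rewrite negb_and -!ltNge tv.
  by rewrite vl (le_trans (ltW tv)) // ltW.
Qed.

End LoopCrossings.

(** * Sums over Gauss diagrams *)

Section GaussSums.
Context {R : realType}.
Implicit Types (C : seq (R * R)) (sg : R * R -> int) (c e : R * R).

Definition kap c e : int :=
  (on_left c e.1 && on_right c e.2)%:Z - (on_right c e.1 && on_left c e.2)%:Z.

Definition deg C sg c : int := \sum_(e <- C) sg e * kap c e.

(* Since kap is 1 on r(c) and -1 on l(c), both halves of the index function take
   the form of one sum; eps = -1 substitutes z^-1 for z. *)
Definition ind C sg (eps : int) k n c : laurent k :=
  \sum_(e <- C | gcdz (deg C sg c) (deg C sg e) == n)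
    zpow k (eps * (kap c e * deg C sg e)) *~ (sg e * kap c e).

(* The sum over all n in the definition of H, cut off at N. *)
Definition Hterm (s : int) (f : nat -> symbol) (N : nat) : ypoly :=
  \sum_(0 <= n < N) (ty (f n) n - ty None n) *~ s.

Lemma on_left_right c x : ~~ (on_left c x && on_right c x).
Proof.
rewrite /on_left /on_right; case: ltP => cc; apply/negP; last first.
  by move=> /andP[/andP[h1 h2] /orP[h|h]]; lra.
by move=> /andP[/orP[h|h] /andP[h1 h2]]; lra.
Qed.

Lemma perm_fset_set_filter (A B : set (R * R)) : finite_set B -> A `<=` B ->
  perm_eq (fset_set A) [seq e <- fset_set B | e \in A].
Proof.
move=> fB AB; apply: uniq_perm; [exact: fset_uniq|exact/filter_uniq/fset_uniq|].
move=> e; rewrite mem_filter !in_fset_set //; last exact: sub_finite_set AB fB.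
by have [eA|//] := boolP (e \in A); apply/esym/mem_set/AB/set_mem.
Qed.

Section OfGauss.
Variable G : gauss_diagram R.
Hypothesis finG : finite_set (chords G).
Hypothesis sgnG : forall c, chords G c -> csgn G c = 1 \/ csgn G c = - 1.

Let C : seq (R * R) := fset_set (chords G).
Let sg := csgn G.

Let CP c : c \in C -> chords G c.
Proof. by rewrite /C in_fset_set // => /set_mem. Qed.

Let card_sum (A : set (R * R)) : A `<=` chords G ->
  Defs.card A = \sum_(e <- C) (e \in A)%:Z.
Proof.
move=> sAC; rewrite /Defs.card (perm_size (perm_fset_set_filter finG sAC)).
rewrite size_filter -sum1_count big_mkcond /= (big_morph Posz PoszD (erefl (Posz 0))).
by apply: eq_bigr => e _; case: (_ \in _).
Qed.

Lemma degree_deg c : degree G c = deg C sg c.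
Proof.
rewrite /degree /deg !card_sum; first last.
all: try by move=> e [[]].
rewrite -!sumrB -big_split /=; apply: eq_big_seq => e /CP Ge.
have mem (A : set (R * R)) s : (e \in with_sign G A s) = (e \in A) && (sg e == s).
  by apply/idP/andP; rewrite !inE /with_sign /= => -[? /eqP].
have rE : (e \in rset G c) = on_left c e.1 && on_right c e.2.
  by apply/idP/andP; rewrite inE /rset /= => -[].
have lE : (e \in lset G c) = on_right c e.1 && on_left c e.2.
  by apply/idP/andP; rewrite inE /lset /= => -[].
rewrite !mem rE lE /kap.
move: (on_left c e.1 && _) (on_right c e.1 && _) => r l.
by case: (sgnG Ge); rewrite -/sg => ->; case: r; case: l.
Qed.

Lemma Ind_ind n c : Ind G n c = ind C sg 1 `|degree G c|%N n c.
Proof.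
have sum_filter (A : set (R * R)) (F : R * R -> laurent `|degree G c|%N) :
    A `<=` chords G -> \sum_(e \in A) F e = \sum_(e <- C | e \in A) F e.
  move=> sAC; rewrite fsbig_finite; last exact: sub_finite_set sAC finG.
  by rewrite (perm_big _ (perm_fset_set_filter finG sAC)) big_filter.
rewrite /Ind !sum_filter; first last.
all: try by move=> e [[]].
rewrite /ind !(big_mkcond (fun e => e \in _)) [RHS]big_mkcond /= -sumrB.
apply: eq_big_seq => e /CP Ge.
have rE : (e \in rset_gcd G n c) = [&& on_left c e.1, on_right c e.2 &
    gcdz (degree G c) (degree G e) == n].
  apply/idP/and3P => [/set_mem[[_ -> ->] /eqP ->]//|[h1 h2 /eqP h3]].
  by apply/mem_set; split=> //; split.
have lE : (e \in lset_gcd G n c) = [&& on_right c e.1, on_left c e.2 &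
    gcdz (degree G c) (degree G e) == n].
  apply/idP/and3P => [/set_mem[[_ -> ->] /eqP ->]//|[h1 h2 /eqP h3]].
  by apply/mem_set; split=> //; split.
rewrite rE lE -!degree_deg /kap mul1r.
have := on_left_right c e.1.
case: ifP; case: (on_left c e.1); case: (on_right c e.1) => //=;
  case: (on_left c e.2); case: (on_right c e.2); case: (_ == _) => //=;
  by move=> *; rewrite ?subr0 ?sub0r ?mulr0 ?mulr0z ?mulr1 ?mul1r ?mulN1r
    ?mulrN1 ?mulrNz.
Qed.

(** When [n] exceeds every gcd of two degrees, the index is an empty sum and its term is
    [t^0 - 1 = 0]. The cut-off is left free above [N0] so that two diagrams can share one. *)
Lemma Hgauss_Hterm : exists N0, forall N, (N0 <= N)%N ->
  Hgauss G = \sum_(c <- C)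
    Hterm (sg c) (fun n => tpow (ind C sg 1 `|deg C sg c|%N n c)) N.
Proof.
exists (\max_(c <- C) \max_(e <- C) `|gcdz (deg C sg c) (deg C sg e)|%N.+1).
move=> N leN.
have small c e : c \in C -> e \in C ->
    (`|gcdz (deg C sg c) (deg C sg e)| < N)%N.
  move=> cC eC; apply: leq_trans leN.
  apply: leq_trans (leq_bigmax_seq _ cC isT).
  exact: (@leq_bigmax_seq _ C xpredT
    (fun e => `|gcdz (deg C sg c) (deg C sg e)|%N.+1) e eC isT).
pose F (p : R * R * nat) : ypoly :=
  (ty (tpow (ind C sg 1 `|deg C sg p.1|%N p.2 p.1)) p.2 - ty None p.2) *~ sg p.1.
rewrite /Hgauss; transitivity (\sum_(p \in chords G `*` `I_N) F p).
  transitivity (\sum_(p \in chords G `*` [set: nat]) F p).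
    by apply: eq_fsbigr => p _; rewrite /F Ind_ind degree_deg.
  apply/esym/fsbig_widen; first by move=> p [].
  move=> -[c n] /= [[Gc _]] nN; rewrite /F /=.
  have cC : c \in C by rewrite in_fset_set // mem_set.
  rewrite /ind big_seq_cond big1 ?/tpow ?insubF ?eqxx ?subrr ?mul0rz //.
  move=> e /andP[eC /eqP gn]; exfalso; apply: nN; split=> //=.
  by have := small _ _ cC eC; rewrite gn.
rewrite fsbig_finite; last by apply: finite_setX => //; exact: finite_II.
rewrite (perm_big [seq (c, n) | c <- C, n <- index_iota 0 N]) /=; last first.
  apply: uniq_perm; first exact: fset_uniq.
    by apply: allpairs_uniq; [exact: fset_uniq|exact: iota_uniq|move=> [? ?] [? ?]].
  move=> [c n]; rewrite in_fset_set; last by apply: finite_setX => //; exact: finite_II.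
  apply/idP/allpairsP => [/set_mem[/= Gc nN]|[[c' n'] /= [cC nN [-> ->]]]].
    by exists (c, n); rewrite /= mem_index_iota nN in_fset_set ?mem_set.
  by apply/mem_set; split=> /=; [exact: CP|rewrite mem_index_iota in nN].
by rewrite big_allpairs.
Qed.

End OfGauss.
End GaussSums.

(** * Substitutions in t and z *)

Section Substitutions.

Lemma subst_exponent_is_additive F : zmod_morphism (subst_exponent F).
Proof. exact: lift_is_additive. Qed.

HB.instance Definition _ F := GRing.isZmodMorphism.Build ypoly ypoly
  (subst_exponent F) (subst_exponent_is_additive F).

Lemma zinv_is_additive k : zmod_morphism (@zinv k).
Proof. exact: lift_is_additive. Qed.

HB.instance Definition _ k := GRing.isZmodMorphism.Build (laurent k) (laurent k)
  (@zinv k) (@zinv_is_additive k).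

(** [F] has to fix 0 because every [t^0] is the one symbol [None], which the substitution keeps. *)
Lemma subst_exponent_tpow (F : forall k, laurent k -> laurent k) k
    (f : laurent k) n : F k 0 = 0 ->
  subst_exponent F (ty (tpow f) n) = ty (tpow (F k f)) n.
Proof.
move=> F0; rewrite /subst_exponent /ty liftU scale1r; congr << (_, _) >>.
rewrite {1}/tpow; case: insubP => [u _ <- //|] /=.
by rewrite negbK => /eqP ->; rewrite F0 /tpow insubF ?eqxx.
Qed.

Lemma tpow0 k : tpow (0 : laurent k) = None.
Proof. by rewrite /tpow insubF ?eqxx. Qed.

Lemma subst_exponent_Hterm (F : forall k, laurent k -> laurent k) k
    (f : nat -> laurent k) s N : (forall k, F k 0 = 0) ->
  subst_exponent F (Hterm s (fun n => tpow (f n)) N) =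
  Hterm s (fun n => tpow (F k (f n))) N.
Proof.
move=> F0; rewrite /Hterm raddf_sum; apply: eq_bigr => n _ /=.
rewrite raddfMz raddfB /= subst_exponent_tpow //.
by rewrite -[None](tpow0 k) subst_exponent_tpow // F0 tpow0.
Qed.

Lemma zinv_zpow k j : zinv (zpow k j) = zpow k (- j).
Proof.
rewrite /zinv /zpow liftU scale1r; congr << _ >>; apply: val_inj => /=.
by rewrite modzNm.
Qed.

End Substitutions.

(** * Maps of chords that change signs and sides uniformly *)

Section GaussMorphisms.
Context {R : realType}.
Implicit Types (C : seq (R * R)) (sg : R * R -> int) (c e : R * R).

Lemma Hterm_ext s s' f f' N : s = s' -> (forall n, f n = f' n) ->
  Hterm s f N = Hterm s' f' N.
Proof. by move=> -> ff; apply: eq_bigr => n _; rewrite ff. Qed.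

Lemma HtermN s f N : Hterm (- s) f N = - Hterm s f N.
Proof. by rewrite /Hterm -sumrN; apply: eq_bigr => n _; rewrite mulrNz. Qed.

Lemma zinv_ind C sg eps k n c : zinv (ind C sg eps k n c) = ind C sg (- eps) k n c.
Proof.
rewrite /ind raddf_sum; apply: eq_bigr => e _.
by rewrite raddfMz /= zinv_zpow mulNr.
Qed.

Definition is_sign (s : int) := s = 1 \/ s = - 1.

Section Map.
Variables (C C' : seq (R * R)) (sg sg' : R * R -> int) (f : R * R -> R * R).
Variables (e1 e2 : int).
Hypotheses (s1 : is_sign e1) (s2 : is_sign e2).
Hypothesis CC' : perm_eq C' (map f C).
Hypothesis sgf : forall c, c \in C -> sg' (f c) = e2 * sg c.
Hypothesis kapf : forall c e, c \in C -> e \in C ->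
  kap (f c) (f e) = e1 * kap c e.

Let sq (s : int) : is_sign s -> s * s = 1.
Proof. by case=> ->. Qed.

Lemma deg_map c : c \in C -> deg C' sg' (f c) = e1 * e2 * deg C sg c.
Proof.
move=> cC; rewrite /deg (perm_big _ CC') big_map mulr_sumr.
apply: eq_big_seq => e eC; rewrite sgf // kapf //; ring.
Qed.

Lemma gcdz_sign s a b : is_sign s -> gcdz (s * a) (s * b) = gcdz a b.
Proof. by case=> ->; rewrite ?mul1r // !mulN1r gcdzN gcdNz. Qed.

(** The exponent is a product of a [kap] and a degree, so [e1] enters it twice and cancels: [e2]
    alone inverts z. The coefficients are multiplied by [e1 * e2], which inverts t. *)
Lemma ind_map eps k n c : c \in C ->
  ind C' sg' eps k n (f c) = ind C sg (e2 * eps) k n c *~ (e1 * e2).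
Proof.
move=> cC; rewrite /ind (perm_big _ CC') big_map /=.
rewrite mulrz_suml big_seq_cond [RHS]big_seq_cond.
have s12 : is_sign (e1 * e2) by case: s1 => ->; case: s2 => ->; [left|right|right|left].
apply: eq_big => [e|e /andP[eC _]].
  by case eC: (e \in C) => //=; rewrite !deg_map // gcdz_sign.
rewrite deg_map // kapf // sgf //.
have -> : eps * (e1 * kap c e * (e1 * e2 * deg C sg e)) =
   e2 * eps * (kap c e * deg C sg e) * (e1 * e1) by ring.
rewrite (sq s1) mulr1 -mulrzA; congr (_ *~ _); ring.
Qed.

Lemma absz_sign s a : is_sign s -> `|(s * a)%R|%N = `|a|%N.
Proof. by case=> ->; rewrite ?mul1r // mulN1r abszN. Qed.

Lemma sum_Hterm_map N :
  \sum_(c <- C') Hterm (sg' c)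
     (fun n => tpow (ind C' sg' 1 `|deg C' sg' c|%N n c)) N =
  \sum_(c <- C) Hterm (e2 * sg c)
     (fun n => tpow (ind C sg e2 `|deg C sg c|%N n c *~ (e1 * e2))) N.
Proof.
rewrite (perm_big _ CC') big_map; apply: eq_big_seq => c cC.
apply: Hterm_ext => [|n]; first exact: sgf.
have s12 : is_sign (e1 * e2) by case: s1 => ->; case: s2 => ->; [left|right|right|left].
by rewrite (ind_map _ _ _ cC) mulr1 (deg_map cC) (absz_sign _ s12).
Qed.

End Map.
End GaussMorphisms.

(** * Inverse and mirror image *)

Section DiagramSums.
Context {R : realType}.
Implicit Types (D : knotoid_diagram R) (c e : R * R).

Definition crossings D : seq (R * R) := fset_set (chords (gauss D)).

Lemma finite_chords D : finite_set (chords (gauss D)).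
Proof. by apply: sub_finite_set (@crv_finite _ D) => c []. Qed.

Lemma crossingsP D c : reflect (chords (gauss D) c) (c \in crossings D).
Proof.
rewrite /crossings in_fset_set; last exact: finite_chords.
by apply: (iffP idP) => [/set_mem|/mem_set].
Qed.

Lemma csgn_sign D c : is_sign (csgn (gauss D) c).
Proof. by rewrite /=; case: ifP; [left|right]. Qed.

Lemma Hpoly_Hterm D : exists N0, forall N, (N0 <= N)%N ->
  Hpoly D = \sum_(c <- crossings D) Hterm (csgn (gauss D) c)
    (fun n => tpow (ind (crossings D) (csgn (gauss D)) 1
                      `|deg (crossings D) (csgn (gauss D)) c|%N n c)) N.
Proof.
by apply: Hgauss_Hterm => [|c _]; [exact: finite_chords|exact: csgn_sign].
Qed.

Lemma Hpoly_map D D' (f : R * R -> R * R) (e1 e2 : int) : injective f ->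
    is_sign e1 -> is_sign e2 ->
    (forall c, chords (gauss D) c -> chords (gauss D') (f c)) ->
    (forall c, chords (gauss D') c -> exists2 b, chords (gauss D) b & c = f b) ->
    (forall c, chords (gauss D) c ->
       csgn (gauss D') (f c) = e2 * csgn (gauss D) c) ->
    (forall c e, chords (gauss D) c -> chords (gauss D) e ->
       kap (f c) (f e) = e1 * kap c e) ->
  exists N0, forall N, (N0 <= N)%N ->
    Hpoly D' = \sum_(c <- crossings D) Hterm (e2 * csgn (gauss D) c)
      (fun n => tpow (ind (crossings D) (csgn (gauss D)) e2
         `|deg (crossings D) (csgn (gauss D)) c|%N n c *~ (e1 * e2))) N.
Proof.
move=> injf s1 s2 Gf fG sgf kapf; have [N0 HN] := Hpoly_Hterm D'.
exists N0 => N /HN ->; apply: (sum_Hterm_map (f := f)) => //.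
- apply: uniq_perm; [exact: fset_uniq| |].
    by rewrite (map_inj_uniq injf); exact: fset_uniq.
  move=> c; apply/crossingsP/mapP => [/fG[b Gb ->]|[b /crossingsP Gb ->]].
    by exists b => //; apply/crossingsP.
  exact: Gf.
- by move=> c /crossingsP; apply: sgf.
- by move=> c e /crossingsP Gc /crossingsP Ge; apply: kapf.
Qed.

Definition rev (c : R * R) : R * R := (c.2, c.1).

Lemma on_right_rev c x : c.1 != c.2 -> on_right (rev c) x = on_left c x.
Proof. by rewrite /on_right /on_left /=; case: ltgtP. Qed.

Lemma on_left_rev c x : c.1 != c.2 -> on_left (rev c) x = on_right c x.
Proof. by rewrite /on_right /on_left /=; case: ltgtP. Qed.

Lemma kap_rev c e : kap c (rev e) = - kap c e.
Proof.
by rewrite /kap /= opprB (andbC (on_left c e.2)) (andbC (on_right c e.2)).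
Qed.

Lemma kap_revl c e : c.1 != c.2 -> kap (rev c) e = - kap c e.
Proof. by move=> c12; rewrite /kap !on_right_rev // !on_left_rev // opprB. Qed.

Lemma chord_neq D c : chords (gauss D) c -> c.1 != c.2.
Proof. by case=> -[]. Qed.

Lemma csgn_rev D c : double_pt (crv D) c.1 c.2 ->
  csgn (gauss D) (rev c) = - csgn (gauss D) c.
Proof.
have sgnN (u v : R * R) : det2 u v != 0 ->
    (if 0 < det2 v u then 1 else -1 : int) = - (if 0 < det2 u v then 1 else -1).
  by rewrite (det2C v u) oppr_gt0; case: ltgtP; rewrite ?opprK.
move=> /crv_transverse; exact: sgnN.
Qed.

(** Both velocities at a crossing are negated, so signs persist; the reversal of the parameter
    exchanges the two sides of each chord, so [kap] is negated. *)
Lemma Hpoly_inverse D : Hpoly (inverse D) = subst_tinv (Hpoly D).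
Proof.
pose f (c : R * R) : R * R := (1 - c.1, 1 - c.2).
have fK : cancel f f by move=> [x y]; rewrite /f /= !subKr.
have flipP x y : double_pt (crv D) x y -> double_pt (crv (inverse D)) (1 - x) (1 - y).
  move=> dxy; apply: (@double_pt_flip _ (crv (inverse D))).
  by case: dxy => *; split=> //=; rewrite !subKr.
have onE c x : c.1 != c.2 -> (on_right (f c) (1 - x) = on_left c x)
    /\ (on_left (f c) (1 - x) = on_right c x).
  rewrite /on_right /on_left /= !ltrD2l !ltrN2.
  by case: ltgtP => //= _ _; rewrite andbC orbC.
have [||c|c|c|c e|N1 H1] := @Hpoly_map D (inverse D) f (-1) 1 (can_inj fK).
- by right.
- by left.
- by move=> [dc o1 o2]; split; rewrite /= ?subKr //; apply: flipP.
- move=> [dc o1 o2]; exists (f c); rewrite ?fK //; split=> //.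
  exact: double_pt_flip dc.
- move=> [dc o1 o2]; rewrite /= mul1r !inverse_derive1 !subKr.
  by rewrite /det2 /= !mulrNN.
- move=> /chord_neq c12 _; rewrite /kap /=.
  by rewrite !(onE c _ c12).1 !(onE c _ c12).2; ring.
have [N0 H0] := Hpoly_Hterm D.
rewrite (H1 _ (leq_maxl N1 N0)) (H0 _ (leq_maxr N1 N0)) /subst_tinv raddf_sum /=.
apply: eq_bigr => c _; rewrite subst_exponent_Hterm; last by move=> k; rewrite oppr0.
apply: Hterm_ext => [|n]; first by rewrite mul1r.
by rewrite mulr1 mulrN1z.
Qed.

(** All chords are reversed, which negates the signs; [kap] changes sign once for each of its
    arguments and is preserved. *)
Lemma Hpoly_mirror D : Hpoly (mirror D) = - subst_tinv (subst_zinv (Hpoly D)).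
Proof.
have fK : cancel rev rev by case.
have [||c|c|c|c e|N1 H1] := @Hpoly_map D (mirror D) rev 1 (-1) (can_inj fK).
- by left.
- by right.
- by move=> [dc o1 o2]; split=> //=; [exact: double_ptC|rewrite negbK].
- move=> [dc /= o1 o2]; exists (rev c); rewrite ?fK //; split=> //=.
    exact: double_ptC.
  by rewrite negbK in o2.
- by move=> [dc o1 o2]; rewrite mulN1r -csgn_rev.
- by move=> /chord_neq c12 _; rewrite kap_rev kap_revl // opprK mul1r.
have [N0 H0] := Hpoly_Hterm D.
rewrite (H1 _ (leq_maxl N1 N0)) (H0 _ (leq_maxr N1 N0)).
rewrite /subst_tinv /subst_zinv raddf_sum /= raddf_sum /= -sumrN.
apply: eq_bigr => c _; rewrite !subst_exponent_Hterm; first last.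
- by move=> k; rewrite raddf0.
- by move=> k; rewrite oppr0.
rewrite -HtermN; apply: Hterm_ext => [|n]; first by rewrite mulN1r.
by rewrite zinv_ind mul1r mulrN1z.
Qed.

End DiagramSums.

(** * Vanishing when the endpoints share a region *)

Section SameRegion.
Context {R : realType}.
Implicit Types (D : knotoid_diagram R) (c e : R * R).

Lemma on_leftE c x : x != c.1 -> x != c.2 -> on_left c x = ~~ on_right c x.
Proof.
rewrite /on_left /on_right; case: (ltP c.1 c.2) => cc; case: (ltgtP x c.1);
  case: (ltgtP x c.2) => //= h1 h2; lra.
Qed.

(** For chords without a common end, left is the complement of right, and [kap] becomes the
    increment along [e] of the indicator of the right side, a form that telescopes. *)
Lemma kap_on_right c e : e.1 != c.1 -> e.1 != c.2 -> e.2 != c.1 -> e.2 != c.2 ->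
  kap c e = (on_right c e.2)%:Z - (on_right c e.1)%:Z.
Proof.
move=> h1 h2 h3 h4; rewrite /kap !on_leftE //.
by case: (on_right c e.1); case: (on_right c e.2).
Qed.

Lemma kapcc c : kap c c = 0.
Proof. by rewrite /kap /on_left /on_right; case: ifP; rewrite !ltxx ?andbF. Qed.

Lemma double_pt_eq D c e : double_pt (crv D) c.1 c.2 -> double_pt (crv D) e.1 e.2 ->
  [\/ e = c, e = rev c | [/\ e.1 != c.1, e.1 != c.2, e.2 != c.1 & e.2 != c.2]].
Proof.
case: c e => [c1 c2] [e1 e2] /= dc de; rewrite /rev /=.
have [h|h1] := eqVneq e1 c1.
  by constructor 1; rewrite h in de *; rewrite (crv_no_triple de dc).
have [h|h2] := eqVneq e1 c2.
  by constructor 2; rewrite h in de *; rewrite (crv_no_triple de (double_ptC dc)).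
constructor 3; split=> //; apply/eqP => h; rewrite h in de.
  by rewrite (crv_no_triple (double_ptC de) dc) eqxx in h2.
by rewrite (crv_no_triple (double_ptC de) (double_ptC dc)) eqxx in h1.
Qed.

Lemma rev_chord D c : chords (gauss D) c -> ~ chords (gauss D) (rev c).
Proof. by move=> [_ o1 o2] [_ /= o3 o4]; rewrite o1 in o4. Qed.

Lemma deg_rev C sg c : c.1 != c.2 :> R -> deg C sg (rev c) = - deg C sg c.
Proof.
move=> c12; rewrite /deg -sumrN; apply: eq_bigr => e _.
by rewrite kap_revl // mulrN.
Qed.

(** Only the chords of [F], with exactly one end on the loop, contribute. Once [o] lists that end
    first, [sgn(e) kap(c, e)] is minus the determinant sign summed in [loop_crossings_sum], in
    whichever direction [e] runs. *)
Lemma deg_same_region D c : endpoints_in_same_region D ->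
  double_pt (crv D) c.1 c.2 -> deg (crossings D) (csgn (gauss D)) c = 0.
Proof.
move=> same; wlog c12 : c / c.1 < c.2 => [wl dc|dc].
  have n12 : c.1 != c.2 by case: dc.
  move: (n12); rewrite neq_lt => /orP[/wl/(_ dc)//|c21].
  have := wl (rev c) c21 (double_ptC dc).
  by rewrite deg_rev // => /eqP; rewrite oppr_eq0 => /eqP.
pose inn x : bool := c.1 < x < c.2.
pose F := [seq e <- crossings D | inn e.1 (+) inn e.2].
pose o (e : R * R) := if inn e.1 then e else rev e.
have FP e : e \in F -> chords (gauss D) e /\ inn e.1 (+) inn e.2.
  by rewrite mem_filter => /andP[? /crossingsP].
have onE x : on_right c x = inn x by rewrite /on_right c12.
have generic e : e \in F ->
    [/\ e.1 != c.1, e.1 != c.2, e.2 != c.1 & e.2 != c.2].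
  move=> /FP[[de _ _] xe]; case: (double_pt_eq dc de) => // ee;
    by rewrite ee /inn /= !ltxx ?andbF in xe.
have := @loop_crossings_sum R D (map o F) c.1 c.2 same dc c12.
rewrite big_map => S.
have {S}S : \sum_(e <- F) det_sign (derive1 (crv D) (o e).1) (derive1 (crv D) (o e).2) = 0.
  apply: S.
  - rewrite map_inj_in_uniq; first exact/filter_uniq/fset_uniq.
    move=> e e' /FP[Ge _] /FP[Ge' _]; rewrite /o.
    case: (inn e.1); case: (inn e'.1) => // h.
    + by case: (rev_chord Ge'); rewrite -h.
    + by case: (rev_chord Ge); rewrite h.
    + by move: h; case: (e) (e') => [? ?] [? ?] [-> ->].
  - move=> z /mapP[e eF ->]; have [[de _ _] xe] := FP e eF.
    have [n1 n2 n3 n4] := generic e eF.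
    have out x : x != c.1 -> x != c.2 -> ~~ inn x -> ~~ (c.1 <= x <= c.2).
      by move=> x1 x2; rewrite /inn !lt_neqAle x2 eq_sym x1.
    rewrite /o; move: xe; case: ifP => [i1 /= i2|i1 /= i2].
      by split=> //; apply: out.
    by split=> //; [apply: out; rewrite ?i1|exact: double_ptC].
  - move=> x v xin vin dxv; have := dxv => /ov_crossing ovx.
    have ixin : inn x := xin.
    have vout : ~~ inn v.
      by apply: contra vin => /andP[? ?]; rewrite !ltW.
    case ox: (ov D x) ovx => /esym ovv.
      apply/mapP; exists (x, v); last by rewrite /o /= ixin.
      rewrite mem_filter /= ixin (negbTE vout) /=.
      by apply/crossingsP; split=> //=; rewrite ox.
    apply/mapP; exists (v, x); last by rewrite /o /= (negbTE vout).
    rewrite mem_filter /= (negbTE vout) ixin /=.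
    apply/crossingsP; split=> //=; [exact: double_ptC| |by rewrite ox].
    by move: ovv => /negbFE.
rewrite /deg (bigID (fun e => inn e.1 (+) inn e.2)) /= -(big_filter (crossings D)).
rewrite -/F [X in _ + X]big1_seq => [|e /andP[xe /crossingsP Ge]].
  rewrite addr0; apply: oppr_inj; rewrite oppr0 -[RHS]S -sumrN.
  apply: eq_big_seq => e eF.
  have [[de _ _] xe] := FP e eF; have [n1 n2 n3 n4] := generic e eF.
  rewrite kap_on_right // !onE /o; move: xe.
  case i1: (inn e.1) => /= i2; first by rewrite (negbTE i2) sub0r mulrN1 opprK.
  by rewrite i2 subr0 mulr1 -csgn_rev.
case: Ge => de o1 o2; case: (double_pt_eq dc de) => [->|->|[n1 n2 n3 n4]].
- by rewrite kapcc mulr0.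
- by rewrite kap_rev kapcc oppr0 mulr0.
rewrite kap_on_right // !onE; move: xe.
by case: (inn e.1); case: (inn e.2) => //=; rewrite subrr mulr0.
Qed.

Lemma Hpoly_same_region D : endpoints_in_same_region D -> Hpoly D = 0.
Proof.
move=> same; have [N H] := Hpoly_Hterm D; rewrite (H N) //.
have d0 c : c \in crossings D -> deg (crossings D) (csgn (gauss D)) c = 0.
  by move=> /crossingsP[dc _ _]; apply: deg_same_region.
apply: big1_seq => c /andP[_ cC]; rewrite /Hterm big1 // => n _.
suff -> : ind (crossings D) (csgn (gauss D)) 1
    `|deg (crossings D) (csgn (gauss D)) c|%N n c = 0.
  by rewrite tpow0 subrr mul0rz.
(* All gcds are [gcd(0, 0) = 0], so the index is an empty sum unless [n = 0]. *)
rewrite /ind; have [n0|n0] := eqVneq n 0%N; last first.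
  rewrite big_seq_cond big1 // => e /andP[eC]; rewrite !d0 //.
  by rewrite /gcdz /= eqz_nat eq_sym (negbTE n0).
transitivity (zpow `|deg (crossings D) (csgn (gauss D)) c|%N 0 *~
   deg (crossings D) (csgn (gauss D)) c); last by rewrite d0 // mulr0z.
rewrite [X in _ = _ *~ X]/deg mulrz_sumr [LHS]big_mkcond; apply: eq_big_seq => e eC.
by rewrite !d0 // n0 !mulr0.
Qed.

End SameRegion.

(** * Sums over crossings listed in either direction *)

Section CrossingLists.
Context {R : realType}.
Implicit Types (D : knotoid_diagram R) (c e : R * R) (S : seq (R * R)).

(* Each crossing may be listed in either direction: the moves are compared
   along strands, whichever of them is the upper one. *)
Definition crossing_list D S : Prop :=
  [/\ uniq S, forall c, c \in S -> double_pt (crv D) c.1 c.2,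
      forall c, c \in S -> rev c \notin S &
      forall x y, double_pt (crv D) x y -> (x, y) \in S \/ (y, x) \in S].

Definition Hchord S (sg : R * R -> int) (b : bool) N c : ypoly :=
  let k := `|deg S sg c|%N in
  if b then Hterm (sg c) (fun n => tpow (ind S sg 1 k n c)) N
  else Hterm (- sg c) (fun n => tpow (- ind S sg (-1) k n c)) N.

Definition Hsum S sg (o : R -> bool) N : ypoly :=
  \sum_(c <- S) Hchord S sg (o c.1) N c.

Lemma ind_rev S sg eps k n c : c.1 != c.2 :> R ->
  ind S sg eps k n (rev c) = - ind S sg (- eps) k n c.
Proof.
move=> c12; rewrite /ind deg_rev // -[in RHS]sumrN; apply: eq_big => [e|e _].
  by rewrite gcdNz.
by rewrite kap_revl // mulrN mulrNz mulNr mulrN mulNr.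
Qed.

Lemma revK : cancel (@rev R) rev. Proof. by case. Qed.

(** Reversing a listed crossing [e] negates its sign, its degree and [kap c e]; degrees and indices
    involve only products of two of these, and gcds. *)
Lemma Hpoly_Hsum D S : crossing_list D S ->
  exists N0, forall N, (N0 <= N)%N ->
    Hpoly D = Hsum S (csgn (gauss D)) (ov D) N.
Proof.
move=> [uS dS rS cS]; set sg := csgn (gauss D).
pose f c := if ov D c.1 then c else rev c.
have inS c : c \in S -> chords (gauss D) (f c).
  move=> cinS; have dc := dS _ cinS; have o := ov_crossing dc.
  rewrite /f; case: ifP o => ovc /esym o.
    by split=> //; rewrite -o.
  by split=> /=; [exact: double_ptC|move/negbFE: o|rewrite ovc].
have perm : perm_eq (crossings D) (map f S).
  apply: uniq_perm; first exact: fset_uniq.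
    rewrite map_inj_in_uniq // => c e cinS einS; rewrite /f.
    case: (ov D c.1); case: (ov D e.1) => // h.
    - by have := rS _ einS; rewrite -h cinS.
    - by have := rS _ cinS; rewrite h einS.
    - exact: (can_inj revK).
  move=> c; apply/crossingsP/mapP => [[dc o1 o2]|[e einS ->]]; last exact: inS.
  case: (cS _ _ dc) => h.
    by exists c; [rewrite [c]surjective_pairing|rewrite /f o1].
  by exists (c.2, c.1) => //; rewrite /f /= (negbTE o2) -[LHS]revK.
have degE c : deg (crossings D) sg c = deg S sg c.
  rewrite /deg (perm_big _ perm) big_map; apply: eq_big_seq => e einS.
  rewrite /f; case: ifP => // _; rewrite kap_rev /sg csgn_rev ?mulrNN //.
  exact: dS.
have indE eps k n c : ind (crossings D) sg eps k n c = ind S sg eps k n c.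
  rewrite /ind (perm_big _ perm) big_map /= big_seq_cond [RHS]big_seq_cond.
  apply: eq_big => [e|e /andP[einS _]]; rewrite /f.
    case einS : (e \in S) => //=; rewrite !degE; case: ifP => // _.
    by rewrite deg_rev ?gcdzN //; have [] := dS _ einS.
  rewrite !degE; case: ifP => // _; rewrite kap_rev deg_rev ?mulrNN.
    by rewrite /sg csgn_rev ?mulrNN //; exact: dS.
  by have [] := dS _ einS.
have [N0 H0] := Hpoly_Hterm D; exists N0 => N /H0 ->.
rewrite (perm_big _ perm) big_map /Hsum; apply: eq_big_seq => c cinS.
have dc := dS _ cinS; have c12 : c.1 != c.2 by case: dc.
rewrite /Hchord /f; case: ifP => _.
  by apply: Hterm_ext => // n; rewrite indE degE.
apply: Hterm_ext => [|n]; first by rewrite csgn_rev.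
by rewrite indE (ind_rev _ _ _ _ _ c12) degE (deg_rev _ _ c12) abszN.
Qed.

Lemma Hchord_ext S S' sg sg' b N c c' : sg c = sg' c' ->
    deg S sg c = deg S' sg' c' ->
    (forall eps n, is_sign eps -> let k := `|deg S sg c|%N in
       ind S sg eps k n c = ind S' sg' eps k n c') ->
  Hchord S sg b N c = Hchord S' sg' b N c'.
Proof.
move=> sE dE iE; rewrite /Hchord -dE; case: b.
  by apply: Hterm_ext => // n; rewrite iE //; left.
by apply: Hterm_ext => [|n]; rewrite ?sE // iE //; right.
Qed.

Lemma HchordN S sg b N c c' : sg c' = - sg c ->
    deg S sg c = deg S sg c' ->
    (forall eps n, is_sign eps -> let k := `|deg S sg c|%N in
       ind S sg eps k n c = ind S sg eps k n c') ->
  Hchord S sg b N c + Hchord S sg b N c' = 0.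
Proof.
move=> sE dE iE; rewrite /Hchord -dE sE; case: b; rewrite -?HtermN.
  apply/eqP; rewrite addr_eq0 -HtermN opprK; apply/eqP.
  by apply: Hterm_ext => // n; rewrite iE //; left.
apply/eqP; rewrite addr_eq0 -HtermN opprK; apply/eqP.
by apply: Hterm_ext => // n; rewrite iE //; right.
Qed.

(** If [e] passes through [c] from left to right, then [c] passes through [e] from right to left. *)
Lemma kapC c e : e.1 != c.1 -> e.1 != c.2 -> e.2 != c.1 -> e.2 != c.2 ->
  c.1 != c.2 -> e.1 != e.2 -> kap c e = - kap e c.
Proof.
move=> h1 h2 h3 h4 h5 h6.
rewrite !kap_on_right // 1?eq_sym // /on_right.
move: h1 h2 h3 h4 h5 h6; case: c e => [x y] [z w] /=.
case: (ltgtP x y) => // xy; case: (ltgtP z w) => // zw;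
case: (ltgtP z x) => // zx; case: (ltgtP z y) => // zy;
  (try by exfalso; clear -xy zx zy; lra) => _ _;
case: (ltgtP w x) => // wx; case: (ltgtP w y) => // wy _ _ _ _ //=;
  by exfalso; lra.
Qed.

End CrossingLists.

(** * The effect of the three moves on the sums *)

Section MoveSums.
Context {R : realType}.
Implicit Types (c e : R * R) (S O : seq (R * R)) (sg : R * R -> int).

Lemma Hsum_ext S sg sg' (o o' : R -> bool) N :
    (forall c, c \in S -> sg c = sg' c) -> (forall c, c \in S -> o c.1 = o' c.1) ->
  Hsum S sg o N = Hsum S sg' o' N.
Proof.
move=> sE oE.
have dE c : deg S sg c = deg S sg' c.
  by apply: eq_big_seq => e eS; rewrite sE.
apply: eq_big_seq => c cS; rewrite oE //; apply: Hchord_ext => //; first exact: sE.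
move=> eps n _ k; rewrite /ind big_seq_cond [RHS]big_seq_cond.
by apply: eq_big => [e|e /andP[eS _]]; rewrite !dE // sE.
Qed.

Lemma Hsum_Omega1 O sg o c0 N :
    (forall e, e \in O -> kap e c0 = 0 /\ kap c0 e = 0) ->
  Hsum (c0 :: O) sg o N = Hsum O sg o N.
Proof.
move=> k0.
have dO e : e \in O -> deg (c0 :: O) sg e = deg O sg e.
  by move=> eO; rewrite /deg big_cons (k0 _ eO).1 mulr0 add0r.
have iO e eps k n : e \in O -> ind (c0 :: O) sg eps k n e = ind O sg eps k n e.
  move=> eO; rewrite /ind big_cons (k0 _ eO).1 mulr0 mulr0z add0r if_same.
  rewrite big_seq_cond [RHS]big_seq_cond.
  apply: eq_big => [e'|e' /andP[e'O _]]; last by rewrite dO.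
  by case e'O : (e' \in O) => //=; rewrite !dO.
rewrite /Hsum big_cons (_ : Hchord _ _ _ _ c0 = 0) ?add0r.
  apply: eq_big_seq => e eO; apply: Hchord_ext => //; first exact: dO.
  by move=> eps n _; apply: iO.
have i0 eps k n : ind (c0 :: O) sg eps k n c0 = 0.
  rewrite /ind big1_seq // => e /andP[_]; rewrite inE => /predU1P[->|eO].
    by rewrite kapcc mulr0.
  by rewrite (k0 _ eO).2 mulr0.
rewrite /Hchord; case: (o _); rewrite /Hterm big1 // => n _.
  by rewrite i0 tpow0 subrr mul0rz.
by rewrite i0 oppr0 tpow0 subrr mul0rz.
Qed.

Lemma zpow_self k j : `|j|%N = k -> zpow k j = zpow k 0.
Proof.
move=> <-; rewrite /zpow; congr << _ >>; apply: val_inj => /=.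
by rewrite mod0z; apply/dvdz_mod0P; rewrite dvdzE.
Qed.

(** The two chords may also meet each other. Each then occurs in the index of the other with
    exponent plus or minus their common degree [d], that is 0 modulo [d], and with the same
    coefficient. *)
Lemma Hsum_Omega2 O sg (o : R -> bool) c1 c2 N :
    sg c2 = - sg c1 -> o c1.1 = o c2.1 -> kap c2 c1 = - kap c1 c2 ->
    is_sign (kap c1 c2) \/ kap c1 c2 = 0 ->
    (forall e, e \in O -> kap e c1 = kap e c2 /\ kap c1 e = kap c2 e) ->
  Hsum [:: c1, c2 & O] sg o N = Hsum O sg o N.
Proof.
move=> s2 o12 k21 k12 kO; set S := [:: c1, c2 & O].
have dO e : e \in O -> deg S sg e = deg O sg e.
  by move=> /kO[k1 _]; rewrite /deg !big_cons k1 s2; ring.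
have d12 : deg S sg c1 = deg S sg c2.
  rewrite /deg !big_cons !kapcc k21 s2.
  have -> : \sum_(e <- O) sg e * kap c1 e = \sum_(e <- O) sg e * kap c2 e.
    by apply: eq_big_seq => e /kO[_ ->].
  ring.
have iO e eps k n : e \in O -> ind S sg eps k n e = ind O sg eps k n e.
  move=> eO; rewrite /ind !big_cons -d12 (kO e eO).1 s2 mulNr mulrNz.
  transitivity (\sum_(e' <- O | gcdz (deg S sg e) (deg S sg e') == n)
     zpow k (eps * (kap e e' * deg S sg e')) *~ (sg e' * kap e e')).
    by case: (gcdz (deg S sg e) (deg S sg c1) == n); rewrite // addrA subrr add0r.
  rewrite big_seq_cond [RHS]big_seq_cond.
  apply: eq_big => [e'|e' /andP[e'O _]]; last by rewrite dO.
  by case e'O : (e' \in O) => //=; rewrite !dO.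
rewrite /Hsum !big_cons addrA -o12 HchordN ?add0r //.
  apply: eq_big_seq => e eO; apply: Hchord_ext => //; first exact: dO.
  by move=> eps n _; apply: iO.
move=> eps n seps k; rewrite /ind !big_cons -d12 !kapcc !mulr0 !mulr0z !add0r.
rewrite !if_same k21 s2.
have -> : \sum_(e <- O | gcdz (deg S sg c1) (deg S sg e) == n)
     zpow k (eps * (kap c1 e * deg S sg e)) *~ (sg e * kap c1 e) =
  \sum_(e <- O | gcdz (deg S sg c1) (deg S sg e) == n)
     zpow k (eps * (kap c2 e * deg S sg e)) *~ (sg e * kap c2 e).
  rewrite big_seq_cond [RHS]big_seq_cond; apply: eq_bigr => e /andP[/kO[_ ->] _] //.
case: (gcdz (deg S sg c1) (deg S sg c1) == n) => //; congr (_ + _).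
have [|->] := k12; last by rewrite !mulr0.
move=> sk; have Nsk : is_sign (- kap c1 c2).
  by case: sk => ->; [right|left].
by rewrite !zpow_self ?absz_sign // mulNr mulrN.
Qed.

Section Triple.

Definition bsg (b : bool) : int := if b then 1 else -1.

(* The chords of the triangle of an Omega3 move: [o0], [o1] and [o2] are the orders
   of the two crossings on the three strands, which the move reverses, while [r]
   depends only on the order of the strands along D, which it does not change. *)
Record triangle O sg A B C (K : int) (r o0 o1 o2 : bool) : Prop := Triangle {
  tri_AB : kap A B = r%:Z - o1%:Z;
  tri_AC : kap A C = o0%:Z - r%:Z;
  tri_BC : kap B C = r%:Z - o2%:Z;
  tri_BA : kap B A = o1%:Z - r%:Z;
  tri_CA : kap C A = r%:Z - o0%:Z;
  tri_CB : kap C B = o2%:Z - r%:Z;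
  tri_sA : sg A = K * bsg o2;
  tri_sB : sg B = K * bsg o0;
  tri_sC : sg C = K * bsg o1;
  tri_O : forall e, e \in O -> kap A e + kap B e + kap C e = 0 }.

(** The data are cyclic in the three chords, so facts about [A] carry over to [B] and [C]. *)
Lemma triangle_rot O sg A B C K r o0 o1 o2 :
  triangle O sg A B C K r o0 o1 o2 -> triangle O sg B C A K r o1 o2 o0.
Proof.
by case=> *; split=> // e eO; rewrite -[RHS](_ : kap A e + kap B e + kap C e = 0);
  [ring|auto].
Qed.

(* Hence d(B) = - d(C) modulo d(A), and gcd(d(A), d(B)) = gcd(d(A), d(C)):
   B and C can trade places in the index of A. *)
Lemma triangle_deg O sg A B C K r o0 o1 o2 S :
    perm_eq S [:: A, B, C & O] -> triangle O sg A B C K r o0 o1 o2 ->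
  deg S sg A + deg S sg B + deg S sg C = 0.
Proof.
move=> pS [AB AC BC BA CA CB sA sB sC tO].
rewrite /deg !(perm_big _ pS) /= !big_cons !kapcc AB AC BC BA CA CB sA sB sC.
have : \sum_(e <- O) sg e * kap A e + \sum_(e <- O) sg e * kap B e
     + \sum_(e <- O) sg e * kap C e = 0.
  rewrite -!big_split big1_seq // => e /andP[_ eO] /=.
  by rewrite -!mulrDr tO // mulr0.
move: (\sum_(e <- O) _) (\sum_(e <- O) _) (\sum_(e <- O) _) => x y z.
clear AB AC BC BA CA CB sA sB sC.
by case: r; case: o0; case: o1; case: o2 => /= *; rewrite /bsg /=; lia.
Qed.

(** [K] changes sign together with the three orders, so each crossing sign [K * bsg o] is
    preserved. *)
Record triangle_move O sg sg' A B C A' B' C' K r o0 o1 o2 : Prop := TriangleMove {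
  tm_tri : triangle O sg A B C K r o0 o1 o2;
  tm_tri' : triangle O sg' A' B' C' (- K) r (~~ o0) (~~ o1) (~~ o2);
  tm_sg : forall e, e \in O -> sg e = sg' e;
  tm_A : forall e, e \in O -> kap A e = kap A' e /\ kap e A = kap e A';
  tm_B : forall e, e \in O -> kap B e = kap B' e /\ kap e B = kap e B';
  tm_C : forall e, e \in O -> kap C e = kap C' e /\ kap e C = kap e C' }.

Lemma triangle_move_rot O sg sg' A B C A' B' C' K r o0 o1 o2 :
  triangle_move O sg sg' A B C A' B' C' K r o0 o1 o2 ->
  triangle_move O sg sg' B C A B' C' A' K r o1 o2 o0.
Proof. by case=> *; split=> //; apply: triangle_rot. Qed.

Lemma tm_deg O sg sg' A B C A' B' C' K r o0 o1 o2 S S' :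
    perm_eq S [:: A, B, C & O] -> perm_eq S' [:: A', B', C' & O] ->
    triangle_move O sg sg' A B C A' B' C' K r o0 o1 o2 ->
  deg S sg A = deg S' sg' A'.
Proof.
move=> pS pS' [[AB AC _ _ _ _ sA sB sC _] [AB' AC' _ _ _ _ sA' sB' sC' _] sO kA _ _].
rewrite /deg !(perm_big _ pS, perm_big _ pS') /= !big_cons !kapcc AB AC AB' AC'.
rewrite sB sC sB' sC'.
have -> : \sum_(e <- O) sg e * kap A e = \sum_(e <- O) sg' e * kap A' e.
  by apply: eq_big_seq => e eO; rewrite sO // (kA _ eO).1.
clear AB AC AB' AC' sA sB sC sA' sB' sC'.
move: (\sum_(e <- O) _) => T; rewrite !mulr0 !add0r.
by case: r; case: o0; case: o1 => /=; rewrite /bsg /=; ring.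
Qed.

Lemma tm_deg_O O sg sg' A B C A' B' C' K r o0 o1 o2 S S' e :
    perm_eq S [:: A, B, C & O] -> perm_eq S' [:: A', B', C' & O] ->
    triangle_move O sg sg' A B C A' B' C' K r o0 o1 o2 -> e \in O ->
  deg S sg e = deg S' sg' e.
Proof.
move=> pS pS' [[_ _ _ _ _ _ sA sB sC tO] [_ _ _ _ _ _ sA' sB' sC' tO'] sO kA kB kC] eO.
rewrite /deg !(perm_big _ pS, perm_big _ pS') /= !big_cons.
rewrite sA sB sC sA' sB' sC' (kA _ eO).2 (kB _ eO).2 (kC _ eO).2.
have -> : \sum_(e' <- O) sg e' * kap e e' = \sum_(e' <- O) sg' e' * kap e e'.
  by apply: eq_big_seq => e' e'O; rewrite sO.
clear sA sB sC sA' sB' sC'; move: (\sum_(e' <- O) _) => T.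
by case: o0; case: o1; case: o2; rewrite /bsg /=; ring.
Qed.

Lemma triangle_perm A B C O S : perm_eq S [:: A, B, C & O] ->
  perm_eq S [:: B, C, A & O].
Proof.
by move=> pS; apply: perm_trans pS (permEl (perm_catCA [:: A] [:: B; C] O)).
Qed.

Lemma tm_ind_O O sg sg' A B C A' B' C' K r o0 o1 o2 S S' e eps k n :
    perm_eq S [:: A, B, C & O] -> perm_eq S' [:: A', B', C' & O] ->
    triangle_move O sg sg' A B C A' B' C' K r o0 o1 o2 -> e \in O ->
  ind S sg eps k n e = ind S' sg' eps k n e.
Proof.
move=> pS pS' tm eO; have tmr := triangle_move_rot tm.
have dA := tm_deg pS pS' tm.
have dB := tm_deg (triangle_perm pS) (triangle_perm pS') tmr.
have dC := tm_deg (triangle_perm (triangle_perm pS)) (triangle_perm (triangle_perm pS'))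
  (triangle_move_rot tmr).
have dO e' : e' \in O -> _ := tm_deg_O pS pS' tm.
move: tm => [[_ _ _ _ _ _ sA sB sC tO] [_ _ _ _ _ _ sA' sB' sC' tO'] sO kA kB kC].
have bN b : K * bsg b = - K * bsg (~~ b) by case: b; rewrite /bsg /=; ring.
rewrite -!bN in sA' sB' sC'.
rewrite /ind !(perm_big _ pS, perm_big _ pS') /= !big_cons.
rewrite sA sB sC sA' sB' sC' (kA _ eO).2 (kB _ eO).2 (kC _ eO).2.
rewrite -dA -dB -dC -(dO _ eO).
have -> : \sum_(j <- O | gcdz (deg S sg e) (deg S sg j) == n)
     zpow k (eps * (kap e j * deg S sg j)) *~ (sg j * kap e j) =
   \sum_(j <- O | gcdz (deg S sg e) (deg S' sg' j) == n)
     zpow k (eps * (kap e j * deg S' sg' j)) *~ (sg' j * kap e j).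
  rewrite big_seq_cond [RHS]big_seq_cond.
  apply: eq_big => [j|j /andP[jO _]]; last by rewrite dO // sO.
  by case jO : (j \in O) => //=; rewrite !dO.
by [].
Qed.

Lemma zpow_congr (k : nat) (i j : int) : (k%:Z %| i - j)%Z -> zpow k i = zpow k j.
Proof.
move=> kij; rewrite /zpow; congr << _ >>; apply: val_inj => /=.
by apply/eqP; rewrite eqz_mod_dvd.
Qed.

(** [T a b] is the contribution of [B] and [C] to the index of [A], with the signs held fixed.
    Reversing both orders either makes the other chord the only contributor, with the same term, or
    exchanges an empty contribution with two terms that cancel. *)
Lemma triangle_terms (k : nat) (eps dB dC K : int) (r o0 o1 : bool)
    (T : bool -> bool -> laurent k) :
    zpow k (eps * dC) = zpow k (- (eps * dB)) ->
    zpow k (- (eps * dC)) = zpow k (eps * dB) ->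
    (forall a b, T a b =
      zpow k (eps * ((r%:Z - b%:Z) * dB)) *~ (K * bsg o0 * (r%:Z - b%:Z)) +
      zpow k (eps * ((a%:Z - r%:Z) * dC)) *~ (K * bsg o1 * (a%:Z - r%:Z))) ->
  T o0 o1 = T (~~ o0) (~~ o1).
Proof.
move=> h1 h2 HT; rewrite !HT {HT}.
case: r; case: o0; case: o1; rewrite /bsg /=;
  rewrite ?subrr ?sub0r ?subr0 ?mulr0 ?mulr0z ?addr0 ?add0r
    ?mulNr ?mul1r ?mulrN ?mulr1 ?h1 ?h2 ?opprK ?mulNr ?mul1r //;
  by rewrite ?mulrNz ?subrr ?addNr.
Qed.

Lemma tm_ind O sg sg' A B C A' B' C' K r o0 o1 o2 S S' eps n :
    perm_eq S [:: A, B, C & O] -> perm_eq S' [:: A', B', C' & O] ->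
    triangle_move O sg sg' A B C A' B' C' K r o0 o1 o2 ->
  let k := `|deg S sg A|%N in ind S sg eps k n A = ind S' sg' eps k n A'.
Proof.
move=> pS pS' tm k; have tmr := triangle_move_rot tm.
have dA := tm_deg pS pS' tm.
have dB := tm_deg (triangle_perm pS) (triangle_perm pS') tmr.
have dC := tm_deg (triangle_perm (triangle_perm pS)) (triangle_perm (triangle_perm pS'))
  (triangle_move_rot tmr).
have dO e' : e' \in O -> _ := tm_deg_O pS pS' tm.
have d0 : deg S sg C = - (deg S sg A + deg S sg B).
  by apply/eqP; rewrite -addr_eq0 addrC; apply/eqP/(triangle_deg pS); case: tm; eauto.
move: tm => [[AB AC _ _ _ _ sA sB sC tO] [AB' AC' _ _ _ _ sA' sB' sC' tO'] sO kA kB kC].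
have bN b : K * bsg b = - K * bsg (~~ b) by case: b; rewrite /bsg /=; ring.
rewrite -!bN in sA' sB' sC'.
rewrite /ind !(perm_big _ pS, perm_big _ pS') /= !big_cons !kapcc !mulr0 !mulr0z !add0r.
rewrite AB AC AB' AC' sB sC sB' sC' -dA -dB -dC !if_same.
have -> : \sum_(j <- O | gcdz (deg S sg A) (deg S sg j) == n)
     zpow k (eps * (kap A j * deg S sg j)) *~ (sg j * kap A j) =
   \sum_(j <- O | gcdz (deg S sg A) (deg S' sg' j) == n)
     zpow k (eps * (kap A' j * deg S' sg' j)) *~ (sg' j * kap A' j).
  rewrite big_seq_cond [RHS]big_seq_cond.
  apply: eq_big => [j|j /andP[jO _]]; last by rewrite dO // sO // (kA _ jO).1.
  by case jO : (j \in O) => //=; rewrite (dO j jO).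
have -> : gcdz (deg S sg A) (deg S sg C) = gcdz (deg S sg A) (deg S sg B).
  by rewrite d0 gcdzN gcdzDl.
case: (_ == n) => //; rewrite !addrA; congr (_ + _).
have dvd j : (k%:Z %| j * deg S sg A)%Z by rewrite dvdz_mull // dvdzE.
apply: (@triangle_terms k eps (deg S sg B) (deg S sg C) K r o0 o1 (fun a b =>
      zpow k (eps * ((r%:Z - b%:Z) * deg S sg B)) *~ (K * bsg o0 * (r%:Z - b%:Z)) +
      zpow k (eps * ((a%:Z - r%:Z) * deg S sg C)) *~ (K * bsg o1 * (a%:Z - r%:Z)))) => //.
  apply: zpow_congr; rewrite d0.
  rewrite (_ : _ - _ = - eps * deg S sg A) ?dvd //; ring.
apply: zpow_congr; rewrite d0.
rewrite (_ : _ - _ = eps * deg S sg A) ?dvd //; ring.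
Qed.

Lemma Hsum_Omega3 O sg sg' A B C A' B' C' K r o0 o1 o2 (o o' : R -> bool) N :
    triangle_move O sg sg' A B C A' B' C' K r o0 o1 o2 ->
    o A.1 = o' A'.1 -> o B.1 = o' B'.1 -> o C.1 = o' C'.1 ->
    (forall e, e \in O -> o e.1 = o' e.1) ->
  Hsum [:: A, B, C & O] sg o N = Hsum [:: A', B', C' & O] sg' o' N.
Proof.
move=> tm oA oB oC oO; set S := [:: A, B, C & O]; set S' := [:: A', B', C' & O].
have pS : perm_eq S [:: A, B, C & O] by [].
have pS' : perm_eq S' [:: A', B', C' & O] by [].
have tmr := triangle_move_rot tm; have tmrr := triangle_move_rot tmr.
have pSr := triangle_perm pS; have pSr' := triangle_perm pS'.
have pSrr := triangle_perm pSr; have pSrr' := triangle_perm pSr'.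
have sg_tri A0 B0 C0 A1 B1 C1 p0 p1 p2 :
    triangle_move O sg sg' A0 B0 C0 A1 B1 C1 K r p0 p1 p2 -> sg A0 = sg' A1.
  case=> [[_ _ _ _ _ _ -> _ _ _] [_ _ _ _ _ _ -> _ _ _] _ _ _ _].
  by case: p2; rewrite /bsg /=; ring.
rewrite /Hsum !big_cons oA oB oC; congr (_ + _); last congr (_ + _); last congr (_ + _).
- apply: Hchord_ext; [exact: sg_tri tm|exact: tm_deg tm|].
  by move=> eps n _; apply: tm_ind tm.
- apply: Hchord_ext; [exact: sg_tri tmr|exact: tm_deg pSr pSr' tmr|].
  by move=> eps n _; apply: tm_ind pSr pSr' tmr.
- apply: Hchord_ext; [exact: sg_tri tmrr|exact: tm_deg pSrr pSrr' tmrr|].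
  by move=> eps n _; apply: tm_ind pSrr pSrr' tmrr.
apply: eq_big_seq => e eO; rewrite oO //; apply: Hchord_ext.
- by case: tm => _ _ ->.
- exact: tm_deg_O tm eO.
- by move=> eps n _; apply: tm_ind_O tm eO.
Qed.

End Triple.
End MoveSums.

(** * Planar isotopies *)

Section Jacobian.
Context {R : realType}.
Implicit Types (psi phi : R * R -> R * R) (g : R -> R * R).

Definition jac psi (x : R * R) : R := det2 ('D_(1, 0) psi x) ('D_(0, 1) psi x).

Lemma derive1_comp (V W : normedModType R) (psi : V -> W) (g : R -> V) t :
    differentiable psi (g t) -> derivable g t 1 ->
  derivable (psi \o g) t 1 /\ derive1 (psi \o g) t = 'D_(derive1 g t) psi (g t).
Proof.
move=> dpsi /derivable1_diffP dg.
have dc : differentiable (psi \o g) t by apply: differentiable_comp.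
split; first exact/derivable1_diffP.
by rewrite derive1E deriveE // diff_comp //= derive1E !deriveE.
Qed.

Lemma derive_scalar (W : normedModType R) (g : R -> W) (v x : R) :
  derivable g x 1 -> 'D_v g x = v *: derive1 g x.
Proof.
move=> /derivable1_diffP dg; rewrite derive1E !deriveE // -linearZ.
by rewrite [v *: _]mulr1.
Qed.

Lemma derive_scale (V W : normedModType R) (psi : V -> W) k v x :
  differentiable psi x -> 'D_(k *: v) psi x = k *: 'D_v psi x.
Proof. by move=> dpsi; rewrite !deriveE // linearZ. Qed.

Lemma derive_lin psi x (u : R * R) : differentiable psi x ->
  'D_u psi x = u.1 *: 'D_(1, 0) psi x + u.2 *: 'D_(0, 1) psi x.
Proof.
move=> dpsi; rewrite !deriveE // -!linearZ -linearD; congr ('d _ _ _).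
by apply: injective_projections; rewrite /= /GRing.scale /=; ring.
Qed.

Lemma det2_derive psi x u v : differentiable psi x ->
  det2 ('D_u psi x) ('D_v psi x) = jac psi x * det2 u v.
Proof.
move=> dpsi; rewrite (derive_lin u) // (derive_lin v) // /jac.
move: ('D_(1, 0) psi x) ('D_(0, 1) psi x) => a b.
by rewrite /det2 /= /GRing.scale /=; ring.
Qed.

Lemma det2_derive_gt0 psi x u v (a b : R) : differentiable psi x ->
    0 < a -> 0 < b -> 0 < jac psi x ->
  (0 < det2 (a *: 'D_u psi x) (b *: 'D_v psi x)) = (0 < det2 u v).
Proof.
move=> dpsi a0 b0 j0; rewrite det2Zl det2Zr det2_derive //.
by rewrite !pmulr_rgt0.
Qed.

Lemma jac_neq0 psi x : diffeo psi -> jac psi x != 0.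
Proof.
move=> [[dpsi _] [phi [dphi _] [psiK _]]].
have E u : 'D_('D_u psi x) phi (psi x) = u.
  rewrite !deriveE // -[LHS]/(('d phi (psi x) \o 'd psi x) u) -diff_comp //.
  have -> : phi \o psi = id by apply/funext => y /=; rewrite psiK.
  by rewrite diff_val.
have h : jac phi (psi x) * jac psi x = det2 (1, 0) (0, 1) :=
  etrans (esym (det2_derive _ _ (dphi (psi x)))) (congr2 det2 (E (1, 0)) (E (0, 1))).
apply/eqP => j0; move: h.
by rewrite j0 mulr0 /det2 /= mulr1 mulr0 subr0 => /esym/eqP; rewrite oner_eq0.
Qed.

Lemma continuous_det2 (T : topologicalType) (f g : T -> R * R) (x : T) :
  {for x, continuous f} -> {for x, continuous g} ->
  {for x, continuous (fun y => det2 (f y) (g y))}.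
Proof.
move=> cf cg; rewrite /det2.
have c1 (h : T -> R * R) : {for x, continuous h} -> {for x, continuous (fun y => (h y).1)}.
  by move=> ch; apply: (@continuous_comp _ _ _ h fst); [exact: ch|exact: cvg_fst].
have c2 (h : T -> R * R) : {for x, continuous h} -> {for x, continuous (fun y => (h y).2)}.
  by move=> ch; apply: (@continuous_comp _ _ _ h snd); [exact: ch|exact: cvg_snd].
by apply: cvgB; apply: cvgM; [exact: c1|exact: c2|exact: c2|exact: c1].
Qed.

Lemma pos_segment (f : R -> R) : continuous f ->
  (forall t, 0 <= t <= 1 -> f t != 0) -> 0 < f 0 -> 0 < f 1.
Proof.
move=> cf f0 f00; rewrite ltNge; apply/negP => f1.
have [|c] := @IVT R f 0 1 0 ler01 (continuous_subspaceT cf).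
  by rewrite ge_min f1 orbT le_max ltW.
by rewrite in_itv /= => /f0/eqP.
Qed.

(** The Jacobian is continuous and has no zero on the segment from [x] to [y]. *)
Lemma jac_sign psi x y : diffeo psi -> (0 < jac psi x) = (0 < jac psi y).
Proof.
move=> dpsi.
suff H a b : 0 < jac psi a -> 0 < jac psi b by apply/idP/idP; apply: H.
move=> ja; pose l (t : R) := a + t *: (b - a).
have cl : continuous l.
  move=> r; apply: (@cvgD R (R * R)%type); first exact: cvg_cst.
  by apply: (@cvgZr_tmp R (R * R)%type); exact: cvg_id.
have := @pos_segment (fun t => jac psi (l t)).
rewrite /l scale0r addr0 scale1r [a + (b - a)]addrC subrK; apply=> //.
  have [[_ cpsi] _] := dpsi.
  move=> t; apply: (@continuous_det2 _ (fun t => 'D_(1, 0) psi (l t))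
    (fun t => 'D_(0, 1) psi (l t))).
    by apply: (@continuous_comp _ _ _ l ('D_(1, 0) psi)); [exact: cl|exact: cpsi].
  by apply: (@continuous_comp _ _ _ l ('D_(0, 1) psi)); [exact: cl|exact: cpsi].
by move=> t _; apply: jac_neq0.
Qed.

(** Along the isotopy the Jacobian at [x] starts from 1, that of the identity, and never
    vanishes. *)
Lemma isotopy_jac_gt0 (Phi : R -> R * R -> R * R) x : ambient_isotopy Phi ->
  0 < jac (Phi 1) x.
Proof.
move=> [P0 dP _ cD].
apply: (@pos_segment (fun s => jac (Phi s) x)).
- move=> s; have cx : {for s, continuous (fun s : R => (s, x))}.
    exact: (cvg_pair cvg_id (cvg_cst x)).
  apply: (@continuous_det2 _ (fun s => 'D_(1, 0) (Phi s) x)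
    (fun s => 'D_(0, 1) (Phi s) x)).
    apply: (@continuous_comp _ _ _ (fun s : R => (s, x))
      (fun p : R * (R * R) => 'D_(1, 0) (Phi p.1) p.2)); [exact: cx|exact: cD].
  apply: (@continuous_comp _ _ _ (fun s : R => (s, x))
    (fun p : R * (R * R) => 'D_(0, 1) (Phi p.1) p.2)); [exact: cx|exact: cD].
- by move=> t _; apply: jac_neq0.
rewrite /jac (_ : Phi 0 = id); last exact/funext.
by rewrite !deriveE ?diff_val //= /det2 /= mulr1 mulr0 subr0.
Qed.

End Jacobian.

Section Isotopy.
Context {R : realType}.
Implicit Types (D : knotoid_diagram R).

Lemma increasing_of_derive1 (th : R -> R) : (forall t, derivable th t 1) ->
  (forall t, 0 < derive1 th t) -> {mono th : x y / x < y}.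
Proof.
move=> dth th0; apply: leW_mono; apply: le_mono => x y xy.
have [z _ h] := @MVT R th (derive1 th) x y xy
  (fun z _ => @DeriveDef _ _ _ _ _ _ _ (dth z) (esym (derive1E th z)))
  (derivable_within_continuous (fun z _ => dth z)).
by rewrite -subr_gt0 h mulr_gt0 // subr_gt0.
Qed.

(** A derivative is determined by the values on any set that accumulates at [t], such as one side of
    [t]. *)
Lemma derive1_accumulation (W : normedModType R) (f g : R -> W) t :
    derivable f t 1 -> derivable g t 1 -> f t = g t ->
    (forall e : R, 0 < e -> exists2 h, 0 < `|h| < e & f (t + h) = g (t + h)) ->
  derive1 f t = derive1 g t.
Proof.
move=> df dg fgt H; apply/eqP; rewrite -subr_eq0 -normr_le0.
apply/ler_addgt0Pl => e e0; rewrite addr0.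
have e2 : 0 < e / 2 by rewrite divr_gt0.
have [r1 r10 H1] := derivable_expansion df e2.
have [r2 r20 H2] := derivable_expansion dg e2.
have [|h /andP[h0 hr] fg] := H (Num.min r1 r2); first by rewrite lt_min r10.
move: hr; rewrite lt_min => /andP[/ltW/H1 + /ltW/H2].
move: (derive1 f t) (derive1 g t) => L G; rewrite fg fgt => h1 h2.
rewrite -(ler_pM2l h0) -normrZ scalerBr.
have -> : h *: L - h *: G = (g (t + h) - g t - h *: G) - (g (t + h) - g t - h *: L).
  by rewrite opprB [RHS]addrC subrKA.
rewrite (le_trans (ler_normB _ _)) // mulrC [e in _ <= e * _]splitr mulrDl.
exact: lerD.
Qed.

Lemma diff_crv D t : differentiable (crv D) t.
Proof. exact/derivable1_diffP/crv_derivable. Qed.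

(** The reparametrization is increasing, which keeps the sides of chords; signs are kept because it
    has positive derivative and [Phi 1] has positive Jacobian. *)
Lemma Hpoly_isotopy D D' : planar_isotopy D D' -> Hpoly D = Hpoly D'.
Proof.
move=> [Phi [th [isoP [th0 th1 dth cth thpos] crvE ovE]]].
have [_ diffP _ _] := isoP; have [[dP1 cP1] [phi [dphi _] [PK phiK]]] := diffP 1.
have mth := increasing_of_derive1 dth thpos.
have ith : injective th.
  by move=> x y e; apply/eqP; rewrite eq_le !leNgt -(mth y x) -(mth x y) e ltxx.
pose f (c : R * R) : R * R := (th c.1, th c.2).
have fi : injective f by move=> [a b] [a' b'] [/ith -> /ith ->].
have th01 t : (0 <= th t <= 1) = (0 <= t <= 1).
  by rewrite -{1}th0 -{1}th1 !leNgt !mth.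
have dptE s t : double_pt (crv D') s t <-> double_pt (crv D) (th s) (th t).
  split=> -[s01 t01 st gst]; split.
  - by rewrite th01.
  - by rewrite th01.
  - by rewrite (inj_eq ith).
  - by move: gst; rewrite !crvE //; apply: (can_inj PK).
  - by rewrite -th01.
  - by rewrite -th01.
  - by rewrite -(inj_eq ith).
  - by rewrite th01 in s01; rewrite th01 in t01; rewrite !crvE // gst.
have surj u : 0 <= u <= 1 -> exists2 t, 0 <= t <= 1 & th t = u.
  move=> u01.
  have cth' : {within `[0, 1], continuous th}.
    exact: (derivable_within_continuous (fun z _ => dth z)).
  have [|t] := @IVT R th 0 1 u ler01 cth'.
    by rewrite th0 th1 ge_min le_max; move: u01 => /andP[-> ->]; rewrite orbT.
  by rewrite in_itv /= => t01 tE; exists t.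
have onE c x : (on_right (f c) (th x) = on_right c x)
    /\ (on_left (f c) (th x) = on_left c x).
  by rewrite /on_right /on_left /f /= !mth.
have derE t : 0 < t < 1 -> derive1 (crv D') t =
    derive1 th t *: 'D_(derive1 (crv D) (th t)) (Phi 1) (crv D (th t)).
  move=> /andP[t0 t1].
  have [dct] := derive1_comp (@diff_crv D (th t)) (@dth t).
  rewrite derive_scalar; last exact: crv_derivable.
  move=> E2.
  have [dc E] := derive1_comp (dP1 _) dct.
  transitivity (derive1 (Phi 1 \o (crv D \o th)) t); last first.
    by rewrite E E2; apply: derive_scale; exact: dP1.
  apply: derive1_accumulation; [exact: crv_derivable|exact: dc| |].
    by rewrite crvE // !ltW.
  (* The increment keeps [t + h] in [0, 1], where the formula for [crv D'] holds. *)
  move=> e e0; exists (Num.min e (1 - t) / 2).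
    have m0 : 0 < Num.min e (1 - t) by rewrite lt_min e0 subr_gt0.
    rewrite gtr0_norm ?divr_gt0 //=; apply: (@lt_le_trans _ _ (Num.min e (1 - t))).
      by rewrite ltr_pdivrMr // ltr_pMr // ltr1n.
    by rewrite ge_min lexx.
  have m0 : 0 < Num.min e (1 - t) by rewrite lt_min e0 subr_gt0.
  rewrite crvE //; rewrite addr_ge0 ?(ltW t0) ?divr_ge0 ?(ltW m0) //= -lerBrDl.
  apply: (@le_trans _ _ (Num.min e (1 - t))); last by rewrite ge_min lexx orbT.
  by rewrite ler_pdivrMr // ler_peMr ?(ltW m0) // ler1n.
have sgnE c : double_pt (crv D') c.1 c.2 ->
    csgn (gauss D) (f c) = csgn (gauss D') c.
  move=> dc; have [_ _ _ gc] := (dptE _ _).1 dc.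
  have E1 := derE c.1 (crv_endpoints dc).
  have E2 := derE c.2 (crv_endpoints (double_ptC dc)).
  rewrite -gc in E2.
  have E := etrans (congr1 (fun x => 0 < x) (congr2 det2 E1 E2))
    (det2_derive_gt0 (derive1 (crv D) (th c.1)) (derive1 (crv D) (th c.2))
    (dP1 (crv D (th c.1))) (thpos c.1) (thpos c.2) (isotopy_jac_gt0 _ isoP)).
  exact: (congr1 (fun b : bool => if b then 1 else -1) (esym E)).
have [||c|c|c|c e|N1 H1] := @Hpoly_map R D' D f 1 1 fi.
- by left.
- by left.
- move=> [dc o1 o2]; split; first exact/dptE.
    by rewrite -(ovE _ _ dc).
  by rewrite -(ovE _ _ (double_ptC dc)).
- case: c => u v [/= dc o1 o2]; have [u01 v01 _ _] := dc.
  have [s s01 sE] := surj u u01; have [t t01 tE] := surj v v01.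
  have dst : double_pt (crv D') s t by apply/dptE; rewrite sE tE.
  exists (s, t); last by rewrite /f /= sE tE.
  split=> //=; first by rewrite (ovE _ _ dst) sE.
  by rewrite (ovE _ _ (double_ptC dst)) tE.
- by move=> [dc _ _]; rewrite mul1r; exact: sgnE.
- by move=> _ _; rewrite /kap !(onE _ _).1 !(onE _ _).2 mul1r.
have [N0 H0] := Hpoly_Hterm D'.
rewrite (H1 _ (leq_maxl N1 N0)) (H0 _ (leq_maxr N1 N0)).
by apply: eq_bigr => c _; apply: Hterm_ext => [|n]; rewrite ?mul1r ?mulr1.
Qed.

End Isotopy.

(** * Reidemeister moves *)

Section LocalChange.
Context {R : realType}.
Implicit Types (D : knotoid_diagram R) (psi : R * R -> R * R).

Section Arcs.
Variables (k : nat) (a b : 'I_k -> R).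

Definition inb (t : R) : bool := [exists i, a i < t < b i].

Lemma inbP t : reflect (exists i, a i < t < b i) (inb t).
Proof. exact: existsP. Qed.

(** If [t] is the end of an arc, disjointness prevents an arc from starting there and one moves
    right; otherwise no arc ends at [t] and one moves left. *)
Lemma accumulation_outside t : 0 < t < 1 -> ~~ inb t ->
    (forall i, a i < b i) ->
    (forall i j t, a i <= t <= b i -> a j <= t <= b j -> i = j) ->
  forall e : R, 0 < e ->
    exists h, [/\ 0 < `|h| < e, 0 <= t + h <= 1 & ~~ inb (t + h)].
Proof.
move=> /andP[t0 t1] /existsPn nin ab disj e e0.
have out j : t <= a j \/ b j <= t.
  have := nin j; rewrite negb_and -!leNgt => /orP[?|?]; by [left|right].
have sized r : 0 < r -> exists h, [/\ 0 < h, h < e, h < t, h < 1 - t & h < r].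
  move=> r0; pose m := Num.min (Num.min e t) (Num.min (1 - t) r).
  have m0 : 0 < m by rewrite !lt_min e0 t0 r0 subr_gt0 t1.
  have hm : m / 2 < m by rewrite ltr_pdivrMr // ltr_pMr // ltr1n.
  exists (m / 2); split; first (by rewrite divr_gt0);
    by apply: (lt_le_trans hm); rewrite !ge_min lexx ?orbT.
have [/existsP[i /eqP tb]|/existsPn nb] := boolP [exists i, t == b i].
  have [|r r0 Hr] := @exists_gap R [seq a j | j : 'I_k] t.
    apply/mapP => -[j _ tj]; have ij : i = j.
      by apply: (disj i j t); [rewrite tb lexx ltW|rewrite tj lexx ltW].
    by have := ab i; rewrite -tb tj ij ltxx.
  have [h [h0 he ht h1 hr]] := sized r r0.
  exists h; rewrite gtr0_norm // h0 he; split=> //.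
    by rewrite addr_ge0 ?(ltW t0) ?(ltW h0) //= -lerBrDl ltW.
  apply/existsPn => j; rewrite negb_and -!leNgt.
  have [ta|bt] := out j; last by rewrite (le_trans bt) ?orbT // lerDl ltW.
  apply/orP; left; rewrite -lerBrDl; apply/ltW/(lt_trans hr).
  by have := Hr (a j); rewrite map_f ?mem_enum // ger0_norm ?subr_ge0 //; apply.
have [|r r0 Hr] := @exists_gap R [seq b j | j : 'I_k] t.
  by apply/mapP => -[j _ tj]; have := nb j; rewrite tj eqxx.
have [h [h0 he ht h1 hr]] := sized r r0.
exists (- h); rewrite normrN gtr0_norm // h0 he; split=> //.
  rewrite subr_ge0 (ltW ht) /= lerBlDr; apply: le_trans (ltW t1) _.
  by rewrite lerDl ltW.
apply/existsPn => j; rewrite negb_and -!leNgt.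
have [ta|bt] := out j; first by rewrite (le_trans _ ta) // gerBl ltW.
apply/orP; right; rewrite lerBrDr -lerBrDl; apply/ltW/(lt_trans hr).
have := Hr (b j); rewrite map_f ?mem_enum // distrC ger0_norm ?subr_ge0 //; exact.
Qed.

End Arcs.

Section Lists.
Variables (k : nat) (D D' : knotoid_diagram R) (psi : R * R -> R * R).
Variables (a b : 'I_k -> R).
Hypothesis lc : local_change D D' psi a b.

Lemma local_change_sym : local_change D' D psi a b.
Proof.
case: lc => dpsi ab tD tD' out; split=> // t t01 nt.
by have [-> ->] := out t t01 nt.
Qed.

Lemma odisc_inb t : 0 <= t <= 1 -> in_odisc (psi (crv D t)) = inb a b t.
Proof.
case: lc => _ _ tD _ _ /tD[_ h].
by apply/idP/inbP => /h.
Qed.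

(** Lying in the open disc depends only on the image point. *)
Lemma double_pt_inb s t : double_pt (crv D) s t -> inb a b s = inb a b t.
Proof. by case=> s01 t01 _ gst; rewrite -!odisc_inb // gst. Qed.

Lemma crv_out t : 0 <= t <= 1 -> ~~ inb a b t -> crv D t = crv D' t /\ ov D t = ov D' t.
Proof.
case: lc => _ _ _ _ out t01 /negP nt; apply: out => // h; apply: nt.
exact/inbP.
Qed.

Lemma double_pt_out s t : double_pt (crv D) s t -> ~~ inb a b s ->
  double_pt (crv D') s t.
Proof.
move=> dst ns; have nt := ns; rewrite (double_pt_inb dst) in nt.
case: dst => s01 t01 st gst; split=> //.
by rewrite -(crv_out s01 ns).1 -(crv_out t01 nt).1.
Qed.

Lemma derive1_out t : 0 < t < 1 -> ~~ inb a b t ->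
  derive1 (crv D) t = derive1 (crv D') t.
Proof.
move=> t01 nt; have [_ [ab disj] _ _ _] := lc.
apply: derive1_accumulation; [exact: crv_derivable|exact: crv_derivable| |].
  by have [] := crv_out _ nt; move: t01 => /andP[? ?]; rewrite ?ltW.
move=> e e0.
have [|h [he h01 nh]] := accumulation_outside t01 nt _ disj e0.
  by move=> i; have [] := ab i.
by exists h => //; have [] := crv_out h01 nh.
Qed.

Lemma csgn_out c : double_pt (crv D) c.1 c.2 -> ~~ inb a b c.1 ->
  csgn (gauss D) c = csgn (gauss D') c.
Proof.
move=> dc n1; have n2 := n1; rewrite (double_pt_inb dc) in n2.
have E1 := derive1_out (crv_endpoints dc) n1.
have E2 := derive1_out (crv_endpoints (double_ptC dc)) n2.
exact: (congr1 (fun x : R => if 0 < x then 1 else -1) (congr2 det2 E1 E2)).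
Qed.

(** Taken from [D] alone; by [double_pt_out] these are also crossings of [D'], so both lists share
    this part. *)
Definition outer : seq (R * R) := [seq c <- crossings D | ~~ inb a b c.1].

Lemma outerP c : c \in outer -> double_pt (crv D) c.1 c.2 /\
  (~~ inb a b c.1 /\ ~~ inb a b c.2).
Proof.
rewrite mem_filter => /andP[n1 /crossingsP[dc _ _]].
by rewrite -(double_pt_inb dc).
Qed.

Definition inner_list E (X : seq (R * R)) : Prop :=
  [/\ uniq X, forall c, c \in X -> double_pt (crv E) c.1 c.2 /\ inb a b c.1,
      forall c, c \in X -> rev c \notin X &
      forall x y, double_pt (crv E) x y -> inb a b x -> inb a b y ->
        (x, y) \in X \/ (y, x) \in X].

Lemma outer_complete x y : double_pt (crv D) x y -> ~~ inb a b x ->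
  (x, y) \in outer \/ (y, x) \in outer.
Proof.
move=> dxy nx; have ny := nx; rewrite (double_pt_inb dxy) in ny.
have o := ov_crossing dxy; case ox: (ov D x) o => /esym o.
  left; rewrite mem_filter nx; apply/crossingsP; split=> //=.
right; rewrite mem_filter ny; apply/crossingsP; split=> /=; rewrite ?ox //.
  exact: double_ptC.
by move/negbFE: o.
Qed.

End Lists.

Lemma crossing_list_outer k D D' psi (a b : 'I_k -> R) E X :
    local_change D D' psi a b -> E = D \/ E = D' -> inner_list a b E X ->
  crossing_list E (X ++ outer D a b).
Proof.
move=> lc ED [uX dX rX cX].
have EO x y : ~~ inb a b x -> double_pt (crv D) x y -> double_pt (crv E) x y.
  by move=> nx d; case: ED => ->; [|exact: (double_pt_out lc d nx)].
have OE x y : ~~ inb a b x -> double_pt (crv E) x y -> double_pt (crv D) x y.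
  move=> nx; case: ED => -> // d; exact: (double_pt_out (local_change_sym lc) d nx).
have Einb x y : double_pt (crv E) x y -> inb a b x = inb a b y.
  case: ED => ->; first exact: (double_pt_inb lc).
  exact: (double_pt_inb (local_change_sym lc)).
have oP := outerP lc.
split.
- rewrite cat_uniq uX filter_uniq ?fset_uniq ?andbT //=.
  by apply/hasPn => c /oP[_ [nc _]]; apply/negP => /dX[_]; rewrite (negbTE nc).
- move=> c; rewrite mem_cat => /orP[/dX[]//|/oP[dc [n1 _]]].
  exact: EO.
- move=> c; rewrite !mem_cat negb_or => /orP[cX'|cO].
    rewrite rX //=; apply/negP => /oP[_ [_ /= nc]].
    by have [_] := dX _ cX'; rewrite (negbTE nc).
  apply/andP; split.
    apply/negP => /dX[_ /= ic]; have [_ [_ nc]] := oP _ cO.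
    by rewrite ic in nc.
  apply/negP => rO; move: rO cO; rewrite !mem_filter.
  move=> /andP[_ /crossingsP h1] /andP[_ /crossingsP h2].
  exact: rev_chord h2 h1.
move=> x y dxy; have [ix|nx] := boolP (inb a b x).
  have iy := ix; rewrite (Einb _ _ dxy) in iy.
  by rewrite !mem_cat; case: (cX _ _ dxy ix iy) => ->; [left|right].
by rewrite !mem_cat; case: (outer_complete lc (OE _ _ nx dxy) nx) => ->;
  rewrite orbT; [left|right].
Qed.

Lemma Hsum_outer k D D' psi (a b : 'I_k -> R) N : local_change D D' psi a b ->
  Hsum (outer D a b) (csgn (gauss D)) (ov D) N =
  Hsum (outer D a b) (csgn (gauss D')) (ov D') N.
Proof.
move=> lc; apply: Hsum_ext => c /(outerP lc)[dc [n1 _]].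
  exact: (csgn_out lc dc n1).
by have [c01 _ _ _] := dc; have [_ ->] := crv_out lc c01 n1.
Qed.

Lemma Hpoly_local_change k D D' psi (a b : 'I_k -> R) X X' :
    local_change D D' psi a b -> inner_list a b D X -> inner_list a b D' X' ->
    (forall N, Hsum (X ++ outer D a b) (csgn (gauss D)) (ov D) N =
               Hsum (X' ++ outer D a b) (csgn (gauss D')) (ov D') N) ->
  Hpoly D = Hpoly D'.
Proof.
move=> lc iX iX' H.
have [N1 H1] := Hpoly_Hsum (crossing_list_outer lc (or_introl erefl) iX).
have [N2 H2] := Hpoly_Hsum (crossing_list_outer lc (or_intror erefl) iX').
by rewrite (H1 _ (leq_maxl N1 N2)) (H2 _ (leq_maxr N1 N2)).
Qed.

Lemma on_right_arc (p q : R) c x y : ~~ (p < c.1 < q) -> ~~ (p < c.2 < q) ->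
  p < x < q -> p < y < q -> on_right c x = on_right c y.
Proof.
have cmp z u v : ~~ (p < z < q) -> p < u < q -> p < v < q -> z < u -> z < v.
  move=> nz /andP[pu uq] /andP[pv vq] zu; rewrite ltNge; apply: contra nz => vz.
  by rewrite (lt_le_trans pv vz) (lt_trans zu).
have cmp' z u v : ~~ (p < z < q) -> p < u < q -> p < v < q -> u < z -> v < z.
  move=> nz /andP[pu uq] /andP[pv vq] zu; rewrite ltNge; apply: contra nz => vz.
  by rewrite (lt_trans pu zu) (le_lt_trans vz).
have E z u v : ~~ (p < z < q) -> p < u < q -> p < v < q -> (z < u) = (z < v).
  by move=> *; apply/idP/idP; apply: cmp.
have E' z u v : ~~ (p < z < q) -> p < u < q -> p < v < q -> (u < z) = (v < z).
  by move=> *; apply/idP/idP; apply: cmp'.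
move=> n1 n2 hx hy; rewrite /on_right.
by rewrite (E c.1 x y) // (E' c.2 x y) // (E c.1 x y).
Qed.

End LocalChange.

Section Omega1.
Context {R : realType}.
Implicit Types (D : knotoid_diagram R).

Lemma Hpoly_Omega1 D D' : Omega1 D D' -> Hpoly D = Hpoly D'.
Proof.
move=> [psi [a [b [lc [emb [s [t [as' st tb gst uniq_st]]]]]]]].
have inbE x : inb a b x = (a 0 < x < b 0).
  by apply/existsP/idP => [[i]|h]; [rewrite (ord1 i)|exists 0].
have [_ [/(_ 0) [a0 ab b1] _] _ _ _] := lc.
have ist : s != t by rewrite lt_eqF.
have dst : double_pt (crv D') s t.
  split=> //; apply/andP; split.
  - exact/ltW/(lt_trans a0).
  - exact/ltW/(lt_trans st)/(lt_trans tb).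
  - exact/ltW/(lt_trans a0)/(lt_trans as').
  - exact/ltW/(lt_trans tb).
have is_ : a 0 < s < b 0 by rewrite as' (lt_trans st).
have it_ : a 0 < t < b 0 by rewrite tb (lt_trans as').
apply: (@Hpoly_local_change R 1 D D' psi a b [::] [:: (s, t)] lc).
- split=> // x y dxy; rewrite !inbE => /andP[ax xb] /andP[ay yb].
  have [_ _ /eqP xy gxy] := dxy; case: xy.
  by apply: emb => //; rewrite !ltW.
- split=> //.
  + by move=> c; rewrite inE => /eqP ->; rewrite inbE.
  + by move=> c; rewrite inE => /eqP ->; rewrite inE /rev xpair_eqE /= eq_sym (negbTE ist).
  + move=> x y dxy; rewrite !inbE => /andP[ax xb] /andP[ay yb].
    have [_ _ + gxy] := dxy; rewrite neq_lt => /orP[xy|yx].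
      by left; have [-> ->] := uniq_st x y (ltW ax) xy (ltW yb) gxy; rewrite inE.
    by right; have [-> ->] := uniq_st y x (ltW ay) yx (ltW xb) (esym gxy); rewrite inE.
move=> N; rewrite cat0s (Hsum_outer N lc) cat1s Hsum_Omega1 // => e eO.
have [de [n1 n2]] := outerP lc eO; rewrite !inbE in n1 n2.
(* Both ends of the new chord lie on one arc that contains no end of [e]. *)
have ke : kap e (s, t) = 0.
  rewrite kap_on_right /= ?(on_right_arc n1 n2 it_ is_) ?subrr //;
    by [apply: contraNneq n1 => <-|apply: contraNneq n2 => <-].
split=> //; rewrite kapC ?ke ?oppr0 //=;
  by [apply: contraNneq n1 => ->|apply: contraNneq n2 => ->|have [] := de].
Qed.

End Omega1.

(** * Signs of functions and derivatives on an interval *)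

Section RealFunctions.
Context {R : realType}.
Implicit Types (f : R -> R).

(** [k] selects the side from which [t] is approached and [s] the sign of [f] there. *)
Lemma derive1_sign f t (s k : R) : derivable f t 1 -> f t = 0 ->
  (exists2 r : R, 0 < r & forall h, 0 < h -> h < r -> 0 <= s * f (t + k * h)) ->
  0 < k * k -> 0 <= s * (k * derive1 f t).
Proof.
move=> df ft [r r0 H] kk; rewrite leNgt; apply/negP => neg.
have k0 : k != 0 by apply: contraTneq kk => ->; rewrite mulr0 ltxx.
have nk : 0 < `|k| by rewrite normr_gt0.
have s0 : s != 0 by apply: contraTneq neg => ->; rewrite mul0r ltxx.
have ns : 0 < `|s| by rewrite normr_gt0.
move: neg (@derivable_expansion R R^o f t) => neg /(_ _ df).
move: (derive1 f t) neg => d neg Hexp.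
(* With this precision the error is at most half of the linear term, which would then impose its
   negative sign. *)
pose e := - (s * (k * d)) / (2 * `|s| * `|k|).
have e0 : 0 < e by rewrite divr_gt0 ?oppr_gt0 // !mulr_gt0.
have [r1 r10 H1] := Hexp _ e0.
pose m := Num.min r (r1 / `|k|).
have m0 : 0 < m by rewrite lt_min r0 divr_gt0.
have hm : m / 2 < m by rewrite ltr_pdivrMr // ltr_pMr // ltr1n.
have h0 : 0 < m / 2 by rewrite divr_gt0.
have hr : m / 2 < r by apply: (lt_le_trans hm); rewrite ge_min lexx.
have hr1 : m / 2 < r1 / `|k| by apply: (lt_le_trans hm); rewrite ge_min lexx orbT.
move: (m / 2) h0 hr hr1 => h h0 /(H _ h0) fh.
rewrite ltr_pdivlMr // => hk.
have kh : `|k * h| = h * `|k| by rewrite normrM (gtr0_norm h0) mulrC.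
have := H1 (k * h); rewrite kh => /(_ (ltW hk)).
rewrite ft subr0 -[(k * h) *: _]/(k * h * d) => H2.
have : `|s * (f (t + k * h) - k * h * d)| <= `|s| * (e * (h * `|k|)).
  by rewrite normrM ler_wpM2l.
have -> : `|s| * (e * (h * `|k|)) = - (s * (k * d)) * h / 2.
  by rewrite /e; field; rewrite !gt_eqF.
rewrite mulrBr ler_norml => /andP[_].
rewrite lerBlDr => le2.
have : 0 <= - (s * (k * d)) * h / 2 + s * (k * h * d) by apply: le_trans le2.
have -> : - (s * (k * d)) * h / 2 + s * (k * h * d) = s * (k * d) * h / 2.
  by field.
by rewrite leNgt ltr_pdivrMr // mul0r pmulr_llt0 // neg.
Qed.

Lemma no_zero_sign f (p q : R) : continuous f -> p <= q ->
  (forall z, p <= z <= q -> f z != 0) -> (0 < f p) = (0 < f q).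
Proof.
move=> cf pq f0.
have pp : p <= p <= q by rewrite lexx.
have qq : p <= q <= q by rewrite lexx andbT.
have H v : (f p <= v <= f q) || (f q <= v <= f p) -> v != 0.
  move=> hv; have [|z] := @IVT R f p q v pq (continuous_subspaceT cf).
    by rewrite ge_min le_max; case/orP: hv => /andP[-> ->]; rewrite ?orbT.
  by rewrite in_itv /= => zpq <-; exact: f0.
apply/idP/idP => h; rewrite ltNge; apply/negP => h'.
  by have := H 0; rewrite h' (ltW h) orbT eqxx => /(_ isT).
by have := H 0; rewrite h' (ltW h) eqxx => /(_ isT).
Qed.

Lemma no_critical_mono f (p q : R) : (forall t, derivable f t 1) ->
    continuous (derive1 f) -> p < q ->
    (forall z, p < z < q -> derive1 f z != 0) ->
  exists s : R, [/\ s = 1 \/ s = -1, forall z, p < z < q -> 0 < s * derive1 f z &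
    forall x y, p <= x -> x < y -> y <= q -> s * f x < s * f y].
Proof.
move=> df cf pq f0; pose m := (p + q) / 2.
have pm : p < m by rewrite /m midf_lt.
have mq : m < q by rewrite /m midf_lt.
pose s : R := if 0 < derive1 f m then 1 else -1.
have sE : s = 1 \/ s = -1 by rewrite /s; case: ifP; [left|right].
have sgnE z : p < z < q -> (0 < derive1 f z) = (0 < derive1 f m).
  move=> /andP[pz zq]; have [zm|mz] := leP z m.
    apply: no_zero_sign => // x /andP[zx xm]; apply: f0.
    by rewrite (lt_le_trans pz) // (le_lt_trans xm).
  apply/esym; apply: no_zero_sign; rewrite ?ltW // => x /andP[mx xz]; apply: f0.
  by rewrite (lt_le_trans pm) // (le_lt_trans xz).
have pos z : p < z < q -> 0 < s * derive1 f z.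
  move=> zpq; rewrite /s -(sgnE z zpq); case: ifPn; first by rewrite mul1r.
  by rewrite -leNgt mulN1r oppr_gt0 lt_neqAle f0.
exists s; split=> // x y px xy yq.
have [z /andP[xz zy] E] := @MVT R f (derive1 f) x y xy
  (fun z _ => @DeriveDef _ _ _ _ _ _ _ (@df z) (esym (derive1E f z)))
  (derivable_within_continuous (fun z _ => @df z)).
rewrite -subr_gt0 -mulrBr E mulrA mulr_gt0 ?subr_gt0 //; apply: pos.
by rewrite (le_lt_trans px) // (lt_le_trans zy).
Qed.

End RealFunctions.

(** * Diagrams in the coordinates of a disc *)

Section Coordinates.
Context {R : realType}.
Implicit Types (D : knotoid_diagram R) (psi : R * R -> R * R).

Lemma dot2_derive (l x v : R * R) :
  differentiable (dot2 l : R * R -> R) x /\ 'D_v (dot2 l : R * R -> R) x = dot2 l v.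
Proof.
have lin : linear (dot2 l : R * R -> R).
  by move=> k a b; rewrite /dot2 /= /GRing.scale /=; ring.
pose L := GRing.isLinear.Build _ _ _ _ (dot2 l) lin.
pose F : {linear (R * R)%type -> R} := HB.pack (dot2 l : (R * R)%type -> R) L.
have c : continuous F by exact: continuous_dot2.
have dF : differentiable (dot2 l : R * R -> R) x.
  exact: (@linear_differentiable _ _ _ F x c).
split; first exact: dF.
by rewrite deriveE; [rewrite (@diff_lin _ _ _ F x c)|exact: dF].
Qed.

(** The velocity of the diagram read in the chart [psi]. *)
Definition etad psi D (t : R) : R * R := 'D_(derive1 (crv D) t) psi (crv D t).

Lemma coord_derive1 psi D l t : diffeo psi ->
  derivable (fun t => dot2 l (psi (crv D t))) t 1 /\
  derive1 (fun t => dot2 l (psi (crv D t))) t = dot2 l (etad psi D t).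
Proof.
move=> [[dpsi _] _].
have [d1 E1] := derive1_comp (dpsi (crv D t)) (@crv_derivable _ D t).
have [dl El] := dot2_derive l (psi (crv D t)) (derive1 (psi \o crv D) t).
have [d2 E2] := derive1_comp dl d1.
split; first exact: d2.
apply: etrans E2 _; apply: etrans El _.
exact: congr1 E1.
Qed.

Lemma coord_C1 psi D l : diffeo psi ->
  continuous (derive1 (fun t => dot2 l (psi (crv D t)))).
Proof.
move=> dpsi; have [[dp cp] _] := dpsi.
have -> : derive1 (fun t => dot2 l (psi (crv D t))) = fun t =>
    (derive1 (crv D) t).1 * dot2 l ('D_(1, 0) psi (crv D t)) +
    (derive1 (crv D) t).2 * dot2 l ('D_(0, 1) psi (crv D t)).
  apply/funext => t; apply: etrans (coord_derive1 D l t dpsi).2 _.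
  rewrite /etad; apply: etrans (congr1 (dot2 l) (derive_lin _ (dp _))) _.
  move: (derive1 (crv D) t) ('D_(1, 0) psi (crv D t)) ('D_(0, 1) psi (crv D t)).
  by move=> u a b; rewrite /dot2 /= /GRing.scale /=; ring.
have cc v : continuous (fun t => dot2 l ('D_v psi (crv D t))).
  move=> t; apply: (@continuous_comp _ _ _ (fun t => 'D_v psi (crv D t)) (dot2 l)).
    apply: (@continuous_comp _ _ _ (crv D) ('D_v psi)); last exact: cp.
    exact: continuous_crv.
  exact: continuous_dot2.
move=> t; apply: cvgD; apply: cvgM; [|exact: cc| |exact: cc].
  apply: (@continuous_comp _ _ _ (derive1 (crv D)) fst); last exact: cvg_fst.
  exact: crv_C1.
apply: (@continuous_comp _ _ _ (derive1 (crv D)) snd); last exact: cvg_snd.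
exact: crv_C1.
Qed.

Lemma etad_det psi D s t : diffeo psi -> crv D s = crv D t ->
  det2 (etad psi D s) (etad psi D t) =
  jac psi (crv D s) * det2 (derive1 (crv D) s) (derive1 (crv D) t).
Proof.
move=> [[dp _] _] E; rewrite /etad -E; exact: (det2_derive _ _ (dp _)).
Qed.

Lemma etad_neq0 psi D t : diffeo psi -> 0 <= t <= 1 -> etad psi D t != 0.
Proof.
move=> dpsi t01; apply/eqP => e0; have /eqP := @crv_immersion _ D _ t01; apply.
have [[dp _] _] := dpsi.
have H v : jac psi (crv D t) * det2 (derive1 (crv D) t) v = 0.
  apply: etrans (esym (det2_derive _ v (dp _))) _.
  apply: etrans (congr1 (fun u => det2 u _) e0) _.
  by rewrite /det2 /= !mul0r subr0.
have j0 := jac_neq0 (crv D t) dpsi.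
have H' v : det2 (derive1 (crv D) t) v = 0.
  by have /eqP := H v; rewrite mulf_eq0 (negbTE j0) => /eqP.
move: (H' (0, 1)) (H' (1, 0)); rewrite /det2 /= !mulr1 !mulr0 subr0 sub0r.
move: (derive1 (crv D) t) => u u1 /eqP; rewrite oppr_eq0 => /eqP u2.
by apply: injective_projections.
Qed.

End Coordinates.

(** * Arcs that run along a diameter *)

Section StraightArcs.
Context {R : realType}.
Implicit Types (D : knotoid_diagram R) (psi : R * R -> R * R).

Definition sqn (x : R * R) : R := x.1 ^+ 2 + x.2 ^+ 2.

Definition perp (w : R * R) : R * R := (- w.2, w.1).

Lemma sqn_dot2 (w x : R * R) : sqn w * sqn x = dot2 w x ^+ 2 + dot2 (perp w) x ^+ 2.
Proof. by rewrite /sqn /dot2 /perp /=; ring. Qed.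

Lemma dot2_inj (w x y : R * R) : 0 < sqn w -> dot2 w x = dot2 w y ->
  dot2 (perp w) x = dot2 (perp w) y -> x = y.
Proof.
move=> w0 h1 h2; have E1 : sqn w * x.1 = sqn w * y.1.
  transitivity (w.1 * dot2 w x - w.2 * dot2 (perp w) x).
    by rewrite /sqn /dot2 /perp /=; ring.
  by rewrite h1 h2 /sqn /dot2 /perp /=; ring.
have E2 : sqn w * x.2 = sqn w * y.2.
  transitivity (w.2 * dot2 w x + w.1 * dot2 (perp w) x).
    by rewrite /sqn /dot2 /perp /=; ring.
  by rewrite h1 h2 /sqn /dot2 /perp /=; ring.
by apply: injective_projections; apply: (mulfI (lt0r_neq0 w0)).
Qed.

Lemma local_change_boundary k D D' psi (a b : 'I_k -> R) i :
    local_change D D' psi a b ->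
  [/\ ~~ inb a b (a i), ~~ inb a b (b i), sqn (psi (crv D (a i))) = 1 &
      sqn (psi (crv D (b i))) = 1].
Proof.
move=> lc; have [_ [ab disj] tD _ _] := lc.
have [a0 abi b1] := ab i.
have na : ~~ inb a b (a i).
  apply/inbP => -[j /andP[h1 h2]].
  have ij : i = j by apply: (disj i j (a i)); rewrite ?lexx ltW // ltW.
  by rewrite ij ltxx in h1.
have nb : ~~ inb a b (b i).
  apply/inbP => -[j /andP[h1 h2]].
  have ij : i = j by apply: (disj i j (b i)); rewrite ?lexx ?andbT ltW // ltW.
  by rewrite ij ltxx in h2.
have bd t : a i <= t <= b i -> ~~ inb a b t -> sqn (psi (crv D t)) = 1.
  move=> /andP[h1 h2] nt.
  have t01 : 0 <= t <= 1.
    by rewrite (le_trans (ltW a0) h1) (le_trans h2 (ltW b1)).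
  have [hd _] := tD t t01.
  have : in_disc (psi (crv D t)) by apply/hd; exists i; rewrite h1.
  have := odisc_inb lc t01; rewrite (negbTE nt) /in_odisc /in_disc => h3 h4.
  by apply/eqP; rewrite eq_le h4 leNgt h3.
split=> //; apply: bd => //; rewrite ?lexx ?andbT ltW //.
Qed.

(** Since [dot2 w] is constant on the arc, the immersion condition makes the derivative of the other
    coordinate nonzero: the arc runs strictly in one direction [s]. Its ends are then distinct
    points of the circle on one line, hence opposite, and the intermediate value theorem fills the
    diameter. *)
Lemma straight_arc psi D (p q : R) (w : R * R) : diffeo psi ->
    0 < p -> p < q -> q < 1 -> 0 < sqn w ->
    sqn (psi (crv D p)) = 1 -> sqn (psi (crv D q)) = 1 ->
    (forall t, p <= t <= q -> dot2 w (psi (crv D t)) = 0) ->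
  exists s : R, [/\ s = 1 \/ s = -1,
    forall z, p < z < q -> dot2 w (etad psi D z) = 0 /\
                           0 < s * dot2 (perp w) (etad psi D z),
    forall x y, p <= x -> x < y -> y <= q ->
      s * dot2 (perp w) (psi (crv D x)) < s * dot2 (perp w) (psi (crv D y)) &
    forall x, dot2 w x = 0 -> in_odisc x ->
      exists2 z, p < z < q & psi (crv D z) = x].
Proof.
move=> dpsi p0 pq q1 w0 sp sq flat.
have flat' z : p < z < q -> dot2 w (etad psi D z) = 0.
  move=> /andP[pz zq]; have [df E] := coord_derive1 D w z dpsi.
  rewrite -E; apply: etrans (derive1_cst (0 : R) z).
  apply: derive1_accumulation; [exact: df|exact: derivable_cst| |].
    by rewrite flat // !ltW.
  move=> e e0; have m0 : 0 < Num.min e (q - z) by rewrite lt_min e0 subr_gt0.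
  have hm : Num.min e (q - z) / 2 < Num.min e (q - z).
    by rewrite ltr_pdivrMr // ltr_pMr // ltr1n.
  exists (Num.min e (q - z) / 2).
    rewrite gtr0_norm ?divr_gt0 //=; apply: (lt_le_trans hm).
    by rewrite ge_min lexx.
  rewrite flat //; rewrite (le_trans (ltW pz)) ?lerDl ?divr_ge0 ?(ltW m0) //=.
  rewrite -lerBrDl; apply/ltW/(lt_le_trans hm).
  by rewrite ge_min lexx orbT.
have crit z : p < z < q -> derive1 (fun t => dot2 (perp w) (psi (crv D t))) z != 0.
  move=> zpq; have [_ E] := coord_derive1 D (perp w) z dpsi.
  apply/eqP => e0; have e1 := etrans (esym E) e0.
  have z01 : 0 <= z <= 1.
    move: zpq => /andP[pz zq].
    by rewrite (ltW (lt_trans p0 pz)) (ltW (lt_trans zq q1)).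
  have /eqP := etad_neq0 D dpsi z01; apply.
  apply: (dot2_inj w0); first by rewrite flat' // /dot2 /= !mulr0 addr0.
  by rewrite e1 /dot2 /= !mulr0 addr0.
have [s [s1 pos mono]] := no_critical_mono
  (fun t => (coord_derive1 D (perp w) t dpsi).1) (coord_C1 dpsi) pq crit.
exists s; split=> //.
- move=> z zpq; split; first exact: flat'.
  by rewrite -(coord_derive1 D (perp w) z dpsi).2; exact: pos.
move=> x wx; rewrite /in_odisc -/(sqn x) => x1.
pose f t := dot2 (perp w) (psi (crv D t)).
have fend t : p <= t <= q -> sqn (psi (crv D t)) = 1 -> f t ^+ 2 = sqn w.
  by move=> tpq st; rewrite -[RHS]mulr1 -st sqn_dot2 flat // expr0n add0r.
have pp : p <= p <= q by rewrite lexx ltW.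
have qq : p <= q <= q by rewrite lexx ltW.
(* Both values have square [sqn w]; equality is excluded by strict monotonicity. *)
have fpq : f q = - f p.
  have : f p ^+ 2 = f q ^+ 2 by rewrite !fend.
  move/eqP; rewrite eqf_sqr => /orP[/eqP e|/eqP ->]; last by rewrite opprK.
  by have := mono p q (lexx _) pq (lexx _); rewrite -/(f p) -/(f q) e ltxx.
have fx : dot2 (perp w) x ^+ 2 < f p ^+ 2.
  rewrite fend // -[ltRHS]mulr1.
  apply: (@le_lt_trans _ _ (sqn w * sqn x)); last by rewrite ltr_pM2l.
  by rewrite sqn_dot2 wx expr0n add0r.
have cf : continuous f.
  move=> t; apply: (@continuous_comp _ _ _ (fun t => psi (crv D t)) (dot2 (perp w))).
    apply: (@continuous_comp _ _ _ (crv D) psi); first exact: continuous_crv.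
    by have [[dp _] _] := dpsi; apply: differentiable_continuous; exact: dp.
  exact: continuous_dot2.
have [|z] := @IVT R f p q (dot2 (perp w) x) (ltW pq) (continuous_subspaceT cf).
  have := fx; rewrite fpq -ltr_sqrt; last first.
    by rewrite exprn_even_gt0 //=; apply: contraTneq fx => ->; rewrite expr0n -leNgt sqr_ge0.
  rewrite !sqrtr_sqr ltr_norml ge_min le_max.
  have [f0|f0] := leP 0 (f p).
    rewrite (ger0_norm f0) => /andP[/ltW h1 /ltW h2].
    by rewrite h1 h2 orbT.
  by rewrite (ltr0_norm f0) opprK => /andP[/ltW h1 /ltW h2]; rewrite h1 h2 orbT.
rewrite in_itv /= => /andP[pz zq] fz.
have zx : psi (crv D z) = x.
  by apply: (dot2_inj w0) => //; rewrite flat ?pz.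
exists z => //; rewrite !lt_neqAle pz zq !andbT; apply/andP; split.
  by apply: contraTneq x1 => zp; rewrite -zx -zp sp ltxx.
by apply: contraTneq x1 => zp; rewrite -zx zp sq ltxx.
Qed.

End StraightArcs.

(** * The second move *)

Section Omega2.
Context {R : realType}.
Implicit Types (D : knotoid_diagram R) (psi : R * R -> R * R).

Lemma ord2P (i : 'I_2) : i = 0 \/ i = 1.
Proof. by case: i => [[|[|]]] //= h; [left|right]; apply: val_inj. Qed.

Lemma diffeo_inj psi : diffeo psi -> injective psi.
Proof. by move=> [_ [phi _ [K _]]]; exact: can_inj K. Qed.

Lemma continuous_coord psi D l : diffeo psi ->
  continuous (fun t => dot2 l (psi (crv D t))).
Proof.
move=> dpsi t; apply: differentiable_continuous; apply/derivable1_diffP.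
exact: (coord_derive1 D l t dpsi).1.
Qed.

(** [J1] and [J2] are the Jacobians at the two crossings and [m] is the direction of arc 0; the
    determinants are compared in the chart. *)
Lemma opposite_signs (m J1 J2 d1 d2 : R) : (m = 1 \/ m = -1) ->
    (0 < J1) = (0 < J2) -> J1 != 0 -> J2 != 0 ->
    m * (J1 * d1) < 0 -> 0 < m * (J2 * d2) ->
  (if 0 < d2 then 1 else -1 : int) = - (if 0 < d1 then 1 else -1).
Proof.
move=> hm JJ J10 J20 h1 h2.
suff -> : (0 < d2) = ~~ (0 < d1) by case: (0 < d1).
rewrite -leNgt; move: JJ.
case: (ltgtP 0 J1) J10 => // j1 _; case: (ltgtP 0 J2) J20 => // j2 _ _;
  case: hm h1 h2 => ->; rewrite ?mul1r ?mulN1r ?oppr_lt0 ?oppr_gt0.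
- by rewrite pmulr_rlt0 // pmulr_rgt0 // => /ltW -> ->.
- by rewrite pmulr_rgt0 // pmulr_rlt0 // => h1 h2; rewrite !leNgt h1 ltNge (ltW h2).
- rewrite nmulr_rlt0 // nmulr_rgt0 // => h1 h2.
  by rewrite !leNgt h1 ltNge (ltW h2).
- by rewrite nmulr_rgt0 // nmulr_rlt0 // => h1 h2; rewrite (ltW h1) h2.
Qed.

(** The height [y] of arc 1 above the diameter is positive before [s] and after [t], so its slope is
    at most 0 at [s] and at least 0 at [t], strictly by transversality. Arc 0 keeps one direction,
    so the two crossings have opposite signs. *)
Lemma Hpoly_Omega2 D D' : Omega2 D D' -> Hpoly D = Hpoly D'.
Proof.
move=> [psi [a [b [lc [arc0 arc1 embD embD' [s [t [as' st tb zeros ovst]]]]]]]].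
have lc' := local_change_sym lc.
have [dpsi [ab disj] _ _ _] := lc.
have [a00 ab0 b01] := ab 0; have [a10 ab1 b11] := ab 1.
have ipsi := diffeo_inj dpsi.
have [na0 nb0 sa0 sb0] := local_change_boundary 0 lc'.
have [na1 nb1 sa1 sb1] := local_change_boundary 1 lc'.
pose w : R * R := (0, 1).
have wE x : dot2 w x = x.2 by rewrite /dot2 /= mul0r add0r mul1r.
have w0 : 0 < sqn w by rewrite /sqn /= expr0n expr1n add0r.
have flat x : a 0 <= x <= b 0 -> dot2 w (psi (crv D' x)) = 0.
  by move=> xab; rewrite wE; have [<- ->] := arc0 x xab.
have [m [m1 arcpos arcmono arcsurj]] :=
  straight_arc dpsi a00 ab0 b01 w0 sa0 sb0 flat.
have inj0 x y : a 0 <= x <= b 0 -> a 0 <= y <= b 0 -> crv D' x = crv D' y -> x = y.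
  move=> /andP[ax xb] /andP[ay yb] E; apply/eqP; rewrite eq_le !leNgt.
  by apply/andP; split; apply/negP => h; have := arcmono _ _ _ h _;
    rewrite E ltxx => H; (have := H); rewrite ?ax ?ay ?xb ?yb => /(_ isT isT).
pose y x := dot2 w (psi (crv D' x)).
have cy : continuous y by exact: continuous_coord.
have yz x : a 1 <= x <= b 1 -> y x = 0 <-> x = s \/ x = t.
  by move=> xab; rewrite /y wE; exact: zeros.
have tb1 : t <= b 1 := tb.
have sab : a 1 <= s <= b 1 by rewrite as' (le_trans (ltW st)).
have tab : a 1 <= t <= b 1 by rewrite tb1 (le_trans as') ?ltW.
have ys : y s = 0 by apply/yz => //; left.
have yt : y t = 0 by apply/yz => //; right.
have t01 x : a 1 <= x <= b 1 -> 0 <= x <= 1.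
  by move=> /andP[h1 h2]; rewrite (le_trans (ltW a10)) // (le_trans h2) // ltW.
have t00 x : a 0 <= x <= b 0 -> 0 <= x <= 1.
  by move=> /andP[h1 h2]; rewrite (le_trans (ltW a00)) // (le_trans h2) // ltW.
have aab : a 1 <= a 1 <= b 1 by rewrite lexx ltW.
have bab : a 1 <= b 1 <= b 1 by rewrite lexx ltW.
(* The ends of arc 1 are common to both diagrams, and in [D] the closed arc is above the diameter;
   so [s] and [t] are interior. *)
have ya : 0 < y (a 1).
  by rewrite /y wE (crv_out lc' (t01 _ aab) na1).1; apply: arc1.
have yb : 0 < y (b 1).
  by rewrite /y wE (crv_out lc' (t01 _ bab) nb1).1; apply: arc1.
have as_ : a 1 < s.
  by rewrite lt_neqAle as' andbT; apply: contraTneq ya => ->; rewrite ys ltxx.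
have tb_ : t < b 1.
  by rewrite lt_neqAle tb1 andbT; apply: contraTneq yb => <-; rewrite yt ltxx.
have sI : a 1 < s < b 1 by rewrite as_ (lt_trans st).
have tI : a 1 < t < b 1 by rewrite tb_ (lt_trans as_).
have ybefore x : a 1 <= x -> x < s -> 0 < y x.
  move=> ax xs; rewrite -(@no_zero_sign _ y (a 1) x) // => z /andP[az zx].
  have zs := le_lt_trans zx xs.
  apply/eqP => /yz[|e|e]; first by rewrite az (ltW (lt_le_trans zs _)) //; case/andP: sab.
    by rewrite e ltxx in zs.
  by have := lt_trans zs st; rewrite e ltxx.
have yafter x : t < x -> x <= b 1 -> 0 < y x.
  move=> tx xb; rewrite (@no_zero_sign _ y x (b 1)) // => z /andP[xz zb].
  have tz := lt_le_trans tx xz.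
  apply/eqP => /yz[|e|e].
  - by rewrite zb andbT; apply: ltW (lt_trans _ tz); case/andP: tI.
  - by have := lt_trans st tz; rewrite e ltxx.
  - by rewrite e ltxx in tz.
have w0E z : (etad psi D' z).2 = dot2 w (etad psi D' z) by rewrite wE.
have in1 x : a 1 < x < b 1 -> inb a b x by move=> h; apply/inbP; exists 1.
have in0 x : a 0 < x < b 0 -> inb a b x by move=> h; apply/inbP; exists 0.
have ne01 x z : a 1 <= x <= b 1 -> a 0 <= z <= b 0 -> x != z.
  move=> h1 h0; apply/eqP => e; rewrite e in h1.
  by have := disj 1 0 z h1 h0.
have oo (x p q : R) : p < x < q -> p <= x <= q by move=> /andP[? ?]; rewrite !ltW.
(* Arc 0 covers the open diameter, so every zero of the height is a crossing with it. *)
have partner u : a 1 < u < b 1 -> y u = 0 ->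
    exists2 p, a 0 < p < b 0 & double_pt (crv D') u p.
  move=> uI yu.
  have [||p pI /ipsi E] := arcsurj (psi (crv D' u)).
  - exact: yu.
  - by rewrite (odisc_inb lc') ?in1 // t01 // oo.
  exists p => //; split; [exact/t01/oo|exact/t00/oo|by apply: ne01; apply: oo|].
  by rewrite E.
have [p pI dsp] := partner s sI ys.
have [q qI dtq] := partner t tI yt.
have gst : crv D' s <> crv D' t.
  by move=> E; have e := embD' _ _ sab tab E; rewrite e ltxx in st.
have pq : p != q.
  apply/eqP => e; apply: gst; have [_ _ _ ->] := dsp; have [_ _ _ ->] := dtq.
  by rewrite e.
have slope_s : dot2 w (etad psi D' s) <= 0.
  have [dy Ey] := coord_derive1 D' w s dpsi; rewrite -Ey.
  suff : 0 <= 1 * (-1 * derive1 y s) by rewrite mul1r mulN1r oppr_ge0.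
  apply: derive1_sign => //; last by rewrite mulrNN mulr1.
  exists (s - a 1) => [|h h0 hs]; first by rewrite subr_gt0.
  rewrite mul1r mulN1r; apply/ltW/ybefore; last by rewrite gtrBl.
  by rewrite lerBrDr -lerBrDl ltW.
have slope_t : 0 <= dot2 w (etad psi D' t).
  have [dy Ey] := coord_derive1 D' w t dpsi; rewrite -Ey.
  suff : 0 <= 1 * (1 * derive1 y t) by rewrite !mul1r.
  apply: derive1_sign => //; last by rewrite mulr1.
  exists (b 1 - t) => [|h h0 hs]; first by rewrite subr_gt0.
  rewrite !mul1r; apply/ltW/yafter; first by rewrite ltrDl.
  by rewrite -lerBrDl ltW.
have detE u z : double_pt (crv D') u z -> a 0 < z < b 0 ->
    jac psi (crv D' u) * det2 (derive1 (crv D') u) (derive1 (crv D') z) =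
    dot2 w (etad psi D' u) * dot2 (perp w) (etad psi D' z).
  move=> [_ _ _ E] zI; apply: etrans (esym (etad_det dpsi E)) _.
  have [flatz _] := arcpos z zI; move: flatz.
  move: (etad psi D' u) (etad psi D' z) => [x1 x2] [z1 z2].
  by rewrite /dot2 /det2 /perp /= mul0r add0r mul1r => ->; ring.
have jd u z : double_pt (crv D') u z ->
    jac psi (crv D' u) * det2 (derive1 (crv D') u) (derive1 (crv D') z) != 0.
  by move=> d; rewrite mulf_neq0 // ?jac_neq0 //; exact: crv_transverse.
have neg : m * (jac psi (crv D' s) *
    det2 (derive1 (crv D') s) (derive1 (crv D') p)) < 0.
  have := jd s p dsp; rewrite detE // mulf_eq0 negb_or => /andP[n0 _].
  rewrite mulrCA nmulr_rlt0; last by rewrite lt_neqAle n0.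
  exact: (arcpos p pI).2.
have pos : 0 < m * (jac psi (crv D' t) *
    det2 (derive1 (crv D') t) (derive1 (crv D') q)).
  have := jd t q dtq; rewrite detE // mulf_eq0 negb_or => /andP[n0 _].
  rewrite mulrCA pmulr_rgt0; last by rewrite lt_neqAle eq_sym n0.
  exact: (arcpos q qI).2.
have sg_opp : csgn (gauss D') (t, q) = - csgn (gauss D') (s, p).
  exact: (opposite_signs m1 (jac_sign _ _ dpsi) (jac_neq0 _ dpsi) (jac_neq0 _ dpsi) neg pos).
have sp' : s != p by case: dsp.
have tq' : t != q by case: dtq.
have st' : s != t by rewrite lt_eqF.
have sq' : s != q by apply: ne01; apply: oo.
have tp' : t != p by apply: ne01; apply: oo.
apply: (@Hpoly_local_change R 2 D D' psi a b [::] [:: (s, p); (t, q)] lc).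
- split=> // x z dxz /inbP[i xi] /inbP[j zj]; exfalso.
  have [_ _ /eqP xz gxz] := dxz; case: xz.
  case: (ord2P i) (ord2P j) xi zj => -> [] -> /oo xi /oo zj.
  + by apply: inj0 => //; rewrite -!(proj1 (arc0 _ _)).
  + have := arc1 z zj; rewrite -gxz (arc0 x xi).2 ltxx //.
  + have := arc1 x xi; rewrite gxz (arc0 z zj).2 ltxx //.
  + exact: embD.
- split.
  + by rewrite /= inE xpair_eqE (negbTE st').
  + by move=> c; rewrite !inE => /orP[/eqP ->|/eqP ->]; split=> //=; apply: in1.
  + move=> c; rewrite !inE /rev => /orP[/eqP ->|/eqP ->] /=; rewrite !xpair_eqE negb_or.
      by rewrite (eq_sym p s) (negbTE sp') (eq_sym p t) (negbTE tp').
    by rewrite (eq_sym q s) (negbTE sq') (eq_sym q t) (negbTE tq').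
  + have cross u z : a 1 < u < b 1 -> a 0 < z < b 0 -> crv D' u = crv D' z ->
        (u, z) = (s, p) \/ (u, z) = (t, q).
      move=> uI zI E.
      have yu : y u = 0 by rewrite /y E flat // oo.
      have zr r : double_pt (crv D') u r -> a 0 < r < b 0 -> z = r.
        by move=> [_ _ _ E'] rI; apply: inj0; rewrite ?oo // -E.
      have [h _] := yz u (oo _ _ _ uI); case: (h yu) => e; rewrite e in zr *.
        by left; rewrite (zr p).
      by right; rewrite (zr q).
    move=> x z dxz /inbP[i xi] /inbP[j zj].
    have [_ _ /eqP xz gxz] := dxz.
    case: (ord2P i) (ord2P j) xi zj => -> [] -> xi zj.
    * by case: xz; apply: inj0; rewrite ?oo.
    * by right; rewrite !inE; case: (cross z x zj xi (esym gxz)) => ->; rewrite eqxx ?orbT.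
    * by left; rewrite !inE; case: (cross x z xi zj gxz) => ->; rewrite eqxx ?orbT.
    * by case: xz; apply: embD' => //; apply: oo.
move=> N; rewrite cat0s (Hsum_outer N lc) /= Hsum_Omega2 //.
- by rewrite kapC //= eq_sym.
- rewrite kap_on_right //= ?(eq_sym t s) ?(eq_sym q s) ?(eq_sym q p) //.
  by case: (on_right _ _); case: (on_right _ _); [right|left; left|left; right|right].
move=> e eO; have [de [/inbP n1 /inbP n2]] := outerP lc eO.
have e12 : e.1 != e.2 by case: de.
have out i : ~~ (a i < e.1 < b i) /\ ~~ (a i < e.2 < b i).
  by split; apply/negP => h; [apply: n1|apply: n2]; exists i.
have ne x i : a i < x < b i -> (x != e.1) && (x != e.2).
  by move=> xi; have [o1 o2] := out i; apply/andP; split;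
    [apply: contraNneq o1 => <-|apply: contraNneq o2 => <-].
have [o10 o20] := out 0; have [o11 o21] := out 1.
have /andP[s1 s2] := ne s 1 sI; have /andP[t1 t2] := ne t 1 tI.
have /andP[p1 p2] := ne p 0 pI; have /andP[q1 q2] := ne q 0 qI.
have ke : kap e (s, p) = kap e (t, q).
  rewrite !kap_on_right //= (on_right_arc o10 o20 pI qI).
  by rewrite (on_right_arc o11 o21 sI tI).
split=> //; rewrite [LHS]kapC ?[RHS]kapC ?ke //= eq_sym //.
Qed.

End Omega2.

(** * Orders and signs around the triangle of the third move *)

Section TriangleSigns.
Context {R : realType}.
Implicit Types (m s sg x y : R) (u v : R * R).

Lemma sign_unique m m' x : (m = 1 \/ m = -1) -> (m' = 1 \/ m' = -1) ->
  0 < m * x -> 0 < m' * x -> m = m'.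
Proof. by case=> ->; case=> -> //; rewrite !(mul1r, mulN1r); lra. Qed.

(** [(x, y)] is where arc 2 cuts the diagonal, [m] the direction of travel on the diagonal and [sg]
    the side on which arc 2 passes the centre: arc 2 is met after the centre exactly when these
    agree. *)
Lemma order_diag0 m sg x y : (m = 1 \/ m = -1) -> (sg = 1 \/ sg = -1) ->
  x - y = 0 -> 0 < sg * y -> (0 < m * (x + y)) = (0 < m * sg).
Proof.
by case=> ->; case=> -> xy; rewrite ?(mul1r, mulN1r, mulr1, opprK) => sy;
  apply/idP/idP => h; lra.
Qed.

Lemma order_diag1 m sg x y : (m = 1 \/ m = -1) -> (sg = 1 \/ sg = -1) ->
  x + y = 0 -> 0 < sg * y -> (m * (y - x) < 0) = (m * sg < 0).
Proof.
by case=> ->; case=> -> xy; rewrite ?(mul1r, mulN1r, mulr1, opprK) => sy;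
  apply/idP/idP => h; lra.
Qed.

Lemma order_arc_lt s sg x y : (s = 1 \/ s = -1) -> (sg = 1 \/ sg = -1) ->
  x - y = 0 -> 0 < sg * y -> 0 < s * (x + y) -> 0 < s * sg.
Proof. by case=> ->; case=> ->; rewrite ?(mul1r, mulN1r, mulr1, opprK); lra. Qed.

Lemma order_arc_gt s sg x y : (s = 1 \/ s = -1) -> (sg = 1 \/ sg = -1) ->
  x + y = 0 -> 0 < sg * y -> 0 < s * (x - y) -> s * sg < 0.
Proof. by case=> ->; case=> ->; rewrite ?(mul1r, mulN1r, mulr1, opprK); lra. Qed.

Lemma det_diag m0 m1 u v : u.1 - u.2 = 0 -> v.1 + v.2 = 0 ->
  0 < m0 * (u.1 + u.2) -> 0 < m1 * (v.2 - v.1) -> 0 < m0 * m1 * det2 u v.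
Proof.
case: u v => [u1 u2] [v1 v2] /=; rewrite /det2 /= => /subr0_eq -> /eqP.
rewrite addr_eq0 => /eqP -> h1 h2.
have -> : m0 * m1 * (u2 * v2 - u2 * - v2) =
  (m0 * (u2 + u2)) * (m1 * (v2 - - v2)) / 2 by field.
by rewrite divr_gt0 // mulr_gt0.
Qed.

(** Arc 2, with velocity [v], leaves the side [s] of the diagonal; this gives a weak inequality,
    made strict by transversality. *)
Lemma det_diag1 m s u v : s != 0 -> u.1 + u.2 = 0 -> 0 < m * (u.2 - u.1) ->
  s * (v.1 + v.2) <= 0 -> det2 u v != 0 -> 0 < m * s * det2 u v.
Proof.
case: u v => [u1 u2] [x y] /=; rewrite /det2 /= => s0 /eqP.
rewrite addr_eq0 => /eqP -> h1 h2.
have -> : - u2 * y - u2 * x = - u2 * (x + y) by ring.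
rewrite mulf_eq0 negb_or => /andP[_ n0].
have h3 : s * (x + y) < 0 by rewrite lt_neqAle h2 mulf_neq0.
have -> : m * s * (- u2 * (x + y)) = (m * (u2 - - u2)) * (- (s * (x + y))) / 2.
  by field.
by rewrite divr_gt0 // mulr_gt0 // oppr_gt0.
Qed.

Lemma det_diag0 m s u v : s != 0 -> v.1 - v.2 = 0 -> 0 < m * (v.1 + v.2) ->
  s * (u.1 - u.2) <= 0 -> det2 u v != 0 -> m * s * det2 u v < 0.
Proof.
case: u v => [x y] [u1 u2] /=; rewrite /det2 /= => s0 /subr0_eq -> h1 h2.
have -> : x * u2 - y * u2 = u2 * (x - y) by ring.
rewrite mulf_eq0 negb_or => /andP[_ n0].
have h3 : s * (x - y) < 0 by rewrite lt_neqAle h2 mulf_neq0.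
have -> : m * s * (u2 * (x - y)) = (m * (u2 + u2)) * (s * (x - y)) / 2 by field.
by rewrite ltr_pdivrMr // mul0r pmulr_rlt0.
Qed.

End TriangleSigns.

(** * The triangle inside one diagram *)

Section Triangle.
Context {R : realType}.
Variables (E : knotoid_diagram R) (psi : R * R -> R * R) (a b : 'I_3 -> R).
Variables (sigma m0 m1 s2 : R).

Let i0 : 'I_3 := 0.
Let i1 : 'I_3 := 1.
Let i2 : 'I_3 := 2.
Let w0 : R * R := (1, -1).
Let w1 : R * R := (1, 1).
Let eta t := psi (crv E t).

(** [sigma] is the side on which arc 2 passes the centre, [m0] and [m1] the directions of arcs 0 and
    1, [s2] the abscissa at which arc 2 starts. Only [sigma] will differ between the two diagrams of
    a move. *)
Record triangle_config : Prop := TriangleConfig {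
  tc_diffeo : diffeo psi;
  tc_arc : forall i, [/\ 0 < a i, a i < b i & b i < 1];
  tc_disj : forall i j t, a i <= t <= b i -> a j <= t <= b j -> i = j;
  tc_odisc : forall t, 0 <= t <= 1 -> in_odisc (eta t) = inb a b t;
  tc_bd : forall i, sqn (eta (a i)) = 1 /\ sqn (eta (b i)) = 1;
  tc_diag0 : forall t, a i0 <= t <= b i0 -> dot2 w0 (eta t) = 0;
  tc_diag1 : forall t, a i1 <= t <= b i1 -> dot2 w1 (eta t) = 0;
  tc_m0 : m0 = 1 \/ m0 = -1;
  tc_m1 : m1 = 1 \/ m1 = -1;
  tc_s2 : s2 = 1 \/ s2 = -1;
  tc_sigma : sigma = 1 \/ sigma = -1;
  tc_dir0 : m0 * dot2 (perp w0) (eta (a i0)) < m0 * dot2 (perp w0) (eta (b i0));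
  tc_dir1 : m1 * dot2 (perp w1) (eta (a i1)) < m1 * dot2 (perp w1) (eta (b i1));
  tc_start : eta (a i2) = (s2, 0);
  tc_end : (eta (b i2)).2 = 0;
  tc_side : forall t, a i2 < t < b i2 -> 0 < sigma * (eta t).2;
  tc_emb : embedded_on E (a i2) (b i2);
  tc_ex0 : exists! t, a i2 <= t <= b i2 /\ dot2 w0 (eta t) = 0;
  tc_ex1 : exists! t, a i2 <= t <= b i2 /\ dot2 w1 (eta t) = 0 }.

(** [pij] is the parameter on arc i of its crossing with arc j. The orders depend on [sigma], the
    signs do not. *)
Record triangle_data (p01 p10 p02 p20 p12 p21 : R) : Prop := TriangleData {
  td_p01 : a i0 < p01 < b i0; td_p10 : a i1 < p10 < b i1;
  td_p02 : a i0 < p02 < b i0; td_p20 : a i2 < p20 < b i2;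
  td_p12 : a i1 < p12 < b i1; td_p21 : a i2 < p21 < b i2;
  td_A : double_pt (crv E) p01 p10;
  td_B : double_pt (crv E) p12 p21;
  td_C : double_pt (crv E) p20 p02;
  td_o0 : (p01 < p02) = (0 < m0 * sigma);
  td_o1 : (p12 < p10) = (m1 * sigma < 0);
  td_o2 : (p20 < p21) = (0 < s2 * sigma);
  td_sA : 0 < m0 * m1 *
    (jac psi (crv E p01) * det2 (derive1 (crv E) p01) (derive1 (crv E) p10));
  td_sB : 0 < m1 * s2 *
    (jac psi (crv E p12) * det2 (derive1 (crv E) p12) (derive1 (crv E) p21));
  td_sC : m0 * s2 *
    (jac psi (crv E p20) * det2 (derive1 (crv E) p20) (derive1 (crv E) p02)) < 0;
  td_inner : inner_list a b E [:: (p01, p10); (p12, p21); (p20, p02)] }.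

Hypothesis tc : triangle_config.

Let ipsi : injective psi := diffeo_inj (tc_diffeo tc).

Let w0E x : dot2 w0 x = x.1 - x.2.
Proof. by rewrite /dot2 /=; ring. Qed.
Let w1E x : dot2 w1 x = x.1 + x.2.
Proof. by rewrite /dot2 /=; ring. Qed.
Let p0E x : dot2 (perp w0) x = x.1 + x.2.
Proof. by rewrite /dot2 /perp /=; ring. Qed.
Let p1E x : dot2 (perp w1) x = x.2 - x.1.
Proof. by rewrite /dot2 /perp /=; ring. Qed.

Let oo (x p q : R) : p < x < q -> p <= x <= q.
Proof. by move=> /andP[? ?]; rewrite !ltW. Qed.

Let in01 i x : a i <= x <= b i -> 0 <= x <= 1.
Proof.
have [h1 h2 h3] := tc_arc tc i.
by move=> /andP[h4 h5]; rewrite (le_trans (ltW h1)) // (le_trans h5) // ltW.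
Qed.

Let inI i x : a i < x < b i -> inb a b x.
Proof. by move=> h; apply/inbP; exists i. Qed.

Let ne i j x y : i != j -> a i < x < b i -> a j < y < b j -> x != y.
Proof.
move=> /eqP ij hx hy; apply/eqP => e; rewrite e in hx; apply: ij.
exact: (tc_disj tc (oo hx) (oo hy)).
Qed.

Let sw0 : 0 < sqn w0.
Proof. by rewrite /sqn /=; lra. Qed.

Let straight0 : [/\ forall z, a i0 < z < b i0 ->
      dot2 w0 (etad psi E z) = 0 /\ 0 < m0 * dot2 (perp w0) (etad psi E z),
    forall x y, a i0 <= x -> x < y -> y <= b i0 ->
      m0 * dot2 (perp w0) (eta x) < m0 * dot2 (perp w0) (eta y) &
    forall x, dot2 w0 x = 0 -> in_odisc x ->
      exists2 z, a i0 < z < b i0 & eta z = x].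
Proof.
have [h1 h2 h3] := tc_arc tc i0; have [sa sb] := tc_bd tc i0.
have [s [s1 S1 S2 S3]] := straight_arc (tc_diffeo tc) h1 h2 h3 sw0 sa sb (tc_diag0 tc).
have ms : s = m0.
  apply: (@sign_unique R _ _ (dot2 (perp w0) (eta (b i0)) - dot2 (perp w0) (eta (a i0)))) => //.
  - exact: tc_m0.
  - by rewrite mulrBr subr_gt0; apply: S2.
  - by rewrite mulrBr subr_gt0; apply: tc_dir0.
by rewrite -ms; split.
Qed.

Let straight1 : [/\ forall z, a i1 < z < b i1 ->
      dot2 w1 (etad psi E z) = 0 /\ 0 < m1 * dot2 (perp w1) (etad psi E z),
    forall x y, a i1 <= x -> x < y -> y <= b i1 ->
      m1 * dot2 (perp w1) (eta x) < m1 * dot2 (perp w1) (eta y) &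
    forall x, dot2 w1 x = 0 -> in_odisc x ->
      exists2 z, a i1 < z < b i1 & eta z = x].
Proof.
have [h1 h2 h3] := tc_arc tc i1; have [sa sb] := tc_bd tc i1.
have sw : 0 < sqn w1 by rewrite /sqn /=; lra.
have [s [s1 S1 S2 S3]] := straight_arc (tc_diffeo tc) h1 h2 h3 sw sa sb (tc_diag1 tc).
have ms : s = m1.
  apply: (@sign_unique R _ _ (dot2 (perp w1) (eta (b i1)) - dot2 (perp w1) (eta (a i1)))) => //.
  - exact: tc_m1.
  - by rewrite mulrBr subr_gt0; apply: S2.
  - by rewrite mulrBr subr_gt0; apply: tc_dir1.
by rewrite -ms; split.
Qed.

Let mono_lt (f : R -> R) (p q m : R) x y :
  (forall x y, p <= x -> x < y -> y <= q -> m * f x < m * f y) ->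
  p <= x <= q -> p <= y <= q -> (x < y) = (m * f x < m * f y).
Proof.
move=> H /andP[px xq] /andP[py yq]; case: (ltgtP x y) => [h|h|->].
- by rewrite H.
- by apply/esym/negbTE; rewrite -leNgt; apply/ltW/H.
- by rewrite ltxx.
Qed.

Let mono_inj (f : R -> R) (p q m : R) x y :
  (forall x y, p <= x -> x < y -> y <= q -> m * f x < m * f y) ->
  p <= x <= q -> p <= y <= q -> f x = f y -> x = y.
Proof.
move=> H hx hy fxy; apply/eqP; rewrite eq_le !leNgt.
by rewrite (mono_lt H hx hy) (mono_lt H hy hx) fxy ltxx.
Qed.

(* The two diagonals are treated alike: along arc 2 the function dot2 w takes
   the value s2 at the start and has a single zero z. *)
Let before_zero (w : R * R) z t : w.1 = 1 -> a i2 < z < b i2 ->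
  (forall t, a i2 <= t <= b i2 -> dot2 w (eta t) = 0 -> t = z) ->
  a i2 <= t -> t < z -> 0 < s2 * dot2 w (eta t).
Proof.
move=> w1' /andP[az zb] uz at_ tz.
have c : continuous (fun t => s2 * dot2 w (eta t)).
  move=> x; apply: cvgMl_tmp; exact: (@continuous_coord R psi E w (tc_diffeo tc)).
rewrite -(@no_zero_sign _ (fun t => s2 * dot2 w (eta t)) (a i2) t) //.
  rewrite (tc_start tc) /dot2 w1' /= mul1r mulr0 addr0.
  by case: (tc_s2 tc) => ->; rewrite ?mulr1 ?mulrNN ?mulr1.
move=> x /andP[ax xt]; rewrite mulf_neq0 //.
  by case: (tc_s2 tc) => ->; rewrite ?oppr_eq0 oner_eq0.
apply/eqP => /uz xz; have := le_lt_trans xt tz; rewrite xz ?ltxx //.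
by rewrite ax (le_trans xt) // (le_trans (ltW tz)) // ltW.
Qed.

Let slope_zero (w : R * R) z : w.1 = 1 -> a i2 < z < b i2 ->
  (forall t, a i2 <= t <= b i2 -> dot2 w (eta t) = 0 -> t = z) ->
  dot2 w (eta z) = 0 -> s2 * dot2 w (etad psi E z) <= 0.
Proof.
move=> w1' zI uz z0; have [dy Ey] := coord_derive1 E w z (tc_diffeo tc).
rewrite -Ey -oppr_ge0.
have -> : - (s2 * derive1 (fun t => dot2 w (psi (crv E t))) z) =
    s2 * (-1 * derive1 (fun t => dot2 w (psi (crv E t))) z).
  by rewrite mulN1r mulrN.
have /andP[az zb] := zI.
apply: derive1_sign => //; last by rewrite mulrNN mulr1.
exists (z - a i2) => [|h h0 hs]; first by rewrite subr_gt0.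
rewrite mulN1r; apply/ltW/(before_zero w1' zI uz); last by rewrite gtrBl.
by rewrite lerBrDr -lerBrDl ltW.
Qed.

Let s2_neq0 : s2 != 0.
Proof. by case: (tc_s2 tc) => ->; rewrite ?oppr_eq0 oner_eq0. Qed.

(** Both ends of arc 2 have coordinates [(1, 0)] or [(-1, 0)], where [dot2 w] is not 0. *)
Let end_interior (w : R * R) z : w.1 = 1 -> a i2 <= z <= b i2 ->
  dot2 w (eta z) = 0 -> a i2 < z < b i2.
Proof.
move=> w1' /andP[az zb] z0; rewrite !lt_neqAle az zb !andbT; apply/andP; split.
  apply: contra_eq_neq z0 => <-.
  by rewrite (tc_start tc) /dot2 w1' /= mul1r mulr0 addr0.
apply: contra_eq_neq z0 => ->; have [_] := tc_bd tc i2.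
rewrite /sqn /dot2 (tc_end tc) w1' mulr0 addr0 mul1r expr0n addr0 => /eqP.
by apply: contraTneq => ->; rewrite expr0n eq_sym oner_eq0.
Qed.

Lemma triangle_dataP : exists p01 p10 p02 p20 p12 p21,
  triangle_data p01 p10 p02 p20 p12 p21.
Proof.
have [S1 S2 S3] := straight0; have [T1 T2 T3] := straight1.
have [p21 [[p21ab z21] u21]] := tc_ex1 tc.
have [p20 [[p20ab z20] u20]] := tc_ex0 tc.
have {}u21 t : a i2 <= t <= b i2 -> dot2 w1 (eta t) = 0 -> t = p21.
  by move=> h1 h2; apply/esym/u21.
have {}u20 t : a i2 <= t <= b i2 -> dot2 w0 (eta t) = 0 -> t = p20.
  by move=> h1 h2; apply/esym/u20.
have I21 : a i2 < p21 < b i2 by apply: (@end_interior w1).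
have I20 : a i2 < p20 < b i2 by apply: (@end_interior w0).
have od i t : a i < t < b i -> in_odisc (eta t).
  by move=> h; rewrite (tc_odisc tc) ?(inI h) //; exact: in01 (oo h).
have [p12 I12 E12] := T3 _ z21 (od _ _ I21).
have [p02 I02 E02] := S3 _ z20 (od _ _ I20).
(* Arcs 0 and 1 cross at the centre. *)
have o0 : in_odisc ((0, 0) : R * R) by rewrite /in_odisc /= expr0n addr0 ltr01.
have [|p01 I01 E01] := S3 (0, 0) _ o0; first by rewrite w0E subrr.
have [|p10 I10 E10] := T3 (0, 0) _ o0; first by rewrite w1E addr0.
have dpt i j x y : i != j -> a i < x < b i -> a j < y < b j -> eta x = eta y ->
    double_pt (crv E) x y.
  move=> ij hx hy h; split; [exact: in01 (oo hx)|exact: in01 (oo hy)| |exact: ipsi].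
  exact: ne ij hx hy.
have dA : double_pt (crv E) p01 p10 by apply: (dpt i0 i1) => //; rewrite E01.
have dB : double_pt (crv E) p12 p21 by apply: (dpt i1 i2).
have dC : double_pt (crv E) p20 p02 by apply: (dpt i2 i0).
have y20 := tc_side tc I20; have y21 := tc_side tc I21.
have jdet x y : double_pt (crv E) x y ->
    det2 (etad psi E x) (etad psi E y) =
    jac psi (crv E x) * det2 (derive1 (crv E) x) (derive1 (crv E) y) /\
    det2 (etad psi E x) (etad psi E y) != 0.
  move=> d; have [_ _ _ h] := d; have H := etad_det (tc_diffeo tc) h.
  split; first exact: H.
  have nz := mulf_neq0 (jac_neq0 (crv E x) (tc_diffeo tc)) (crv_transverse d).
  apply/eqP => h0; move/eqP: nz; apply; exact: etrans (esym H) h0.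
have [jA nA] := jdet _ _ dA; have [jB nB] := jdet _ _ dB; have [jC nC] := jdet _ _ dC.
have [f01 g01] := S1 _ I01; have [f02 g02] := S1 _ I02.
have [f10 g10] := T1 _ I10; have [f12 g12] := T1 _ I12.
rewrite w0E p0E in f01 g01; rewrite w0E p0E in f02 g02.
rewrite w1E p1E in f10 g10; rewrite w1E p1E in f12 g12.
have sl21 := slope_zero (w := w1) erefl I21 u21 z21; rewrite w1E in sl21.
have sl20 := slope_zero (w := w0) erefl I20 u20 z20; rewrite w0E in sl20.
exists p01, p10, p02, p20, p12, p21; split=> //.
- rewrite (mono_lt S2 (oo I01) (oo I02)) E01 E02 !p0E /= addr0 mulr0.
  apply: order_diag0 y20; [exact: tc_m0 tc|exact: tc_sigma tc|by rewrite -w0E].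
- rewrite (mono_lt T2 (oo I12) (oo I10)) E12 E10 !p1E /= subr0 mulr0.
  apply: order_diag1 y21; [exact: tc_m1 tc|exact: tc_sigma tc|by rewrite -w1E].
(* At the first crossing met by arc 2, the form of the other diagonal still has the sign [s2] of the
   start, which determines the side of the point. A simultaneous crossing would be at the centre,
   which arc 2 avoids. *)
- have /andP[a20 _] := oo I20; have /andP[a21 _] := oo I21.
  case: (ltgtP p20 p21) => [h|h|h].
  + have := before_zero (w := w1) erefl I21 u21 a20 h; rewrite w1E => h'.
    apply/esym/(order_arc_lt (tc_s2 tc) (tc_sigma tc) _ y20 h').
    by rewrite -w0E.
  + have := before_zero (w := w0) erefl I20 u20 a21 h; rewrite w0E => h'.
    apply/esym/negbTE; rewrite -leNgt; apply/ltW.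
    apply: (order_arc_gt (tc_s2 tc) (tc_sigma tc) _ y21 h').
    by rewrite -w1E.
  + have e0 : eta p21 = (0, 0).
      rewrite -h; apply: (dot2_inj (w := w0)); first exact: sw0.
        by rewrite z20 w0E subrr.
      by rewrite p0E -w1E h z21 p0E addr0.
    by have := y21; rewrite e0 mulr0 ltxx.
- exact: (eq_ind _ (fun x => 0 < m0 * m1 * x) (det_diag f01 f10 g01 g10) _ jA).
- exact: (eq_ind _ (fun x => 0 < m1 * s2 * x)
    (det_diag1 s2_neq0 f12 g12 sl21 nB) _ jB).
- exact: (eq_ind _ (fun x => m0 * s2 * x < 0)
    (det_diag0 s2_neq0 f02 g02 sl20 nC) _ jC).
split.
- rewrite /= !inE !xpair_eqE !negb_or (negbTE (ne (i := i0) (j := i1) _ I01 I12)) //.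
  rewrite (negbTE (ne (i := i0) (j := i2) _ I01 I20)) //.
  by rewrite (negbTE (ne (i := i1) (j := i2) _ I12 I20)).
- by move=> c; rewrite !inE => /or3P[] /eqP -> /=; split=> //;
    [exact: inI I01|exact: inI I12|exact: inI I20].
- have n01 := ne (i := i1) (j := i0) isT; have n02 := ne (i := i2) (j := i0) isT.
  have n10 := ne (i := i0) (j := i1) isT; have n12 := ne (i := i2) (j := i1) isT.
  have n20 := ne (i := i0) (j := i2) isT; have n21 := ne (i := i1) (j := i2) isT.
  move=> c; rewrite !inE => /or3P[] /eqP -> /=; rewrite !xpair_eqE !negb_or.
  + by rewrite (negbTE (n01 _ _ I10 I01)) (negbTE (n21 _ _ I10 I20))
      (negbTE (n20 _ _ I01 I21)) andbF.
  + by rewrite (negbTE (n02 _ _ I21 I01)) (negbTE (n12 _ _ I21 I12))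
      (negbTE (n01 _ _ I12 I02)) andbF.
  + by rewrite (negbTE (n12 _ _ I20 I10)) (negbTE (n10 _ _ I02 I12))
      (negbTE (n20 _ _ I02 I20)) andbF.
have cross01 u v : a i0 < u < b i0 -> a i1 < v < b i1 -> crv E u = crv E v ->
    (u, v) = (p01, p10).
  move=> uI vI uv; have euv : eta u = eta v by rewrite /eta uv.
  have e1 : dot2 w1 (eta u) = 0 by rewrite euv; apply/(tc_diag1 tc)/oo.
  have e0 : dot2 w0 (eta v) = 0 by rewrite -euv; apply/(tc_diag0 tc)/oo.
  congr (_, _).
    by apply: (mono_inj S2 (oo uI) (oo I01)); rewrite E01 p0E -w1E e1 p0E addr0.
  apply: (mono_inj T2 (oo vI) (oo I10)); rewrite E10 !p1E subr0 -opprB -w0E e0 oppr0 //.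
have cross02 u v : a i2 < u < b i2 -> a i0 < v < b i0 -> crv E u = crv E v ->
    (u, v) = (p20, p02).
  move=> uI vI uv; have euv : eta u = eta v by rewrite /eta uv.
  have e0 : u = p20 by apply: (u20 _ (oo uI)); rewrite euv; apply/(tc_diag0 tc)/oo.
  congr (_, _) => //.
  by apply: (mono_inj S2 (oo vI) (oo I02)); rewrite E02 -euv e0.
have cross12 u v : a i1 < u < b i1 -> a i2 < v < b i2 -> crv E u = crv E v ->
    (u, v) = (p12, p21).
  move=> uI vI uv; have euv : eta u = eta v by rewrite /eta uv.
  have e0 : v = p21 by apply: (u21 _ (oo vI)); rewrite -euv; apply/(tc_diag1 tc)/oo.
  congr (_, _) => //.
  by apply: (mono_inj T2 (oo uI) (oo I12)); rewrite E12 euv e0.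
move=> x y dxy /inbP[i xi] /inbP[j yj].
have [_ _ /eqP xy gxy] := dxy; have gyx := esym gxy.
have exy : eta x = eta y by rewrite /eta gxy.
have ord3P (k : 'I_3) : [\/ k = i0, k = i1 | k = i2].
  by case: k => [[|[|[|]]]] //= h; [constructor 1|constructor 2|constructor 3]; apply: val_inj.
case: (ord3P i) xi => -> xi; case: (ord3P j) yj => -> yj.
- by case: xy; apply: (mono_inj S2 (oo xi) (oo yj)); rewrite exy.
- by left; rewrite (cross01 _ _ xi yj gxy) !inE eqxx.
- by right; rewrite (cross02 _ _ yj xi gyx) !inE eqxx !orbT.
- by right; rewrite (cross01 _ _ yj xi gyx) !inE eqxx.
- by case: xy; apply: (mono_inj T2 (oo xi) (oo yj)); rewrite exy.
- by left; rewrite (cross12 _ _ xi yj gxy) !inE eqxx orbT.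
- by left; rewrite (cross02 _ _ xi yj gxy) !inE eqxx !orbT.
- by right; rewrite (cross12 _ _ yj xi gyx) !inE eqxx orbT.
- by case: xy; apply: (tc_emb tc (oo xi) (oo yj)).
Qed.

End Triangle.

(** * The third move *)

Section Omega3.
Context {R : realType}.
Implicit Types (D E : knotoid_diagram R) (psi : R * R -> R * R) (c e : R * R).

(** Within an arc that contains the start of [c] but not its end, the right side is what follows the
    start, whether or not it runs through the gap. *)
Lemma on_right_start (p q : R) c x : p < c.1 < q -> p < x < q ->
  ~~ (p < c.2 < q) -> on_right c x = (c.1 < x).
Proof.
move=> /andP[p1 q1] /andP[px qx]; rewrite negb_and -!leNgt /on_right => out.
case: ltP => c12.
  have qc : q <= c.2.
    by case/orP: out => // c2p; have := lt_trans c12 (le_lt_trans c2p p1); rewrite ltxx.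
  by rewrite (lt_le_trans qx qc) andbT.
have cp : c.2 <= p.
  by case/orP: out => // qc2; have := lt_le_trans q1 (le_trans qc2 c12); rewrite ltxx.
by rewrite [x < c.2]ltNge (le_trans cp (ltW px)).
Qed.

Lemma on_right_end (p q : R) c x : p < c.2 < q -> p < x < q ->
  ~~ (p < c.1 < q) -> on_right c x = (x < c.2).
Proof.
move=> /andP[p2 q2] /andP[px qx]; rewrite negb_and -!leNgt /on_right => out.
case: ltP => c12.
  have cp : c.1 <= p.
    by case/orP: out => // qc; have := lt_trans c12 (lt_le_trans q2 qc); rewrite ltxx.
  by rewrite (le_lt_trans cp px).
have qc : q <= c.1.
  by case/orP: out => // c1p; have := le_lt_trans c12 (le_lt_trans c1p p2); rewrite ltxx.
by rewrite [c.1 < x]ltNge (le_trans (ltW qx) qc) orbF.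
Qed.

Lemma bsg_mul_pos (m d J : R) : (m = 1 \/ m = -1) -> J != 0 -> 0 < m * (J * d) ->
  bsg (0 < d) = bsg (0 < J) * bsg (0 < m).
Proof.
move=> hm J0; case: hm => ->;
  rewrite ?mul1r ?mulN1r ?oppr_gt0 ?ltr01 ?ltr10 ?mulr1 ?mulrN1; case: (ltgtP J 0) J0 => // j _ h.
- by rewrite nmulr_rgt0 // in h; rewrite ltNge (ltW h).
- by rewrite pmulr_rgt0 // in h; rewrite h.
- by rewrite nmulr_rlt0 // in h; rewrite h.
- by rewrite pmulr_rlt0 // in h; rewrite ltNge (ltW h).
Qed.

Lemma pm1_mul (m m' : R) : (m = 1 \/ m = -1) -> (m' = 1 \/ m' = -1) ->
  (m * m' = 1 \/ m * m' = -1) /\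
  bsg (0 < m * m') = bsg (0 < m) * bsg (0 < m').
Proof.
by case=> ->; case=> ->; rewrite ?mul1r ?mulr1 ?mulrNN ?mulr1 ?ltr01 ?ltr0N1;
  split=> //; [left|right|right|left].
Qed.

Lemma bsgN (m : R) : (m = 1 \/ m = -1) -> bsg (0 < - m) = - bsg (0 < m).
Proof. by case=> ->; rewrite ?opprK ?ltr01 ?ltr0N1. Qed.

Section OneDiagram.
Variables (E : knotoid_diagram R) (psi : R * R -> R * R) (a b : 'I_3 -> R).
Variables (sigma m0 m1 s2 : R) (p01 p10 p02 p20 p12 p21 : R).
Hypothesis tc : triangle_config E psi a b sigma m0 m1 s2.
Hypothesis td : triangle_data E psi a b sigma m0 m1 s2 p01 p10 p02 p20 p12 p21.
Variable O : seq (R * R).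
Hypothesis outO : forall e, e \in O -> e.1 != e.2 /\
  forall i, ~~ (a i < e.1 < b i) /\ ~~ (a i < e.2 < b i).

Let A := (p01, p10).
Let B := (p12, p21).
Let C := (p20, p02).

Let j : bool := 0 < jac psi 0.

Lemma arc_ne : forall i k x y, i != k -> a i < x < b i -> a k < y < b k -> x != y.
Proof.
move=> i k x y /eqP ik /andP[h1 h2] /andP[h3 h4]; apply/eqP => e; rewrite e in h1 h2.
by apply: ik; apply: (tc_disj tc (t := y)); rewrite !ltW.
Qed.

Let out i k x : i != k -> a i < x < b i -> ~~ (a k < x < b k).
Proof.
by move=> ik h; apply/negP => h'; have := arc_ne ik h h'; rewrite eqxx.
Qed.

Let sgnE x y (m m' : R) : (m = 1 \/ m = -1) -> (m' = 1 \/ m' = -1) ->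
  0 < m * m' * (jac psi (crv E x) * det2 (derive1 (crv E) x) (derive1 (crv E) y)) ->
  csgn (gauss E) (x, y) = bsg j * (bsg (0 < m) * bsg (0 < m')).
Proof.
move=> hm hm' H; have [h1 <-] := pm1_mul hm hm'.
rewrite /j (jac_sign 0 (crv E x) (tc_diffeo tc)).
exact: (bsg_mul_pos h1 (jac_neq0 _ (tc_diffeo tc)) H).
Qed.

(** The factor [K] of [triangle]: each crossing sign is the sign of the Jacobian times two strand
    factors, up to sign, and the order attached to the chord supplies the missing strand and
    [sigma], whose squares are 1. *)
Definition triangle_sign : int :=
  bsg j * (bsg (0 < m0) * bsg (0 < m1) * bsg (0 < s2) * bsg (0 < sigma)).

(** An outer chord sees each arc as one point, here [p01], [p10] and [p21]; the three values are
    differences around a cycle and add up to 0. *)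
Lemma kap_e e : e \in O ->
  [/\ kap e A = (on_right e p10)%:Z - (on_right e p01)%:Z,
      kap e B = (on_right e p21)%:Z - (on_right e p10)%:Z &
      kap e C = (on_right e p01)%:Z - (on_right e p21)%:Z] /\
  [/\ kap A e = - kap e A, kap B e = - kap e B & kap C e = - kap e C].
Proof.
move=> eO; have [e12 oe] := outO eO.
have n1 i x : a i < x < b i -> x != e.1.
  by move=> h; apply: contraNneq (oe i).1 => <-.
have n2 i x : a i < x < b i -> x != e.2.
  by move=> h; apply: contraNneq (oe i).2 => <-.
case: td => I01 I10 I02 I20 I12 I21 [_ _ nA _] [_ _ nB _] [_ _ nC _] *.
have arc i x y : a i < x < b i -> a i < y < b i -> on_right e x = on_right e y.
  exact: (on_right_arc (oe i).1 (oe i).2).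
split; split.
- by rewrite kap_on_right ?(n1 _ _ I01) ?(n2 _ _ I01) ?(n1 _ _ I10) ?(n2 _ _ I10).
- rewrite kap_on_right ?(n1 _ _ I12) ?(n2 _ _ I12) ?(n1 _ _ I21) ?(n2 _ _ I21) //.
  by rewrite /= (arc _ _ _ I12 I10).
- rewrite kap_on_right ?(n1 _ _ I20) ?(n2 _ _ I20) ?(n1 _ _ I02) ?(n2 _ _ I02) //.
  by rewrite /= (arc _ _ _ I02 I01) (arc _ _ _ I20 I21).
- by rewrite kapC // eq_sym ?(n1 _ _ I01) ?(n2 _ _ I01) ?(n1 _ _ I10) ?(n2 _ _ I10).
- by rewrite kapC // eq_sym ?(n1 _ _ I12) ?(n2 _ _ I12) ?(n1 _ _ I21) ?(n2 _ _ I21).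
- by rewrite kapC // eq_sym ?(n1 _ _ I20) ?(n2 _ _ I20) ?(n1 _ _ I02) ?(n2 _ _ I02).
Qed.

Lemma triangle_of_data : triangle O (csgn (gauss E)) A B C triangle_sign
  (on_right A p21) (0 < m0 * sigma) (m1 * sigma < 0) (0 < s2 * sigma).
Proof.
have ke := kap_e; have [hm0 hm1 hs hsg] : [/\ m0 = 1 \/ m0 = -1, m1 = 1 \/ m1 = -1,
  s2 = 1 \/ s2 = -1 & sigma = 1 \/ sigma = -1] by case: tc.
case: td => I01 I10 I02 I20 I12 I21 [_ _ nA _] [_ _ nB _] [_ _ nC _] o0 o1 o2 sA sB sC _.
have dA := td_A td; have dB := td_B td; have dC := td_C td.
(* Otherwise arc 1 would meet arcs 0 and 2 in a triple point. *)
have n1210 : p12 != p10.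
  apply/eqP => h; rewrite h in dB.
  have := crv_no_triple (double_ptC dA) dB => e.
  by have := @arc_ne 0 2 _ _ isT I01 I21; rewrite e eqxx.
have n0201 : p02 != p01.
  apply/eqP => h; rewrite h in dC.
  have := crv_no_triple dA (double_ptC dC) => e.
  by have := @arc_ne 1 2 _ _ isT I10 I20; rewrite e eqxx.
have n2021 : p20 != p21.
  apply/eqP => h; rewrite h in dC.
  have := crv_no_triple dC (double_ptC dB) => e.
  by have := @arc_ne 0 1 _ _ isT I02 I12; rewrite e eqxx.
have kAB : kap A B = (on_right A p21)%:Z - (m1 * sigma < 0)%R%:Z.
  rewrite kap_on_right /= ?(@arc_ne 1 0 _ _ isT I12 I01) ?(@arc_ne 2 0 _ _ isT I21 I01)
    ?(@arc_ne 2 1 _ _ isT I21 I10) //.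
  by rewrite (@on_right_end _ _ A p12 I10 I12) ?o1 //; apply: (@out 0 1).
have kAC : kap A C = (0 < m0 * sigma)%R%:Z - (on_right A p21)%:Z.
  rewrite kap_on_right /= ?(@arc_ne 2 0 _ _ isT I20 I01) ?(@arc_ne 2 1 _ _ isT I20 I10)
    ?(@arc_ne 0 1 _ _ isT I02 I10) //.
  rewrite (@on_right_start _ _ A p02 I01 I02) ?o0; last exact: (@out 1 0).
  by rewrite (on_right_arc (c := A) (@out 0 2 _ isT I01) (@out 1 2 _ isT I10) I20 I21).
have kBA : kap B A = (m1 * sigma < 0)%R%:Z - (on_right B p01)%:Z.
  rewrite kap_on_right /= ?(@arc_ne 0 1 _ _ isT I01 I12) ?(@arc_ne 0 2 _ _ isT I01 I21)
    ?(@arc_ne 1 2 _ _ isT I10 I21) ?(eq_sym p10 p12) //.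
  by rewrite (@on_right_start _ _ B p10 I12 I10) ?o1 //; apply: (@out 2 1).
have kABC : kap A B = - kap B A.
  by rewrite kapC //= ?(@arc_ne 1 0 _ _ isT I12 I01) ?(@arc_ne 2 0 _ _ isT I21 I01)
    ?(@arc_ne 2 1 _ _ isT I21 I10).
(* The antisymmetry of [kap A B] identifies the two sides, so a single [r] serves the three
   chords. *)
have rB : (on_right B p01)%:Z = (on_right A p21)%:Z.
  by move: kABC; rewrite kAB kBA opprB => /addIr.
have kBC : kap B C = (on_right A p21)%:Z - (0 < s2 * sigma)%R%:Z.
  rewrite kap_on_right /= ?(@arc_ne 2 1 _ _ isT I20 I12) ?(@arc_ne 0 1 _ _ isT I02 I12)
    ?(@arc_ne 0 2 _ _ isT I02 I21) //.
  rewrite (@on_right_end _ _ B p20 I21 I20) ?o2; last exact: (@out 1 2).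
  by rewrite (on_right_arc (c := B) (@out 1 0 _ isT I12) (@out 2 0 _ isT I21) I02 I01) rB.
have kCA : kap C A = - kap A C.
  by rewrite kapC //= ?(@arc_ne 0 2 _ _ isT I01 I20) ?(@arc_ne 1 2 _ _ isT I10 I20)
    ?(@arc_ne 1 0 _ _ isT I10 I02) ?(eq_sym p01 p02).
have kCB : kap C B = - kap B C.
  by rewrite kapC //= ?(@arc_ne 1 2 _ _ isT I12 I20) ?(@arc_ne 1 0 _ _ isT I12 I02)
    ?(@arc_ne 2 0 _ _ isT I21 I02) ?(eq_sym p21 p20).
have [_ b0] := pm1_mul hm0 hsg; have [h1 b1] := pm1_mul hm1 hsg.
have [_ b2] := pm1_mul hs hsg.
have b1' : bsg (m1 * sigma < 0) = - (bsg (0 < m1) * bsg (0 < sigma)).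
  by rewrite -b1; case: h1 => ->; rewrite ?ltr01 ?ltr10 ?ltr0N1 ?ltrN10.
split=> //.
- by rewrite kBA rB.
- by rewrite kCA kAC opprB.
- by rewrite kCB kBC opprB.
- rewrite (sgnE hm0 hm1 sA) b2 /triangle_sign.
  by case: j; case: (0 < m0); case: (0 < m1); case: (0 < s2); case: (0 < sigma).
- rewrite (sgnE hm1 hs sB) b0 /triangle_sign.
  by case: j; case: (0 < m0); case: (0 < m1); case: (0 < s2); case: (0 < sigma).
- have hNm0 : - m0 = 1 \/ - m0 = -1.
    by case: hm0 => ->; [right|left]; rewrite ?opprK.
  have sC' : 0 < - m0 * s2 *
      (jac psi (crv E p20) * det2 (derive1 (crv E) p20) (derive1 (crv E) p02)).
    by rewrite !mulNr oppr_gt0.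
  rewrite (sgnE hNm0 hs sC') b1' (bsgN hm0) /triangle_sign.
  by case: j; case: (0 < m0); case: (0 < m1); case: (0 < s2); case: (0 < sigma).
move=> e /kap_e[[k1 k2 k3] [-> -> ->]]; rewrite k1 k2 k3.
by rewrite !opprB !subrKA subrr.
Qed.

End OneDiagram.
(** Of two disjoint closed arcs one precedes the other; otherwise the larger of their starts would
    lie on both. *)
Lemma lt_arcs k (a b : 'I_k -> R) i j x x' y y' : i != j ->
    (forall i j t, a i <= t <= b i -> a j <= t <= b j -> i = j) ->
    a i < x < b i -> a i < x' < b i -> a j < y < b j -> a j < y' < b j ->
  (x < y) = (x' < y').
Proof.
move=> /eqP ij disj /andP[ax xb] /andP[ax' xb'] /andP[ay yb] /andP[ay' yb'].
have [h|h] := ltP (b i) (a j).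
  by rewrite (lt_trans xb (lt_trans h ay)) (lt_trans xb' (lt_trans h ay')).
have [h'|h'] := ltP (b j) (a i).
  by rewrite !ltNge (ltW (lt_trans yb (lt_trans h' ax))) (ltW (lt_trans yb' (lt_trans h' ax'))).
case: ij; apply: (disj _ _ (Num.max (a i) (a j))).
  by rewrite le_max lexx ge_max h (ltW (lt_trans ax xb)).
by rewrite le_max lexx orbT ge_max h' (ltW (lt_trans ay yb)).
Qed.

Lemma nonpos_ends (f : R -> R) (p q : R) : continuous f -> p < q ->
  (forall t, p < t < q -> f t < 0) -> f p <= 0 /\ f q <= 0.
Proof.
move=> cf pq fneg; have pm : p < (p + q) / 2 by rewrite midf_lt.
have mq : (p + q) / 2 < q by rewrite midf_lt.
move: ((p + q) / 2) pm mq => m pm mq.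
have fm : (0 < f m) = false.
  by apply/negbTE; rewrite -leNgt; apply/ltW/fneg; rewrite pm.
split; rewrite leNgt; apply/negP => h.
  have : (0 < f p) = (0 < f m); last by rewrite h fm.
  apply: no_zero_sign; [exact: cf|exact: ltW|].
  move=> z /andP[]; rewrite le_eqVlt => /predU1P[<- _|pz zm]; first by rewrite gt_eqF.
  by rewrite lt_eqF // fneg // pz (le_lt_trans zm).
have : (0 < f m) = (0 < f q); last by rewrite h fm.
apply: no_zero_sign; [exact: cf|exact: ltW|].
move=> z /andP[mz]; rewrite le_eqVlt => /predU1P[->|zq]; first by rewrite gt_eqF.
by rewrite lt_eqF // fneg // zq (lt_le_trans pm).
Qed.

(** Since the arcs share their ends, the two diagrams are configurations with the same [m0], [m1]
    and [s2], and with [sigma] equal to -1 and 1. *)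
Lemma Hpoly_Omega3 D D' : Omega3 D D' -> Hpoly D = Hpoly D'.
Proof.
move=> [psi [a [b [lc [[diag0 diag1] side arc2 [lev _ levE]]]]]].
have lc' := local_change_sym lc.
have [dpsi [ab disj] _ _ _] := lc.
have bd i := local_change_boundary i lc; have bd' i := local_change_boundary i lc'.
have arcI i : 0 <= a i <= 1 /\ 0 <= b i <= 1.
  have [h1 h2 h3] := ab i; split; rewrite ?(ltW h1) ?(ltW h3) ?andbT //=.
    exact: ltW (lt_trans h2 h3).
  exact: ltW (lt_trans h1 h2).
have endE i : crv D' (a i) = crv D (a i) /\ crv D' (b i) = crv D (b i).
  have [na nb _ _] := bd i; have [ai bi] := arcI i.
  by split; [have [-> _] := crv_out lc ai na|have [-> _] := crv_out lc bi nb].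
pose w0 : R * R := (1, -1); pose w1 : R * R := (1, 1); pose e2 : R * R := (0, 1).
have w0E x : dot2 w0 x = x.1 - x.2 by rewrite /dot2 /= mul1r mulN1r.
have w1E x : dot2 w1 x = x.1 + x.2 by rewrite /dot2 /= !mul1r.
have e2E x : dot2 e2 x = x.2 by rewrite /dot2 /= mul0r add0r mul1r.
have sw0 : 0 < sqn w0 by rewrite /sqn /= sqrrN expr1n addr_gt0.
have sw1 : 0 < sqn w1 by rewrite /sqn /= expr1n addr_gt0.
have flat0 t : a 0 <= t <= b 0 -> dot2 w0 (psi (crv D t)) = 0.
  by move=> /diag0[_ h]; rewrite w0E h subrr.
have flat1 t : a 1 <= t <= b 1 -> dot2 w1 (psi (crv D t)) = 0.
  by move=> /diag1[_ h]; rewrite w1E h addNr.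
have [a00 ab0 b01] := ab 0; have [a10 ab1 b11] := ab 1.
have [a20 ab2 b21] := ab 2.
have [_ _ sa0 sb0] := bd 0; have [_ _ sa1 sb1] := bd 1; have [_ _ sa2 sb2] := bd 2.
have [m0 [hm0 _ mono0 _]] := straight_arc dpsi a00 ab0 b01 sw0 sa0 sb0 flat0.
have [m1 [hm1 _ mono1 _]] := straight_arc dpsi a10 ab1 b11 sw1 sa1 sb1 flat1.
(* The common ends are limits of points below the axis in [D] and above it in [D']. *)
have [ya yb] : (psi (crv D (a 2))).2 = 0 /\ (psi (crv D (b 2))).2 = 0.
  have [|h1 h2] := @nonpos_ends (fun t => dot2 e2 (psi (crv D t))) _ _
    (@continuous_coord R psi D e2 dpsi) ab2.
    by move=> t /side[h _]; rewrite e2E.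
  have [|h3 h4] := @nonpos_ends (fun t => dot2 (- e2) (psi (crv D' t))) _ _
    (@continuous_coord R psi D' (- e2) dpsi) ab2.
    by move=> t /side[_ h]; rewrite /dot2 /= oppr0 mul0r add0r mulN1r oppr_lt0.
  have [Ea Eb] := endE 2; rewrite e2E in h1; rewrite e2E in h2.
  rewrite /dot2 /= oppr0 mul0r add0r mulN1r Ea oppr_le0 in h3.
  rewrite /dot2 /= oppr0 mul0r add0r mulN1r Eb oppr_le0 in h4.
  by split; apply/eqP; rewrite eq_le ?h1 ?h2 ?h3 ?h4.
pose s2 := (psi (crv D (a 2))).1.
have hs2 : s2 = 1 \/ s2 = -1.
  move: sa2; rewrite /sqn ya expr0n addr0 -/s2 => /eqP.
  by rewrite sqrf_eq1 => /orP[] /eqP; [left|right].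
have start : psi (crv D (a 2)) = (s2, 0) by rewrite [LHS]surjective_pairing ya.
have cfg : triangle_config D psi a b (-1) m0 m1 s2.
  have [emb ex0 ex1] := arc2 D (or_introl erefl).
  split=> //.
  - exact: (odisc_inb lc).
  - by move=> i; have [] := bd i.
  - by right.
  - exact: mono0.
  - exact: mono1.
  - by move=> t /side[h _]; rewrite mulN1r oppr_gt0.
  - have [t [[h1 h2] h3]] := ex0; exists t; split.
      by rewrite h1 -/w0 w0E h2 subrr.
    move=> t' [k1 k2]; apply: h3; split=> //.
    by apply/eqP; rewrite -subr_eq0 -w0E; apply/eqP.
  - have [t [[h1 h2] h3]] := ex1; exists t; split.
      by rewrite h1 -/w1 w1E h2 addNr.
    move=> t' [k1 k2]; apply: h3; split=> //.
    by apply/eqP; rewrite -addr_eq0 -w1E; apply/eqP.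
have cfg' : triangle_config D' psi a b 1 m0 m1 s2.
  have [emb ex0 ex1] := arc2 D' (or_intror erefl).
  split=> //.
  - exact: (odisc_inb lc').
  - by move=> i; have [] := bd' i.
  - by move=> t h; have [<- _] := diag0 t h; apply: flat0.
  - by move=> t h; have [<- _] := diag1 t h; apply: flat1.
  - by left.
  - by have [-> ->] := endE 0; apply: mono0.
  - by have [-> ->] := endE 1; apply: mono1.
  - by have [-> _] := endE 2.
  - by have [_ ->] := endE 2.
  - by move=> t /side[_ h]; rewrite mul1r.
  - have [t [[h1 h2] h3]] := ex0; exists t; split.
      by rewrite h1 -/w0 w0E h2 subrr.
    move=> t' [k1 k2]; apply: h3; split=> //.
    by apply/eqP; rewrite -subr_eq0 -w0E; apply/eqP.
  - have [t [[h1 h2] h3]] := ex1; exists t; split.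
      by rewrite h1 -/w1 w1E h2 addNr.
    move=> t' [k1 k2]; apply: h3; split=> //.
    by apply/eqP; rewrite -addr_eq0 -w1E; apply/eqP.
have [p01 [p10 [p02 [p20 [p12 [p21 td]]]]]] := triangle_dataP cfg.
have [q01 [q10 [q02 [q20 [q12 [q21 td']]]]]] := triangle_dataP cfg'.
have outO e : e \in outer D a b -> e.1 != e.2 /\
    forall i, ~~ (a i < e.1 < b i) /\ ~~ (a i < e.2 < b i).
  move=> /(outerP lc)[[_ _ e12 _] [/inbP n1 /inbP n2]]; split=> // i.
  by split; apply/negP => h; [apply: n1|apply: n2]; exists i.
have T := triangle_of_data cfg td outO; have T' := triangle_of_data cfg' td' outO.
apply: (Hpoly_local_change lc (td_inner td) (td_inner td')) => N.
have [I01 I10 I02 I20 I12 I21 dA dB dC _ _ _ _ _ _ _] := td.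
have [J01 J10 J02 J20 J12 J21 dA' dB' dC' _ _ _ _ _ _ _] := td'.
have oo i x : a i < x < b i -> a i <= x <= b i.
  by move=> /andP[? ?]; rewrite !ltW.
(* Which strand is upper is decided by the levels of the two arcs, common to both diagrams. *)
have sameov i k x y x' y' : i != k -> a i < x < b i -> a k < y < b k ->
    a i < x' < b i -> a k < y' < b k -> double_pt (crv D) x y ->
    double_pt (crv D') x' y' -> ov D x = ov D' x'.
  move=> ik xI yI xI' yI' [_ _ _ h] [_ _ _ h'].
  rewrite (levE D (or_introl erefl) i k x y ik (oo _ _ xI) (oo _ _ yI) h).
  by rewrite (levE D' (or_intror erefl) i k x' y' ik (oo _ _ xI') (oo _ _ yI') h').
have neg_gt (m : R) : m = 1 \/ m = -1 -> (0 < m * 1) = ~~ (0 < m * -1).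
  by case=> ->; rewrite ?mulr1 ?mulrN1 ?opprK ltr01 ltr0N1.
have neg_lt (m : R) : m = 1 \/ m = -1 -> (m * 1 < 0) = ~~ (m * -1 < 0).
  by case=> ->; rewrite ?mulr1 ?mulrN1 ?opprK ltr10 ltrN10.
have Ksign : triangle_sign psi 1 m0 m1 s2 = - triangle_sign psi (-1) m0 m1 s2.
  by rewrite /triangle_sign ltr01 ltr0N1 /= -!mulrN opprK.
(* This is the invariance of [r]: it compares parameters of distinct arcs only. *)
have side12 : on_right (q01, q10) q21 = on_right (p01, p10) p21.
  rewrite /on_right /= (lt_arcs (k := 3) (i := 0) (j := 1) isT disj J01 I01 J10 I10).
  rewrite (lt_arcs (k := 3) (i := 0) (j := 2) isT disj J01 I01 J21 I21).
  by rewrite (lt_arcs (k := 3) (i := 2) (j := 1) isT disj J21 I21 J10 I10).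
rewrite Ksign side12 (neg_gt _ hm0) (neg_gt _ hs2) (neg_lt _ hm1) in T'.
have kapE e : e \in outer D a b ->
    [/\ kap (p01, p10) e = kap (q01, q10) e /\ kap e (p01, p10) = kap e (q01, q10),
        kap (p12, p21) e = kap (q12, q21) e /\ kap e (p12, p21) = kap e (q12, q21) &
        kap (p20, p02) e = kap (q20, q02) e /\ kap e (p20, p02) = kap e (q20, q02)].
  move=> eO; have [_ oe] := outO e eO.
  have [[-> -> ->] [-> -> ->]] := kap_e td outO eO.
  have [[-> -> ->] [-> -> ->]] := kap_e td' outO eO.
  rewrite (on_right_arc (oe 0).1 (oe 0).2 I01 J01).
  rewrite (on_right_arc (oe 1).1 (oe 1).2 I10 J10).
  by rewrite (on_right_arc (oe 2).1 (oe 2).2 I21 J21).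
apply: (Hsum_Omega3 _ (TriangleMove T T' _ _ _ _)).
- by move=> e /(outerP lc)[de [n1 _]]; apply: (csgn_out lc de n1).
- by move=> e /kapE[].
- by move=> e /kapE[].
- by move=> e /kapE[].
- exact: (sameov 0 1 _ _ _ _ isT I01 I10 J01 J10 dA dA').
- exact: (sameov 1 2 _ _ _ _ isT I12 I21 J12 J21 dB dB').
- exact: (sameov 2 0 _ _ _ _ isT I20 I02 J20 J02 dC dC').
by move=> e /(outerP lc)[[e01 _ _ _] [n1 _]]; have [_] := crv_out lc e01 n1.
Qed.

End Omega3.

Lemma closure_invariant (T U : Type) (r : T -> T -> Prop) (f : T -> U) :
  (forall x y, r x y -> f x = f y) ->
  forall x y, clos_refl_sym_trans T r x y -> f x = f y.
Proof. by move=> rf x y; elim=> // {x y} x y z _ -> _ ->. Qed.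

Lemma Hpoly_equiv (R : realType) (D D' : knotoid_diagram R) :
  knotoid_equiv D D' -> Hpoly D = Hpoly D'.
Proof.
apply: closure_invariant => {D D'} D D'.
by case; [exact: Hpoly_isotopy|exact: Hpoly_Omega1|exact: Hpoly_Omega2|exact: Hpoly_Omega3].
Qed.

Theorem theorem1p2 (R : realType) (D : knotoid_diagram R) :
  [/\ Hpoly (inverse D) = subst_tinv (Hpoly D),
      Hpoly (mirror D) = - subst_tinv (subst_zinv (Hpoly D)) &
      zero_height D -> Hpoly D = 0].
Proof.
split; [exact: Hpoly_inverse|exact: Hpoly_mirror|].
by move=> [D' /Hpoly_equiv ->]; apply: Hpoly_same_region.
Qed.
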